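(* Let $u(x,y),v(x,y)$ be conjugate harmonic functions on an open set $\Omega\subset\mathbb{R}^2$, i.e. $u_x=v_y$, $u_y=-v_x$. Let $n,m$ be natural numbers, let $\gamma_{1,1},\dots,\gamma_{1,n},\gamma_{2,1},\dots,\gamma_{2,m}$ be rectifiable (closed or unclosed) curves in the complex plane, and let $a_1(s),\dots,a_n(s)$, $b_1(s),\dots,b_m(s)$ be bounded (integrable) functions on these curves respectively. Let $$\varphi(u,v)=\sum_{j=1}^n\int_{\gamma_{1,j}}a_j(s)e^{su}J_0(sv)\,ds+\sum_{l=1}^m\int_{\gamma_{2,l}}b_l(s)e^{su}\Big(Y_0(sv)-\frac{2}{\pi}\ln(s)J_0(sv)\Big)ds,$$ and set $\psi(x,y)=\mathrm{Re}\,\varphi\big(u(x,y),v(x,y)\big)$. Then the geodesic flow of the metric $$ds^2=\Lambda(x,y)(dx^2+dy^2),\qquad \Lambda(x,y)=\psi_x^2(x,y)+\psi_y^2(x,y)$$ admits the rational first integral $$F=\frac{-(\psi_y u+\psi_x v)p_1+(\psi_x u-\psi_y v)p_2}{-\psi_y p_1+\psi_x p_2},$$ and $\Lambda(x,y)$ is an analytic function at the points where $v(x,y)\neq 0$. Moreover, if $b_l(s)\equiv 0$ for $l=1,\dots,m$, then $\Lambda(x,y)$ is an analytic function on the whole plane $(x,y)$ (i.e. on all of the domain $\Omega$ of $u,v$).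
   Context: $J_0$ and $Y_0$ are the Bessel functions of the first and second kind of order zero. The function $Y_0$ has the representation $Y_0(z)=\frac{2}{\pi}\ln\big(\frac{z}{2}\big)J_0(z)+\sum_{k=0}^\infty d_k z^{2k}$ with certain real coefficients $d_k$, the series converging on the whole complex plane; the expression $Y_0(sv)-\frac{2}{\pi}\ln(s)J_0(sv)$ denotes $\frac{2}{\pi}\ln\big(\frac{v}{2}\big)J_0(sv)+\sum_{k=0}^\infty d_k s^{2k}v^{2k}$, an entire function of $s$ for each real $v\ne0$. For a metric $ds^2=\Lambda(x,y)(dx^2+dy^2)$ with momenta $(p_1,p_2)$, the geodesic flow is the Hamiltonian system with $H=\frac{p_1^2+p_2^2}{2\Lambda}$ and canonical Poisson bracket $\{F,H\}=\sum_{i=1}^2\left(\frac{\partial F}{\partial x^i}\frac{\partial H}{\partial p_i}-\frac{\partial F}{\partial p_i}\frac{\partial H}{\partial x^i}\right)$, $x^1=x$, $x^2=y$; $F$ is a first integral if $\{F,H\}\equiv0$ wherever defined. *)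

(* Defs.v *)
From Stdlib Require Import Reals Factorial ClassicalEpsilon.
From Coquelicot Require Import Coquelicot.
Open Scope R_scope.

Notation CC := Complex.C.

Definition Cexp (z : CC) : CC :=
  (exp (Re z) * cos (Im z), exp (Re z) * sin (Im z)).

Fixpoint Cpow (z : CC) (k : nat) : CC :=
  match k with O => RtoC 1 | S k => Cmult (Cpow z k) z end.

Fixpoint Csum (a : nat -> CC) (n : nat) : CC :=
  match n with O => RtoC 0 | S n => Cplus (Csum a n) (a n) end.

Fixpoint Rsum (a : nat -> R) (n : nat) : R :=
  match n with O => 0 | S n => Rsum a n + a n end.

(** sum of a complex series (componentwise real series; correct whenever
    the complex series converges) *)
Definition CSeries (a : nat -> CC) : CC :=
  (Series (fun k => Re (a k)), Series (fun k => Im (a k))).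

Definition J0 (z : CC) : CC :=
  CSeries (fun k => Cmult (RtoC ((-1) ^ k / (INR (fact k)) ^ 2))
                          (Cpow (Cmult z (RtoC (/ 2))) (2 * k))).

Fixpoint harmonic (k : nat) : R :=
  match k with O => 0 | S k => harmonic k + / INR (S k) end.

Definition euler_gamma : R :=
  real (Lim_seq (fun n => harmonic n - ln (INR n))).

(** coefficients d_k in Y_0(z) = (2/pi) ln(z/2) J_0(z) + sum_k d_k z^(2k):
    d_k = (2/pi) (-1)^k (gamma - H_k) / (4^k (k!)^2) *)
Definition d_coef (k : nat) : R :=
  2 / PI * ((-1) ^ k * (euler_gamma - harmonic k) / (4 ^ k * (INR (fact k)) ^ 2)).

Definition Clog_real (r : R) : CC :=
  (ln (Rabs r), if Rlt_dec r 0 then PI else 0).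

(** Y_0(s v) - (2/pi) ln(s) J_0(s v)
    := (2/pi) ln(v/2) J_0(s v) + sum_k d_k s^(2k) v^(2k) *)
Definition Y0_reg (s : CC) (v : R) : CC :=
  Cplus (Cmult (Cmult (RtoC (2 / PI)) (Clog_real (v / 2))) (J0 (Cmult s (RtoC v))))
        (CSeries (fun k => Cmult (RtoC (d_coef k * v ^ (2 * k))) (Cpow s (2 * k)))).

Definition tagged_partition (n : nat) (t xi : nat -> R) : Prop :=
  t O = 0 /\ t n = 1 /\ forall k, (k < n)%nat -> t k <= xi k <= t (S k).

Definition RS_sum (f g : R -> CC) (n : nat) (t xi : nat -> R) : CC :=
  Csum (fun k => Cmult (f (xi k)) (Cminus (g (t (S k))) (g (t k)))) n.

Definition is_RS (f g : R -> CC) (I : CC) : Prop :=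
  forall eps, 0 < eps -> exists delta, 0 < delta /\
    forall n t xi, tagged_partition n t xi ->
      (forall k, (k < n)%nat -> t (S k) - t k < delta) ->
      Cmod (Cminus (RS_sum f g n t xi) I) < eps.

Definition RS_int (f g : R -> CC) : CC :=
  epsilon (inhabits (RtoC 0)) (is_RS f g).

Definition rectifiable (g : R -> CC) : Prop :=
  (forall t, 0 <= t <= 1 -> continuous g t) /\
  exists M, forall n (t : nat -> R), t O = 0 -> t n = 1 ->
    (forall k, (k < n)%nat -> t k <= t (S k)) ->
    Rsum (fun k => Cmod (Cminus (g (t (S k))) (g (t k)))) n <= M.

Definition curve_int (g : R -> CC) (h : CC -> CC) : CC :=
  RS_int (fun t => h (g t)) g.

Definition bounded_integrable_on (g : R -> CC) (a : CC -> CC) : Prop :=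
  (exists M, forall t, 0 <= t <= 1 -> Cmod (a (g t)) <= M) /\
  (forall h : R -> CC, (forall t, continuous h t) ->
     exists I, is_RS (fun t => Cmult (a (g t)) (h t)) g I).

Definition phi (n m : nat) (g1 : nat -> R -> CC) (a : nat -> CC -> CC)
  (g2 : nat -> R -> CC) (b : nat -> CC -> CC) (U V : R) : CC :=
  Cplus
   (Csum (fun j => curve_int (g1 j)
      (fun s => Cmult (Cmult (a j s) (Cexp (Cmult s (RtoC U)))) (J0 (Cmult s (RtoC V))))) n)
   (Csum (fun l => curve_int (g2 l)
      (fun s => Cmult (Cmult (b l s) (Cexp (Cmult s (RtoC U)))) (Y0_reg s V))) m).

Definition dx (f : R -> R -> R) (x y : R) : R := Derive (fun x' => f x' y) x.
Definition dy (f : R -> R -> R) (x y : R) : R := Derive (fun y' => f x y') y.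

Definition open2 (O : R -> R -> Prop) : Prop :=
  open (T := prod_UniformSpace R_UniformSpace R_UniformSpace)
       (fun p : R * R => O (fst p) (snd p)).

Definition C1_on (O : R -> R -> Prop) (f : R -> R -> R) : Prop :=
  forall x y, O x y ->
    ex_derive (fun x' => f x' y) x /\ ex_derive (fun y' => f x y') y /\
    continuous (T := prod_UniformSpace R_UniformSpace R_UniformSpace)
      (fun p : R * R => dx f (fst p) (snd p)) (x, y) /\
    continuous (T := prod_UniformSpace R_UniformSpace R_UniformSpace)
      (fun p : R * R => dy f (fst p) (snd p)) (x, y).

Definition real_analytic_at (f : R -> R -> R) (x0 y0 : R) : Prop :=
  exists r, 0 < r /\ exists c : nat -> nat -> R,
    forall x y, Rabs (x - x0) < r -> Rabs (y - y0) < r ->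
      (forall i, ex_series (fun j => Rabs (c i j) * Rabs (x - x0) ^ i * Rabs (y - y0) ^ j)) /\
      ex_series (fun i => Series (fun j => Rabs (c i j) * Rabs (x - x0) ^ i * Rabs (y - y0) ^ j)) /\
      f x y = Series (fun i => Series (fun j => c i j * (x - x0) ^ i * (y - y0) ^ j)).

Definition psi n m g1 a g2 b (u v : R -> R -> R) (x y : R) : R :=
  Re (phi n m g1 a g2 b (u x y) (v x y)).

Definition Lambda (ps : R -> R -> R) (x y : R) : R :=
  (dx ps x y) ^ 2 + (dy ps x y) ^ 2.

Definition Ham (ps : R -> R -> R) (x y p1 p2 : R) : R :=
  (p1 ^ 2 + p2 ^ 2) / (2 * Lambda ps x y).

Definition Fint (ps u v : R -> R -> R) (x y p1 p2 : R) : R :=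
  (- (dy ps x y * u x y + dx ps x y * v x y) * p1
     + (dx ps x y * u x y - dy ps x y * v x y) * p2)
  / (- dy ps x y * p1 + dx ps x y * p2).

Definition d4 (i : nat) (G : R -> R -> R -> R -> R) (x y p1 p2 : R) : R :=
  match i with
  | O => Derive (fun z => G z y p1 p2) x
  | 1%nat => Derive (fun z => G x z p1 p2) y
  | 2%nat => Derive (fun z => G x y z p2) p1
  | _ => Derive (fun z => G x y p1 z) p2
  end.

Definition ex_d4 (G : R -> R -> R -> R -> R) (x y p1 p2 : R) : Prop :=
  ex_derive (fun z => G z y p1 p2) x /\ ex_derive (fun z => G x z p1 p2) y /\
  ex_derive (fun z => G x y z p2) p1 /\ ex_derive (fun z => G x y p1 z) p2.

Definition poisson (F G : R -> R -> R -> R -> R) (x y p1 p2 : R) : R :=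
  d4 0 F x y p1 p2 * d4 2 G x y p1 p2 - d4 2 F x y p1 p2 * d4 0 G x y p1 p2
  + d4 1 F x y p1 p2 * d4 3 G x y p1 p2 - d4 3 F x y p1 p2 * d4 1 G x y p1 p2.

(* Main.v *)
From Stdlib Require Import Reals Lra Lia Factorial ClassicalEpsilon.
From Coquelicot Require Import Coquelicot.
Require Import Defs.
Open Scope R_scope.

(** The Poisson bracket of F with the Hamiltonian is
    - |p|^2 / (Lambda D) (v Lap psi + grad v . grad psi), where D is the denominator of F; so everything
    rests on this equation for psi and on analyticity.
    Analyticity is handled in the Banach algebra of double power series that converge absolutely on a box.
    The conjugate harmonic functions u, v belong to it by Cauchy's formula, obtained by contracting the
    circle to a point under truncated Cauchy kernels.
    Expanding in powers of s, exp(sU) J0(sV) = sum_q s^q W_q(U, V) with W_q homogeneous of degree q,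
    and similarly for Y0; hence psi is a series of the functions W_q(u, v) and their Y0-companions, with the
    real and imaginary parts of the moments int a(s) s^q ds as coefficients. The growth of the moments is
    geometric, that of the W_q inverse factorial, so the series converges in the Banach algebra, and the
    equation for psi follows term by term from the recurrences for the coefficients of J0 and Y0. *)

(** The hypotheses give [u] and [v] only continuous first derivatives, while the equation for [psi]
    contains second ones. Analyticity of [u] and [v] therefore has to precede every computation, and
    the route to it may use first derivatives only. On the side of [(U, V)] the equation is
    [V (W_UU + W_VV) + W_V = 0]. For [W = exp(sU) k(sV)] it becomes Bessel's equation of order zero
    for [k], which is where [J0] and [Y0] come from; composition with conjugate harmonic functions
    multiplies its left side by [|grad v|^2]. No derivative is taken under a curve integral: power
    series in [s] converge uniformly on a curve of finite length, so integration leaves moments that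
    no longer depend on the point. The logarithm restricts the general case to [v <> 0] and brings
    in a branch for negative [v]. The imaginary part of that branch is constant on each side of
    [v = 0] and multiplies a solution built from [J0]; on a box where [v] keeps its sign it is
    absorbed into the coefficients of the [J0] part. *)

(** * Series and absolutely summable double families of real numbers *)

Lemma sum_n_le (a b : nat -> R) (N : nat) :
  (forall i, (i <= N)%nat -> a i <= b i) -> sum_n a N <= sum_n b N.
Proof.
induction N as [|N IH]; intros H.
- rewrite !sum_O; apply H; lia.
- rewrite !sum_Sn; unfold plus; simpl.
  apply Rplus_le_compat; [apply IH; intros; apply H; lia|apply H; lia].
Qed.

Lemma sum_n_ge0 (a : nat -> R) (N : nat) :
  (forall i, 0 <= a i) -> 0 <= sum_n a N.
Proof.
intros H; induction N as [|N IH].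
- rewrite sum_O; apply H.
- rewrite sum_Sn; unfold plus; simpl; specialize (H (S N)); lra.
Qed.

Lemma sum_n_Rabs (a : nat -> R) (N : nat) :
  Rabs (sum_n a N) <= sum_n (fun i => Rabs (a i)) N.
Proof.
induction N as [|N IH].
- rewrite !sum_O; lra.
- rewrite !sum_Sn; unfold plus; simpl.
  eapply Rle_trans; [apply Rabs_triang|lra].
Qed.

Lemma ex_series_bounded (a : nat -> R) (M : R) :
  (forall n, 0 <= a n) -> (forall N, sum_n a N <= M) ->
  ex_series a /\ Series a <= M.
Proof.
intros H0 HM.
assert (E : ex_series a).
{ destruct (ex_finite_lim_seq_incr (sum_n a) M) as [l Hl]; trivial.
  - intros n; rewrite sum_Sn; unfold plus; simpl; specialize (H0 (S n)); lra.
  - exists l; exact Hl. }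
split; trivial.
apply Series_correct in E.
assert (L : Rbar_le (Series a) M).
{ apply (is_lim_seq_le (sum_n a) (fun _ => M)); [exact HM|exact E|apply is_lim_seq_const]. }
exact L.
Qed.

Lemma sum_n_le_Series (a : nat -> R) (N : nat) :
  (forall n, 0 <= a n) -> ex_series a -> sum_n a N <= Series a.
Proof.
intros H0 E; apply Series_correct in E.
apply (is_lim_seq_incr_compare (sum_n a)); [exact E|].
intros n; rewrite sum_Sn; unfold plus; simpl; specialize (H0 (S n)); lra.
Qed.

Lemma Series_ge0 (a : nat -> R) : (forall n, 0 <= a n) -> ex_series a -> 0 <= Series a.
Proof.
intros H0 E; eapply Rle_trans; [|apply (sum_n_le_Series a 0); trivial].
rewrite sum_O; apply H0.
Qed.

Lemma term_le_Series (a : nat -> R) (n : nat) :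
  (forall n, 0 <= a n) -> ex_series a -> a n <= Series a.
Proof.
intros H0 E; eapply Rle_trans; [|apply (sum_n_le_Series a n); trivial].
destruct n; [rewrite sum_O; lra|].
rewrite sum_Sn; unfold plus; simpl.
generalize (sum_n_ge0 a n H0); lra.
Qed.

Lemma is_series_sum_n (t : nat -> nat -> R) (N : nat) :
  (forall i, ex_series (t i)) ->
  is_series (fun j => sum_n (fun i => t i j) N) (sum_n (fun i => Series (t i)) N).
Proof.
intros H; induction N as [|N IH].
- rewrite sum_O; eapply is_series_ext; [|apply Series_correct, H].
  intros n; simpl; now rewrite sum_O.
- rewrite sum_Sn.
  generalize (is_series_plus _ _ _ _ IH (Series_correct _ (H (S N)))).
  apply is_series_ext; intros n; now rewrite sum_Sn.
Qed.

Lemma ex_series_dom (a b : nat -> R) :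
  (forall n, Rabs (a n) <= b n) -> ex_series b -> ex_series a.
Proof. intros H; exact (@ex_series_le R_AbsRing R_CompleteNormedModule a b H). Qed.

(** A power series evaluated at 1 splits into its even and odd parts. This lets a series in even
    powers be read as one in all powers, the form that Cauchy products need. *)
Lemma is_series_odd_zero (a : nat -> R) (l : R) :
  (forall k, a (S (2 * k)) = 0) -> is_series (fun k => a (2 * k)%nat) l -> is_series a l.
Proof.
intros H0 H.
assert (P := is_pseries_odd_even a 1 l 0).
assert (E : forall n, pow_n 1 n = 1) by (intros; rewrite pow_n_pow; apply pow1).
assert (E2 : forall n, pow_n (1 ^ 2) n = 1) by (intros; rewrite pow_n_pow, !pow1; trivial).
assert (Q : is_pseries a 1 (l + 1 * 0)).
{ apply P; unfold is_pseries.
  - revert H; apply is_series_ext; intros n.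
    rewrite E2; unfold scal; simpl; unfold mult; simpl; ring.
  - apply (is_series_ext (fun _ => 0)).
    + intros n; replace (2 * n + 1)%nat with (S (2 * n)) by lia; rewrite H0.
      unfold scal; simpl; unfold mult; simpl; ring.
    + assert (L : is_lim_seq (sum_n (fun _ : nat => 0)) 0); [|exact L].
      apply (is_lim_seq_ext (fun _ => 0)); [|apply is_lim_seq_const].
      intros n; rewrite sum_n_const; ring. }
replace (l + 1 * 0) with l in Q by ring.
revert Q; apply is_series_ext; intros n.
rewrite E; unfold scal; simpl; unfold mult; simpl; ring.
Qed.

(** Bounding all finite rectangles makes the notion symmetric in the two indices, since finite sums
    commute. Summability of rows, of columns and of the iterated series all follow from the single
    number [M]. *)
Definition abs2 (t : nat -> nat -> R) (M : R) : Prop :=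
  forall N K, sum_n (fun i => sum_n (fun j => Rabs (t i j)) K) N <= M.

Lemma abs2_ge0 t M : abs2 t M -> 0 <= M.
Proof.
intros H; eapply Rle_trans; [|apply (H 0%nat 0%nat)].
apply sum_n_ge0; intros; apply sum_n_ge0; intros; apply Rabs_pos.
Qed.

Lemma abs2_le t t' M : (forall i j, Rabs (t' i j) <= Rabs (t i j)) -> abs2 t M -> abs2 t' M.
Proof.
intros H A N K; eapply Rle_trans; [|apply (A N K)].
apply sum_n_le; intros; apply sum_n_le; intros; apply H.
Qed.

Lemma abs2_swap t M : abs2 t M -> abs2 (fun i j => t j i) M.
Proof.
intros A N K; rewrite (sum_n_switch (fun i j => Rabs (t j i))); apply A.
Qed.

Lemma abs2_row_le t M i : abs2 t M -> forall K, sum_n (fun j => Rabs (t i j)) K <= M.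
Proof.
intros A K; eapply Rle_trans; [|apply (A i K)].
assert (P : forall i, 0 <= sum_n (fun j => Rabs (t i j)) K).
{ intros; apply sum_n_ge0; intros; apply Rabs_pos. }
destruct i; [rewrite sum_O; lra|].
rewrite sum_Sn; unfold plus; simpl.
assert (Q := sum_n_ge0 (fun i => sum_n (fun j => Rabs (t i j)) K) i P); lra.
Qed.

Lemma abs2_row t M i : abs2 t M -> ex_series (fun j => Rabs (t i j)).
Proof.
intros A; apply (ex_series_bounded _ M); [intros; apply Rabs_pos|].
intros; now apply abs2_row_le.
Qed.

Lemma abs2_row' t M i : abs2 t M -> ex_series (t i).
Proof. intros A; apply ex_series_Rabs; now apply abs2_row with M. Qed.

Lemma abs2_rows t M : abs2 t M ->
  ex_series (fun i => Series (fun j => Rabs (t i j))) /\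
  Series (fun i => Series (fun j => Rabs (t i j))) <= M.
Proof.
intros A; apply ex_series_bounded.
- intros i; apply Series_ge0; [intros; apply Rabs_pos|now apply abs2_row with M].
- intros N.
  assert (S := is_series_sum_n (fun i j => Rabs (t i j)) N (fun i => abs2_row t M i A)).
  assert (L : Rbar_le (sum_n (fun i => Series (fun j => Rabs (t i j))) N) M); [|exact L].
  eapply is_lim_seq_le; [|exact S|apply is_lim_seq_const].
  intros K; simpl; rewrite (sum_n_switch (fun j i => Rabs (t i j))); apply A.
Qed.

Lemma abs2_rows' t M : abs2 t M -> ex_series (fun i => Series (t i)).
Proof.
intros A; apply (ex_series_dom _ (fun i => Series (fun j => Rabs (t i j)))); [|now apply (abs2_rows t M)].
intros i.
apply Series_Rabs; now apply abs2_row with M.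
Qed.

Lemma abs2_nested t (b : nat -> R) :
  (forall i K, sum_n (fun j => Rabs (t i j)) K <= b i) -> ex_series b -> abs2 t (Series b).
Proof.
intros H E N K; eapply Rle_trans; [apply sum_n_le; intros; apply H|].
apply sum_n_le_Series; trivial.
intros n; eapply Rle_trans; [|apply (H n 0%nat)].
apply sum_n_ge0; intros; apply Rabs_pos.
Qed.

(** Finitely many rows may be summed under the inner series, and a partial sum of a column is at
    most the whole column. The reverse inequality is the same fact for the transposed family. *)
Lemma fubini_le t M : (forall i j, 0 <= t i j) -> abs2 t M ->
  Series (fun i => Series (t i)) <= Series (fun j => Series (fun i => t i j)).
Proof.
intros H0 A; assert (A' := abs2_swap _ _ A).
assert (B := ex_series_bounded (fun i => Series (t i))
   (Series (fun j => Series (fun i => t i j)))).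
apply B.
- intros i; apply Series_ge0; [apply H0|now apply abs2_row' with M].
- intros N.
  assert (S := is_series_sum_n t N (fun i => abs2_row' t M i A)).
  rewrite <- (is_series_unique _ _ S).
  apply Series_le.
  + intros j; split; [apply sum_n_ge0; intros; apply H0|].
    apply (sum_n_le_Series (fun i => t i j)); [intros; apply H0|].
    apply (abs2_row' (fun j i => t i j) M j A').
  + apply (abs2_rows' (fun j i => t i j) M A').
Qed.

Lemma fubini_pos t M : (forall i j, 0 <= t i j) -> abs2 t M ->
  Series (fun i => Series (t i)) = Series (fun j => Series (fun i => t i j)).
Proof.
intros H0 A; apply Rle_antisym.
- now apply fubini_le with M.
- apply (fubini_le (fun j i => t i j) M); [intros; apply H0|now apply abs2_swap].
Qed.

Lemma fubini t M : abs2 t M ->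
  Series (fun i => Series (t i)) = Series (fun j => Series (fun i => t i j)).
Proof.
intros A; assert (A' := abs2_swap _ _ A).
assert (AA : abs2 (fun i j => Rabs (t i j)) M).
{ apply abs2_le with t; trivial; intros; rewrite Rabs_Rabsolu; lra. }
assert (AA' := abs2_swap _ _ AA).
(* The signed family is the difference of the nonnegative families [|t| + t] and [|t|]. *)
assert (AP : abs2 (fun i j => Rabs (t i j) + t i j) (2 * M)).
{ intros N K; eapply Rle_trans.
  - apply (sum_n_le _ (fun i => 2 * sum_n (fun j => Rabs (t i j)) K)).
    intros i _; rewrite <- (sum_n_mult_l (K := R_Ring) 2).
    apply sum_n_le; intros; unfold mult; simpl.
    eapply Rle_trans; [apply Rabs_triang|rewrite Rabs_Rabsolu; lra].
  - rewrite (sum_n_mult_l (K := R_Ring) 2); unfold mult; simpl.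
    apply Rmult_le_compat_l; [lra|apply A]. }
assert (E1 := fubini_pos _ _ (fun i j => Rabs_pos (t i j)) AA).
assert (P : forall i j, 0 <= Rabs (t i j) + t i j).
{ intros; unfold Rabs; destruct Rcase_abs; lra. }
assert (E2 := fubini_pos _ _ P AP).
rewrite (Series_ext _ (fun i => Series (fun j => Rabs (t i j)) + Series (t i))) in E2
  by (intros i; apply Series_plus; [now apply abs2_row with M|now apply abs2_row' with M]).
rewrite (Series_ext (fun j => Series (fun i => Rabs (t i j) + t i j))
  (fun j => Series (fun i => Rabs (t i j)) + Series (fun i => t i j))) in E2
  by (intros j; apply Series_plus;
      [now apply (abs2_row (fun j i => t i j) M)|now apply (abs2_row' (fun j i => t i j) M)]).
rewrite !Series_plus in E2.
- lra.
- apply (abs2_rows (fun j i => t i j) M A').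
- apply (abs2_rows' (fun j i => t i j) M A').
- apply (abs2_rows t M A).
- apply (abs2_rows' t M A).
Qed.

(** * Absolutely convergent double power series *)

Lemma Series_single (a : nat -> R) : (forall n, a (S n) = 0) -> is_series a (a 0%nat).
Proof.
intros H; assert (L : is_lim_seq (sum_n a) (a 0%nat)); [|exact L].
apply (is_lim_seq_ext (fun _ => a 0%nat)); [|apply is_lim_seq_const].
intros n; induction n as [|n IH]; [now rewrite sum_O|].
rewrite sum_Sn, <- IH, H; unfold plus; simpl; ring.
Qed.

Lemma Series_0 (a : nat -> R) : (forall n, a n = 0) -> Series a = 0.
Proof.
intros H; rewrite <- (H 0%nat); apply is_series_unique, Series_single; intros; apply H.
Qed.

Lemma sum_n_shift_le (a : nat -> R) N :
  (forall n, 0 <= a n) -> sum_n (fun i => a (S i)) N <= sum_n a (S N).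
Proof.
intros H; induction N as [|N IH].
- rewrite sum_Sn, !sum_O; unfold plus; simpl; specialize (H 0%nat); lra.
- rewrite sum_Sn, (sum_Sn a); unfold plus; simpl; lra.
Qed.

Lemma abs2_shift t M : abs2 t M -> abs2 (fun i j => t (S i) j) M.
Proof.
intros A N K.
eapply Rle_trans; [apply (sum_n_shift_le (fun i => sum_n (fun j => Rabs (t i j)) K))|apply A].
intros; apply sum_n_ge0; intros; apply Rabs_pos.
Qed.

Lemma abs2_scal t M k : abs2 t M -> abs2 (fun i j => k * t i j) (Rabs k * M).
Proof.
intros A N K.
eapply Rle_trans; [|apply Rmult_le_compat_l; [apply Rabs_pos|apply (A N K)]].
rewrite <- (sum_n_mult_l (K := R_Ring)); right.
apply sum_n_ext; intros i.
rewrite <- (sum_n_mult_l (K := R_Ring)).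
apply sum_n_ext; intros j; apply Rabs_mult.
Qed.

Definition ev (c : nat -> nat -> R) (X Y : R) : R :=
  Series (fun i => Series (fun j => c i j * X ^ i * Y ^ j)).

(* M bounds the norm of the coefficients in the Banach algebra l^1 with weights r^(i+j). *)
Definition AN (x0 y0 r : R) (c : nat -> nat -> R) (M : R) (f : R -> R -> R) : Prop :=
  abs2 (fun i j => c i j * r ^ i * r ^ j) M /\
  forall x y, Rabs (x - x0) <= r -> Rabs (y - y0) <= r -> f x y = ev c (x - x0) (y - y0).

Lemma pow_abs_le X r n : Rabs X <= r -> Rabs (X ^ n) <= r ^ n.
Proof.
intros H; rewrite <- RPow_abs; apply pow_incr; split; [apply Rabs_pos|trivial].
Qed.

Lemma abs2_box r c M X Y : Rabs X <= r -> Rabs Y <= r ->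
  abs2 (fun i j => c i j * r ^ i * r ^ j) M -> abs2 (fun i j => c i j * X ^ i * Y ^ j) M.
Proof.
intros HX HY; apply abs2_le; intros i j; rewrite !Rabs_mult.
assert (0 <= r) by (eapply Rle_trans; [apply Rabs_pos|apply HX]).
rewrite (Rabs_pos_eq (r ^ i)), (Rabs_pos_eq (r ^ j)) by (apply pow_le; trivial).
apply Rmult_le_compat.
- apply Rmult_le_pos; apply Rabs_pos.
- apply Rabs_pos.
- apply Rmult_le_compat_l; [apply Rabs_pos|now apply pow_abs_le].
- now apply pow_abs_le.
Qed.

Lemma AN_ext x0 y0 r c M f g :
  (forall x y, Rabs (x - x0) <= r -> Rabs (y - y0) <= r -> f x y = g x y) ->
  AN x0 y0 r c M f -> AN x0 y0 r c M g.
Proof. intros H [A E]; split; trivial; intros; rewrite <- H; auto. Qed.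

Lemma AN_mono x0 y0 r c M M' f : M <= M' -> AN x0 y0 r c M f -> AN x0 y0 r c M' f.
Proof. intros H [A E]; split; trivial; intros N K; specialize (A N K); lra. Qed.

Lemma AN_shrink x0 y0 r r' c M f : 0 <= r' <= r -> AN x0 y0 r c M f -> AN x0 y0 r' c M f.
Proof.
intros H [A E]; split.
- apply abs2_box with r; trivial; rewrite Rabs_pos_eq; lra.
- intros; apply E; lra.
Qed.

Definition const_coef (k : R) (i j : nat) : R :=
  match i, j with O, O => k | _, _ => 0 end.

Lemma AN_const x0 y0 r k : AN x0 y0 r (const_coef k) (Rabs k) (fun _ _ => k).
Proof.
split.
- intros N K.
  assert (E : forall i, sum_n (fun j => Rabs (const_coef k i j * r ^ i * r ^ j)) K =
     match i with O => Rabs k | _ => 0 end).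
  { intros i; induction K as [|K IH]; [rewrite sum_O|rewrite sum_Sn, IH; unfold plus];
    destruct i; simpl; rewrite ?Rmult_0_l, ?Rmult_1_r, ?Rabs_R0; ring. }
  right; rewrite (sum_n_ext _ _ N E).
  clear; induction N as [|N IH]; [now rewrite sum_O|rewrite sum_Sn, IH; unfold plus; simpl; ring].
- intros x y _ _; unfold ev; symmetry.
  rewrite (is_series_unique _ (Series (fun j => const_coef k 0 j * (x - x0) ^ 0 * (y - y0) ^ j))).
  + rewrite (is_series_unique _ (const_coef k 0 0 * (x - x0) ^ 0 * (y - y0) ^ 0)).
    * simpl; ring.
    * apply (Series_single (fun j => const_coef k 0 j * (x - x0) ^ 0 * (y - y0) ^ j)).
      intros; simpl; ring.
  + apply (Series_single (fun i => Series (fun j => const_coef k i j * (x - x0) ^ i * (y - y0) ^ j))).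
    intros n; apply Series_0; intros; simpl; ring.
Qed.

Lemma AN_scal x0 y0 r c M f k : AN x0 y0 r c M f ->
  AN x0 y0 r (fun i j => k * c i j) (Rabs k * M) (fun x y => k * f x y).
Proof.
intros [A E]; split.
- generalize (abs2_scal _ _ k A); apply abs2_le; intros; right; f_equal; ring.
- intros x y Hx Hy; rewrite E by trivial; unfold ev.
  rewrite <- Series_scal_l; apply Series_ext; intros i.
  rewrite <- Series_scal_l; apply Series_ext; intros j; ring.
Qed.

Lemma AN_plus x0 y0 r c M f c' M' f' : AN x0 y0 r c M f -> AN x0 y0 r c' M' f' ->
  AN x0 y0 r (fun i j => c i j + c' i j) (M + M') (fun x y => f x y + f' x y).
Proof.
intros [A E] [A' E']; split.
- intros N K; eapply Rle_trans; [|apply Rplus_le_compat; [apply (A N K)|apply (A' N K)]].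
  rewrite <- (sum_n_plus (G := R_AbelianMonoid)); apply sum_n_le; intros i _.
  rewrite <- (sum_n_plus (G := R_AbelianMonoid)); apply sum_n_le; intros j _.
  unfold plus; simpl; eapply Rle_trans; [|apply Rabs_triang].
  right; f_equal; ring.
- intros x y Hx Hy; rewrite E, E' by trivial; unfold ev.
  assert (B := abs2_box _ _ _ _ _ Hx Hy A); assert (B' := abs2_box _ _ _ _ _ Hx Hy A').
  rewrite <- Series_plus; [|exact (abs2_rows' _ _ B)|exact (abs2_rows' _ _ B')].
  apply Series_ext; intros i.
  rewrite <- Series_plus; [|exact (abs2_row' _ _ i B)|exact (abs2_row' _ _ i B')].
  apply Series_ext; intros j; ring.
Qed.

Lemma AN_swap x0 y0 r c M f : AN x0 y0 r c M f ->
  AN y0 x0 r (fun i j => c j i) M (fun x y => f y x).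
Proof.
intros [A E]; split.
- generalize (abs2_swap _ _ A); apply abs2_le; intros; right; f_equal; ring.
- intros x y Hx Hy; rewrite E by trivial; unfold ev.
  rewrite (fubini _ M) by now apply abs2_box with r.
  apply Series_ext; intros i; apply Series_ext; intros j; ring.
Qed.

Definition shiftX (c : nat -> nat -> R) (i j : nat) : R :=
  match i with O => 0 | S i => c i j end.

Lemma AN_mulX x0 y0 r c M f : 0 <= r -> AN x0 y0 r c M f ->
  AN x0 y0 r (shiftX c) (r * M) (fun x y => (x - x0) * f x y).
Proof.
intros Hr [A E]; split.
- assert (P := abs2_scal _ _ r A); rewrite (Rabs_pos_eq r Hr) in P.
  intros [|N] K.
  + rewrite sum_O; eapply Rle_trans; [|apply (abs2_ge0 _ _ P)].
    right; rewrite (sum_n_ext _ (fun _ => 0)), sum_n_const; [ring|].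
    intros; simpl; rewrite !Rmult_0_l; apply Rabs_R0.
  + eapply Rle_trans; [|apply (P N K)].
    unfold sum_n at 1; rewrite sum_Sn_m by lia.
    rewrite (sum_n_ext _ (fun _ => 0)), sum_n_const, Rmult_0_r.
    2:{ intros; simpl; rewrite !Rmult_0_l; apply Rabs_R0. }
    rewrite <- sum_n_m_S; unfold plus; simpl; rewrite Rplus_0_l.
    apply sum_n_le; intros; apply sum_n_le; intros; right; f_equal; ring.
- intros x y Hx Hy; rewrite E by trivial; unfold ev.
  assert (B := abs2_box _ _ _ _ _ Hx Hy A).
  rewrite (Series_incr_1 (fun i => Series (fun j => shiftX c i j * _ ^ i * _ ^ j))).
  + rewrite (Series_0 (fun j => shiftX c 0 j * _ ^ 0 * _ ^ j)) by (intros; simpl; ring).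
    rewrite Rplus_0_l, <- Series_scal_l; apply Series_ext; intros i.
    rewrite <- Series_scal_l; apply Series_ext; intros j; simpl; ring.
  + apply ex_series_incr_1.
    apply (ex_series_ext (fun i => scal (x - x0) (Series (fun j => c i j * (x - x0) ^ i * (y - y0) ^ j)))).
    * intros i; unfold scal; simpl; unfold mult; simpl.
      rewrite <- Series_scal_l; apply Series_ext; intros j; simpl; ring.
    * apply (ex_series_scal (K := R_AbsRing) (V := R_NormedModule)); exact (abs2_rows' _ _ B).
Qed.

Lemma abs2_coef_le t M i j : abs2 t M -> Rabs (t i j) <= M.
Proof.
intros A; eapply Rle_trans; [|apply (abs2_row_le _ _ i A j)].
destruct j; [rewrite sum_O; lra|rewrite sum_Sn; unfold plus; simpl].
assert (0 <= sum_n (fun j => Rabs (t i j)) j); [|lra].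
apply sum_n_ge0; intros; apply Rabs_pos.
Qed.

(** Completeness of the algebra, with the coefficients of the sum made explicit. Convergence for
    each single coefficient is what later allows a linear relation between Taylor coefficients to be
    summed term by term. *)
Lemma AN_series x0 y0 r (c : nat -> nat -> nat -> R) (Mn : nat -> R) (f : nat -> R -> R -> R) F :
  0 < r -> (forall n, AN x0 y0 r (c n) (Mn n) (f n)) -> ex_series Mn ->
  (forall x y, Rabs (x - x0) <= r -> Rabs (y - y0) <= r -> F x y = Series (fun n => f n x y)) ->
  AN x0 y0 r (fun i j => Series (fun n => c n i j)) (Series Mn) F /\
  forall i j, ex_series (fun n => c n i j).
Proof.
intros Hr H EM HF.
assert (Hc : forall n i j, Rabs (c n i j * r ^ i * r ^ j) <= Mn n).
{ intros n i j; apply (abs2_coef_le _ _ i j (proj1 (H n))). }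
assert (Ea : forall i j, ex_series (fun n => Rabs (c n i j * r ^ i * r ^ j))).
{ intros i j; apply (ex_series_dom _ Mn); trivial.
  intros n; rewrite Rabs_Rabsolu; apply Hc. }
assert (Er : forall i j, r ^ i * r ^ j <> 0).
{ intros; apply Rmult_integral_contrapositive; split; apply pow_nonzero; lra. }
assert (Ec : forall i j, ex_series (fun n => c n i j)).
{ intros i j.
  apply (ex_series_ext (fun n => scal (/ (r ^ i * r ^ j)) (c n i j * r ^ i * r ^ j))).
  - intros n; unfold scal; simpl; unfold mult; simpl; field.
    split; apply pow_nonzero; lra.
  - apply (ex_series_scal (K := R_AbsRing) (V := R_NormedModule)), ex_series_Rabs, Ea. }
split; [|exact Ec]; split.
- intros N K.
  assert (S1 : forall i, is_series (fun n => sum_n (fun j => Rabs (c n i j * r ^ i * r ^ j)) K)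
     (sum_n (fun j => Series (fun n => Rabs (c n i j * r ^ i * r ^ j))) K)).
  { intros i; apply (is_series_sum_n (fun j n => Rabs (c n i j * r ^ i * r ^ j))).
    intros j; apply Ea. }
  assert (S2 := is_series_sum_n (fun i n => sum_n (fun j => Rabs (c n i j * r ^ i * r ^ j)) K) N
      (fun i => ex_intro _ _ (S1 i))).
  apply Rle_trans with
   (sum_n (fun i => Series (fun n => sum_n (fun j => Rabs (c n i j * r ^ i * r ^ j)) K)) N).
  + apply sum_n_le; intros i _; rewrite (is_series_unique _ _ (S1 i)).
    apply sum_n_le; intros j _.
    rewrite <- !Series_scal_r; apply Series_Rabs, Ea.
  + rewrite <- (is_series_unique _ _ S2); apply Series_le; trivial.
    intros n; split; [|apply (proj1 (H n))].
    apply sum_n_ge0; intros; apply sum_n_ge0; intros; apply Rabs_pos.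
- intros x y Hx Hy; rewrite HF by trivial; unfold ev.
  assert (B : forall n, abs2 (fun i j => c n i j * (x - x0) ^ i * (y - y0) ^ j) (Mn n)).
  { intros n; apply abs2_box with r; trivial; apply H. }
  rewrite (Series_ext _ (fun n => Series (fun i => Series (fun j => c n i j * (x - x0) ^ i * (y - y0) ^ j))))
   by (intros n; now apply (proj2 (H n))).
  (* The index [n] is exchanged with [i], then with [j] inside each fixed row; both double families
     are dominated by [Mn]. *)
  rewrite (fubini _ (Series Mn)).
  + apply Series_ext; intros i; rewrite (fubini _ (Series Mn)).
    * apply Series_ext; intros j; now rewrite <- !Series_scal_r.
    * apply abs2_nested; trivial; intros n K; apply (abs2_row_le _ _ i (B n)).
  + apply abs2_nested; trivial; intros n K.
    eapply Rle_trans; [|apply (proj2 (abs2_rows _ _ (B n)))].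
    eapply Rle_trans; [apply sum_n_le; intros i _; apply Series_Rabs; exact (abs2_row _ _ i (B n))|].
    apply sum_n_le_Series; [|exact (proj1 (abs2_rows _ _ (B n)))].
    intros i; apply Series_ge0; [intros; apply Rabs_pos|exact (abs2_row _ _ i (B n))].
Qed.

(** Existential form of [AN]: closure under algebraic operations requires only the norm bound to be
    tracked, and the coefficients are recovered by choice when a series is summed. *)
Definition AE (x0 y0 r M : R) (f : R -> R -> R) : Prop := exists c, AN x0 y0 r c M f.

Lemma AE_ge0 x0 y0 r M f : AE x0 y0 r M f -> 0 <= M.
Proof. intros [c [A _]]; now apply abs2_ge0 in A. Qed.

Lemma AE_ext x0 y0 r M f g :
  (forall x y, Rabs (x - x0) <= r -> Rabs (y - y0) <= r -> f x y = g x y) ->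
  AE x0 y0 r M f -> AE x0 y0 r M g.
Proof. intros H [c A]; exists c; now apply AN_ext with f. Qed.

Lemma AE_mono x0 y0 r M M' f : M <= M' -> AE x0 y0 r M f -> AE x0 y0 r M' f.
Proof. intros H [c A]; exists c; now apply AN_mono with M. Qed.

Lemma AE_shrink x0 y0 r r' M f : 0 <= r' <= r -> AE x0 y0 r M f -> AE x0 y0 r' M f.
Proof. intros H [c A]; exists c; now apply AN_shrink with r. Qed.

Lemma AE_const x0 y0 r k : AE x0 y0 r (Rabs k) (fun _ _ => k).
Proof. eexists; apply AN_const. Qed.

Lemma AE_scal x0 y0 r M f k : AE x0 y0 r M f -> AE x0 y0 r (Rabs k * M) (fun x y => k * f x y).
Proof. intros [c A]; eexists; apply AN_scal, A. Qed.

Lemma AE_plus x0 y0 r M f M' f' : AE x0 y0 r M f -> AE x0 y0 r M' f' ->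
  AE x0 y0 r (M + M') (fun x y => f x y + f' x y).
Proof. intros [c A] [c' A']; eexists; apply AN_plus; eassumption. Qed.

Lemma AE_swap x0 y0 r M f : AE x0 y0 r M f -> AE y0 x0 r M (fun x y => f y x).
Proof. intros [c A]; eexists; apply AN_swap, A. Qed.

Lemma AE_mulX x0 y0 r M f : 0 <= r -> AE x0 y0 r M f ->
  AE x0 y0 r (r * M) (fun x y => (x - x0) * f x y).
Proof. intros Hr [c A]; eexists; now apply AN_mulX, A. Qed.

Lemma AE_mulY x0 y0 r M f : 0 <= r -> AE x0 y0 r M f ->
  AE x0 y0 r (r * M) (fun x y => (y - y0) * f x y).
Proof.
intros Hr A.
exact (AE_swap _ _ _ _ _ (AE_mulX _ _ _ _ _ Hr (AE_swap _ _ _ _ _ A))).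
Qed.

Lemma AE_series x0 y0 r (Mn : nat -> R) (f : nat -> R -> R -> R) F :
  0 < r -> (forall n, AE x0 y0 r (Mn n) (f n)) -> ex_series Mn ->
  (forall x y, Rabs (x - x0) <= r -> Rabs (y - y0) <= r -> F x y = Series (fun n => f n x y)) ->
  AE x0 y0 r (Series Mn) F.
Proof.
intros Hr H EM HF.
pose (c n := proj1_sig (constructive_indefinite_description _ (H n))).
eexists; apply (AN_series x0 y0 r c Mn f F); trivial.
intros n; exact (proj2_sig (constructive_indefinite_description _ (H n))).
Qed.

Lemma AE_monom x0 y0 r M f i j : 0 <= r -> AE x0 y0 r M f ->
  AE x0 y0 r (r ^ i * r ^ j * M) (fun x y => (x - x0) ^ i * (y - y0) ^ j * f x y).
Proof.
intros Hr A.
assert (A1 : AE x0 y0 r (r ^ j * M) (fun x y => (y - y0) ^ j * f x y)).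
{ induction j as [|j IH].
  - simpl; rewrite Rmult_1_l; revert A; apply AE_ext; intros; ring.
  - generalize (AE_mulY _ _ _ _ _ Hr IH); simpl; rewrite <- Rmult_assoc.
    apply AE_ext; intros; ring. }
induction i as [|i IH].
- simpl; rewrite Rmult_1_l; revert A1; apply AE_ext; intros; ring.
- generalize (AE_mulX _ _ _ _ _ Hr IH); simpl; rewrite <- !Rmult_assoc.
  apply AE_ext; intros; ring.
Qed.

(** No Cauchy product of double sequences is formed. The factor [g] is expanded into monomials,
    multiplication of [f] by a monomial multiplies the norm bound by [r^(i+j)], and closure under
    series, applied to [j] and then to [i], gives the product. *)
Lemma AE_mult x0 y0 r M f N g : 0 < r -> AE x0 y0 r M f -> AE x0 y0 r N g ->
  AE x0 y0 r (M * N) (fun x y => f x y * g x y).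
Proof.
intros Hr A [d [B E]].
assert (M0 := AE_ge0 _ _ _ _ _ A).
set (w i j := Rabs (d i j * r ^ i * r ^ j)).
assert (Br := abs2_rows _ _ B).
assert (T : forall i j, AE x0 y0 r (w i j * M)
   (fun x y => d i j * ((x - x0) ^ i * (y - y0) ^ j * f x y))).
{ intros i j; generalize (AE_scal _ _ _ _ _ (d i j) (AE_monom _ _ _ _ _ i j (Rlt_le _ _ Hr) A)).
  apply AE_mono; right; unfold w.
  rewrite !Rabs_mult, (Rabs_pos_eq (r ^ i)), (Rabs_pos_eq (r ^ j)) by (apply pow_le; lra); ring. }
assert (T1 : forall i, AE x0 y0 r (Series (fun j => w i j * M))
   (fun x y => Series (fun j => d i j * ((x - x0) ^ i * (y - y0) ^ j * f x y)))).
{ intros i; eapply AE_series; trivial.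
  - intros j; apply T.
  - apply ex_series_scal_r, (abs2_row _ _ i B).
  - reflexivity. }
apply AE_mono with (Series (fun i => Series (fun j => w i j * M))).
{ rewrite (Series_ext _ (fun i => Series (fun j => w i j) * M)) by (intros; apply Series_scal_r).
  rewrite Series_scal_r, Rmult_comm; apply Rmult_le_compat_l; trivial; apply Br. }
eapply AE_series; trivial; [exact T1| |].
- apply (ex_series_ext (fun i => Series (fun j => w i j) * M)).
  + intros; symmetry; apply Series_scal_r.
  + apply ex_series_scal_r, Br.
- intros x y Hx Hy; cbv beta; rewrite E by trivial; unfold ev.
  rewrite <- Series_scal_l; apply Series_ext; intros i.
  rewrite <- Series_scal_l; apply Series_ext; intros j; ring.
Qed.

Lemma AE_pow x0 y0 r M f n : 0 < r -> AE x0 y0 r M f ->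
  AE x0 y0 r (M ^ n) (fun x y => f x y ^ n).
Proof.
intros Hr A; induction n as [|n IH]; simpl.
- generalize (AE_const x0 y0 r 1); now rewrite Rabs_R1.
- now apply AE_mult.
Qed.

Lemma ev_0 c : ev c 0 0 = c 0%nat 0%nat.
Proof.
unfold ev.
rewrite (is_series_unique _ (Series (fun j => c 0%nat j * 0 ^ 0 * 0 ^ j))).
- rewrite (is_series_unique _ (c 0%nat 0%nat * 0 ^ 0 * 0 ^ 0)); [simpl; ring|].
  apply (Series_single (fun j => c 0%nat j * 0 ^ 0 * 0 ^ j)); intros; simpl; ring.
- apply (Series_single (fun i => Series (fun j => c i j * 0 ^ i * 0 ^ j))).
  intros n; apply Series_0; intros; simpl; ring.
Qed.

Lemma AN_center x0 y0 r c M f : 0 <= r -> AN x0 y0 r c M f -> f x0 y0 = c 0%nat 0%nat.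
Proof.
intros Hr [_ E]; rewrite E by (rewrite Rminus_diag, Rabs_R0; trivial).
rewrite !Rminus_diag; apply ev_0.
Qed.

(* Removing the value at the centre makes the norm small on small boxes. *)
Lemma AE_shrink_center x0 y0 r M f q : 0 < r -> 0 <= q <= 1 -> AE x0 y0 r M f ->
  AE x0 y0 (q * r) (q * (M + Rabs (f x0 y0))) (fun x y => f x y - f x0 y0).
Proof.
intros Hr Hq [c A].
assert (C := AN_center _ _ _ _ _ _ (Rlt_le _ _ Hr) A).
assert (A1 := AN_plus _ _ _ _ _ _ _ _ _ A (AN_const x0 y0 r (- f x0 y0))).
rewrite Rabs_Ropp in A1.
set (d := fun i j => c i j + const_coef (- f x0 y0) i j) in A1.
assert (D0 : d 0%nat 0%nat = 0) by (unfold d; simpl; lra).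
assert (Hqr : 0 <= q * r <= r) by nra.
destruct (AN_shrink _ _ _ _ _ _ _ Hqr A1) as [_ E].
exists d; split.
- generalize (abs2_scal _ _ q (proj1 A1)); rewrite (Rabs_pos_eq q) by apply Hq.
  apply abs2_le; intros i j; rewrite !Rpow_mult_distr.
  replace (d i j * (q ^ i * r ^ i) * (q ^ j * r ^ j)) with
    (q ^ (i + j) * (d i j * r ^ i * r ^ j)) by (rewrite pow_add; ring).
  rewrite !(Rabs_mult (q ^ _)), !(Rabs_mult q).
  destruct (i + j)%nat as [|k] eqn:Eij.
  + replace i with 0%nat by lia; replace j with 0%nat by lia; rewrite D0.
    rewrite !Rmult_0_l, Rabs_R0; lra.
  + apply Rmult_le_compat_r; [apply Rabs_pos|].
    rewrite !Rabs_pos_eq; [|lra|apply pow_le; lra].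
    simpl; rewrite <- (Rmult_1_r q) at 3; apply Rmult_le_compat_l; [lra|].
    rewrite <- (pow1 k); apply pow_incr; lra.
- intros x y Hx Hy; rewrite <- E by trivial; ring.
Qed.

(** * Termwise differentiation on a smaller box *)

Definition dXc (c : nat -> nat -> R) (i j : nat) : R := INR (S i) * c (S i) j.
Definition dYc (c : nat -> nat -> R) (i j : nat) : R := INR (S j) * c i (S j).

(** Each of the [n + 1] copies of [q^n] is at most one of [1, q, ..., q^n]. The bound absorbs the
    factor [i + 1] produced by differentiation, at the price of a smaller radius. *)
Lemma INR_pow_bound q n : 0 <= q < 1 -> INR (S n) * q ^ n <= / (1 - q).
Proof.
intros Hq.
apply Rle_trans with (sum_n (fun k => q ^ k) n).
- rewrite Rmult_comm, <- (Rmult_comm (INR (S n))), <- sum_n_const.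
  apply sum_n_le; intros i Hi.
  replace n with (i + (n - i))%nat at 1 by lia; rewrite pow_add.
  assert (0 <= q ^ i) by (apply pow_le; lra).
  assert (q ^ (n - i) <= 1) by (rewrite <- (pow1 (n - i)); apply pow_incr; lra).
  nra.
- rewrite <- Series_geom by (rewrite Rabs_pos_eq; lra).
  apply sum_n_le_Series; [intros; apply pow_le; lra|].
  apply ex_series_geom; rewrite Rabs_pos_eq; lra.
Qed.

Lemma abs2_dXc c r r' M : 0 <= r' < r -> abs2 (fun i j => c i j * r ^ i * r ^ j) M ->
  exists M', abs2 (fun i j => dXc c i j * r' ^ i * r' ^ j) M'.
Proof.
intros Hr A; eexists.
(* The factor [1 / (1 - r' / r)] pays for [INR (S i)], and [/ r] for the exponent lowered by the
   derivative. *)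
generalize (abs2_scal _ _ (/ (1 - r' / r) * / r) (abs2_shift _ _ A)).
apply abs2_le; intros i j; unfold dXc; rewrite !Rabs_mult.
assert (Q : 0 <= r' / r < 1).
{ split; [apply Rdiv_le_0_compat; lra|].
  apply Rmult_lt_reg_r with r; [lra|]; unfold Rdiv; rewrite Rmult_assoc, Rinv_l; lra. }
assert (B := INR_pow_bound _ i Q).
replace r' with (r' / r * r) at 1 2 by (field; lra); set (q := r' / r) in *.
rewrite !Rpow_mult_distr, !Rabs_mult.
assert (P : forall z k, 0 <= z -> Rabs (z ^ k) = z ^ k)
  by (intros; apply Rabs_pos_eq, pow_le; trivial).
rewrite !P, (Rabs_pos_eq (INR (S i))), (Rabs_pos_eq (/ (1 - q))), (Rabs_pos_eq (/ r)) by
  (try apply pos_INR; try lra; apply Rlt_le, Rinv_0_lt_compat; lra).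
assert (Qj : 0 <= q ^ j <= 1).
{ split; [apply pow_le; lra|rewrite <- (pow1 j); apply pow_incr; lra]. }
assert (R0 : 0 <= r ^ i) by (apply pow_le; lra).
assert (R1 : 0 <= r ^ j) by (apply pow_le; lra).
assert (C0 := Rabs_pos (c (S i) j)).
simpl pow.
replace (/ (1 - q) * / r * (Rabs (c (S i) j) * (r * r ^ i) * r ^ j)) with
  (/ (1 - q) * (Rabs (c (S i) j) * r ^ i * r ^ j)) by (field; lra).
replace (INR (S i) * Rabs (c (S i) j) * (q ^ i * r ^ i) * (q ^ j * r ^ j)) with
  ((INR (S i) * q ^ i) * q ^ j * (Rabs (c (S i) j) * r ^ i * r ^ j)) by ring.
apply Rmult_le_compat_r; [repeat apply Rmult_le_pos; trivial|].
assert (0 <= INR (S i) * q ^ i) by (apply Rmult_le_pos; [apply pos_INR|apply pow_le; lra]).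
nra.
Qed.

(** For frozen [Y] the double series is a power series in [X] whose coefficients are the row sums
    [C i]; its radius is at least [r] because its terms at [r] are bounded by [M]. *)
Lemma ev_derive c r M X Y : Rabs X < r -> Rabs Y <= r ->
  abs2 (fun i j => c i j * r ^ i * r ^ j) M ->
  is_derive (fun X => ev c X Y) X (ev (dXc c) X Y).
Proof.
intros HX HY A.
assert (Hr : 0 < r) by (eapply Rle_lt_trans; [apply Rabs_pos|apply HX]).
set (C i := Series (fun j => c i j * Y ^ j)).
assert (E : forall X, ev c X Y = PSeries C X).
{ intros Z; apply Series_ext; intros i; unfold C; rewrite <- Series_scal_r.
  apply Series_ext; intros; ring. }
assert (CR : Rbar_lt (Rabs X) (CV_radius C)).
{ apply Rbar_lt_le_trans with r; [exact HX|].
  apply CV_radius_bounded; exists M; intros n.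
  assert (Rr : Rabs r <= r) by (rewrite Rabs_pos_eq; lra).
  assert (B := abs2_box _ _ _ r Y Rr HY A).
  unfold C; rewrite <- Series_scal_r.
  rewrite (Series_ext _ (fun j => c n j * r ^ n * Y ^ j)) by (intros; ring).
  eapply Rle_trans; [apply Series_Rabs; exact (abs2_row _ _ n B)|].
  apply ex_series_bounded; [intros; apply Rabs_pos|].
  intros; apply (abs2_row_le _ _ n B). }
assert (D := is_derive_PSeries C X CR).
apply (is_derive_ext (PSeries C)); [intros; symmetry; apply E|].
replace (ev (dXc c) X Y) with (PSeries (PS_derive C) X); trivial.
apply Series_ext; intros i; unfold PS_derive, C, dXc.
rewrite <- Series_scal_l, <- Series_scal_r; apply Series_ext; intros; ring.
Qed.

Lemma AN_is_derive_x x0 y0 r c M f x y : AN x0 y0 r c M f ->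
  Rabs (x - x0) < r -> Rabs (y - y0) <= r ->
  is_derive (fun x => f x y) x (ev (dXc c) (x - x0) (y - y0)).
Proof.
intros [A E] Hx Hy.
apply (is_derive_ext_loc (fun x => ev c (x - x0) (y - y0))).
- assert (P : 0 < r - Rabs (x - x0)) by lra.
  exists (mkposreal _ P); intros z Hz.
  unfold ball in Hz; simpl in Hz; unfold AbsRing_ball, abs, minus, plus, opp in Hz; simpl in Hz.
  symmetry; apply E; trivial.
  replace (z - x0) with ((z + - x) + (x - x0)) by ring.
  eapply Rle_trans; [apply Rabs_triang|lra].
- assert (D := ev_derive c r M (x - x0) (y - y0) Hx Hy A).
  replace (ev (dXc c) (x - x0) (y - y0)) with (1 * ev (dXc c) (x - x0) (y - y0)) by ring.
  apply (is_derive_comp (fun X => ev c X (y - y0)) (fun x => x - x0)); trivial.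
  auto_derive; trivial; ring.
Qed.

Lemma AN_dx x0 y0 r r' c M f : 0 <= r' < r -> AN x0 y0 r c M f ->
  exists M', AN x0 y0 r' (dXc c) M' (dx f).
Proof.
intros Hr A; destruct (abs2_dXc _ _ _ _ Hr (proj1 A)) as [M' A'].
exists M'; split; trivial.
intros x y Hx Hy; apply is_derive_unique; apply (AN_is_derive_x _ _ _ _ _ _ _ _ A); lra.
Qed.

Lemma AN_is_derive_y x0 y0 r c M f x y : AN x0 y0 r c M f ->
  Rabs (x - x0) <= r -> Rabs (y - y0) < r ->
  is_derive (fun y => f x y) y (ev (dXc (fun i j => c j i)) (y - y0) (x - x0)).
Proof.
intros A Hx Hy; apply (AN_is_derive_x _ _ _ _ _ _ y x (AN_swap _ _ _ _ _ _ A)); trivial.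
Qed.

Lemma AN_dy x0 y0 r r' c M f : 0 <= r' < r -> AN x0 y0 r c M f ->
  exists M', AN x0 y0 r' (dYc c) M' (dy f).
Proof.
intros Hr A.
destruct (AN_dx _ _ _ _ _ _ _ Hr (AN_swap _ _ _ _ _ _ A)) as [M' A'].
exists M'; exact (AN_swap _ _ _ _ _ _ A').
Qed.

(** * Analyticity of conjugate harmonic functions *)

Lemma continuity_2d_pt_comp f g h x y :
  continuity_2d_pt f (g x y) (h x y) -> continuity_2d_pt g x y -> continuity_2d_pt h x y ->
  continuity_2d_pt (fun x y => f (g x y) (h x y)) x y.
Proof.
intros Hf Hg Hh eps.
destruct (Hf eps) as [d Hd], (Hg d) as [d1 H1], (Hh d) as [d2 H2].
assert (P : 0 < Rmin d1 d2) by (apply Rmin_pos; apply cond_pos).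
exists (mkposreal _ P); simpl; intros a b Ha Hb.
assert (Rmin d1 d2 <= d1) by apply Rmin_l; assert (Rmin d1 d2 <= d2) by apply Rmin_r.
apply Hd; [apply H1|apply H2]; lra.
Qed.

Lemma continuity_2d_pt_slice f x y :
  continuity_2d_pt f x y -> continuous (fun y => f x y) y.
Proof.
intros H; apply continuity_pt_filterlim; intros eps He.
destruct (H (mkposreal _ He)) as [d Hd]; exists d; split; [apply cond_pos|].
intros z [_ Hz]; apply Hd; [rewrite Rminus_diag, Rabs_R0; apply cond_pos|exact Hz].
Qed.

Lemma continuity_2d_pt_snd f x y : continuous f y -> continuity_2d_pt (fun _ y => f y) x y.
Proof.
intros H; apply (continuity_1d_2d_pt_comp f (fun _ y => y)).
- now apply continuity_pt_filterlim.
- apply continuity_2d_pt_id2.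
Qed.

Lemma ex_RInt_cont (f : R -> R) a b : (forall t, continuous f t) -> ex_RInt f a b.
Proof. intros H; apply (ex_RInt_continuous (V := R_CompleteNormedModule)); intros; apply H. Qed.

(* Equalities between real integrals are stated in the carrier of a normed module. *)
Ltac eqR := match goal with |- ?a = ?b => change (@eq R a b) end.

Lemma RInt_extR (f g : R -> R) a b : (forall t, f t = g t) -> RInt f a b = RInt g a b.
Proof. intros H; apply RInt_ext; intros; apply H. Qed.

Lemma RInt_plusR (f g : R -> R) a b : (forall t, continuous f t) -> (forall t, continuous g t) ->
  RInt (fun t => f t + g t) a b = RInt f a b + RInt g a b.
Proof. intros Hf Hg; apply (RInt_plus (V := R_CompleteNormedModule)); now apply ex_RInt_cont. Qed.

Lemma RInt_scalR (f : R -> R) a b k : (forall t, continuous f t) ->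
  RInt (fun t => k * f t) a b = k * RInt f a b.
Proof. intros Hf; apply (RInt_scal (V := R_CompleteNormedModule)); now apply ex_RInt_cont. Qed.

Lemma continuous_Rmult (f g : R -> R) t : continuous f t -> continuous g t ->
  continuous (fun t => f t * g t) t.
Proof. intros; now apply (continuous_mult (K := R_AbsRing)). Qed.

Lemma continuous_Rplus (f g : R -> R) t : continuous f t -> continuous g t ->
  continuous (fun t => f t + g t) t.
Proof. intros; now apply (continuous_plus (V := R_NormedModule)). Qed.

Lemma continuous_Rminus (f g : R -> R) t : continuous f t -> continuous g t ->
  continuous (fun t => f t - g t) t.
Proof. intros; now apply (continuous_minus (V := R_NormedModule)). Qed.

Lemma continuous_Rsum (f : nat -> R -> R) N t : (forall n, continuous (f n) t) ->
  continuous (fun t => Rsum (fun n => f n t) N) t.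
Proof.
intros H; induction N as [|N IH]; simpl; [apply continuous_const|].
now apply continuous_Rplus.
Qed.

Lemma RInt_Rsum (f : nat -> R -> R) N a b : (forall n t, continuous (f n) t) ->
  RInt (fun t => Rsum (fun n => f n t) N) a b = Rsum (fun n => RInt (f n) a b) N.
Proof.
intros H; induction N as [|N IH]; simpl.
- rewrite RInt_const; apply Rmult_0_r.
- rewrite RInt_plusR, IH; trivial.
  intros; now apply continuous_Rsum.
Qed.

Lemma Rsum_sum_n a N : sum_n a N = Rsum a (S N).
Proof.
induction N as [|N IH]; [rewrite sum_O; symmetry; apply Rplus_0_l|].
rewrite sum_Sn, IH; reflexivity.
Qed.

Lemma Rsum_ext a b N : (forall n, (n < N)%nat -> a n = b n) -> Rsum a N = Rsum b N.
Proof.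
intros H; induction N as [|N IH]; simpl; trivial.
rewrite IH, (H N) by (intros; auto with arith); trivial.
Qed.

Lemma Rsum_plus a b N : Rsum (fun n => a n + b n) N = Rsum a N + Rsum b N.
Proof. induction N as [|N IH]; simpl; [ring|rewrite IH; ring]. Qed.

Lemma Rsum_scal k a N : Rsum (fun n => k * a n) N = k * Rsum a N.
Proof. induction N as [|N IH]; simpl; [ring|rewrite IH; ring]. Qed.

(** * Truncated Cauchy kernels in real form *)

Definition PRe (x y : R) (n : nat) : R := Re (Cpow (x, y) n).
Definition PIm (x y : R) (n : nat) : R := Im (Cpow (x, y) n).

Lemma PRe_S x y n : PRe x y (S n) = x * PRe x y n - y * PIm x y n.
Proof. unfold PRe, PIm, Re, Im; simpl; ring. Qed.

Lemma PIm_S x y n : PIm x y (S n) = x * PIm x y n + y * PRe x y n.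
Proof. unfold PRe, PIm, Re, Im; simpl; ring. Qed.

Lemma PRe_PIm_sq x y n : PRe x y n ^ 2 + PIm x y n ^ 2 = (x ^ 2 + y ^ 2) ^ n.
Proof.
induction n as [|n IH]; [unfold PRe, PIm; simpl; ring|].
rewrite PRe_S, PIm_S, <- (tech_pow_Rmult _ n), <- IH; ring.
Qed.

(* Real and imaginary parts of (z e^{-it} / R)^n for z = x + iy. *)
Definition kc (R0 x y : R) (n : nat) (t : R) : R :=
  (PRe x y n * cos (INR n * t) + PIm x y n * sin (INR n * t)) / R0 ^ n.
Definition ks (R0 x y : R) (n : nat) (t : R) : R :=
  (PIm x y n * cos (INR n * t) - PRe x y n * sin (INR n * t)) / R0 ^ n.

(** The real and imaginary parts of [R0 e^{it} q^(n+1) = z q^n] for [q = z e^{-it} / R0]. *)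
Lemma kc_ks_step R0 x y n t : R0 <> 0 ->
  R0 * (cos t * kc R0 x y (S n) t - sin t * ks R0 x y (S n) t) =
    x * kc R0 x y n t - y * ks R0 x y n t /\
  R0 * (cos t * ks R0 x y (S n) t + sin t * kc R0 x y (S n) t) =
    x * ks R0 x y n t + y * kc R0 x y n t.
Proof.
intros H; unfold kc, ks; rewrite PRe_S, PIm_S.
replace (INR (S n) * t) with (INR n * t + t) by (rewrite S_INR; ring).
rewrite cos_plus, sin_plus.
set (P := PRe x y n); set (Q := PIm x y n); set (C := cos (INR n * t)); set (D := sin (INR n * t)).
assert (E := sin2_cos2 t); unfold Rsqr in E.
assert (HR : R0 ^ n <> 0) by now apply pow_nonzero.
assert (E' : sin t * sin t = 1 - cos t * cos t) by lra.
split.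
- apply Rmult_eq_reg_r with (R0 ^ n); trivial.
  transitivity ((x * (P * C + Q * D) - y * (Q * C - P * D)) * (sin t * sin t + cos t * cos t)).
  + simpl; field; split; trivial.
  + rewrite E; field; trivial.
- apply Rmult_eq_reg_r with (R0 ^ n); trivial.
  transitivity ((x * (Q * C - P * D) + y * (P * C + Q * D)) * (sin t * sin t + cos t * cos t)).
  + simpl; field; split; trivial.
  + rewrite E; field; trivial.
Qed.

(* (R e^{it} - z) sum_{n<N} q^n = R e^{it} (1 - q^N) *)
Lemma kernel_sum R0 x y N t : R0 <> 0 ->
  (R0 * cos t - x) * Rsum (fun n => kc R0 x y n t) N - (R0 * sin t - y) * Rsum (fun n => ks R0 x y n t) N
  = R0 * (cos t * (1 - kc R0 x y N t) + sin t * ks R0 x y N t) /\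
  (R0 * cos t - x) * Rsum (fun n => ks R0 x y n t) N + (R0 * sin t - y) * Rsum (fun n => kc R0 x y n t) N
  = R0 * (sin t * (1 - kc R0 x y N t) - cos t * ks R0 x y N t).
Proof.
intros H; induction N as [|N [IH1 IH2]].
- simpl; unfold kc, ks, PRe, PIm; simpl; rewrite Rmult_0_l, cos_0, sin_0; split; field.
- destruct (kc_ks_step R0 x y N t H) as [E1 E2]; simpl Rsum.
  split.
  + transitivity ((R0 * (cos t * (1 - kc R0 x y N t) + sin t * ks R0 x y N t)) +
      R0 * (cos t * kc R0 x y N t - sin t * ks R0 x y N t) - (x * kc R0 x y N t - y * ks R0 x y N t)).
    * rewrite <- IH1; ring.
    * rewrite <- E1; ring.
  + transitivity ((R0 * (sin t * (1 - kc R0 x y N t) - cos t * ks R0 x y N t)) +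
      R0 * (cos t * ks R0 x y N t + sin t * kc R0 x y N t) - (x * ks R0 x y N t + y * kc R0 x y N t)).
    * rewrite <- IH2; ring.
    * rewrite <- E2; ring.
Qed.

Lemma Rabs_le_of_sq a b c : 0 <= c -> a ^ 2 + b ^ 2 <= c ^ 2 -> Rabs a <= c /\ Rabs b <= c.
Proof.
intros Hc H; split; apply Rabs_le; nra.
Qed.

(** [kc] and [ks] are the components of [q^n], and [|q| = |z| / R0] is at most 1/2 here. *)
Lemma kc_ks_bound R0 x y n t : 0 < R0 -> x ^ 2 + y ^ 2 <= (R0 / 2) ^ 2 ->
  Rabs (kc R0 x y n t) <= (/ 2) ^ n /\ Rabs (ks R0 x y n t) <= (/ 2) ^ n.
Proof.
intros H Hz; apply Rabs_le_of_sq; [apply pow_le; lra|].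
assert (HR : R0 ^ n <> 0) by (apply pow_nonzero; lra).
assert (E := sin2_cos2 (INR n * t)); unfold Rsqr in E.
replace (kc R0 x y n t ^ 2 + ks R0 x y n t ^ 2) with ((PRe x y n ^ 2 + PIm x y n ^ 2) / (R0 ^ n) ^ 2 *
 (sin (INR n * t) * sin (INR n * t) + cos (INR n * t) * cos (INR n * t))) by (unfold kc, ks; field; trivial).
rewrite E, Rmult_1_r, PRe_PIm_sq, <- !pow_mult, !(Nat.mul_comm n 2), !pow_mult.
unfold Rdiv; rewrite <- pow_inv, <- Rpow_mult_distr; apply pow_incr.
assert (0 < R0 ^ 2) by nra.
assert (0 < / R0 ^ 2) by now apply Rinv_0_lt_compat.
split; [nra|].
apply Rmult_le_reg_r with (R0 ^ 2); trivial.
rewrite Rmult_assoc, Rinv_l by lra; nra.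
Qed.

Lemma continuous_kc R0 x y n t : continuous (kc R0 x y n) t.
Proof. apply (ex_derive_continuous (kc R0 x y n)); unfold kc; auto_derive; trivial. Qed.
Lemma continuous_ks R0 x y n t : continuous (ks R0 x y n) t.
Proof. apply (ex_derive_continuous (ks R0 x y n)); unfold ks; auto_derive; trivial. Qed.

Lemma RInt_trig n : (0 < n)%nat ->
  is_RInt (fun t => cos (INR n * t)) 0 (2 * PI) 0 /\ is_RInt (fun t => sin (INR n * t)) 0 (2 * PI) 0.
Proof.
intros Hn; assert (H : INR n <> 0) by (apply not_0_INR; lia).
assert (E : INR n * (2 * PI) = 0 + 2 * INR n * PI) by ring.
split.
- replace 0 with (minus (sin (INR n * (2 * PI)) / INR n) (sin (INR n * 0) / INR n)) at 2.
  + apply (is_RInt_derive (V := R_CompleteNormedModule) (fun t => sin (INR n * t) / INR n)).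
    * intros; auto_derive; trivial; field; trivial.
    * intros; apply (ex_derive_continuous (fun t => cos (INR n * t))); auto_derive; trivial.
  + rewrite E, sin_period, Rmult_0_r, sin_0; unfold minus, plus, opp; simpl; field; trivial.
- replace 0 with (minus (- cos (INR n * (2 * PI)) / INR n) (- cos (INR n * 0) / INR n)) at 2.
  + apply (is_RInt_derive (V := R_CompleteNormedModule) (fun t => - cos (INR n * t) / INR n)).
    * intros; auto_derive; trivial; field; trivial.
    * intros; apply (ex_derive_continuous (fun t => sin (INR n * t))); auto_derive; trivial.
  + rewrite E, cos_period, Rmult_0_r, cos_0; unfold minus, plus, opp; simpl; field; trivial.
Qed.

(** On natural numbers [if n] takes its first branch for [O]. *)
Lemma RInt_cos_sin n : RInt (fun t => cos (INR n * t)) 0 (2 * PI) = (if n then 2 * PI else 0) /\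
  RInt (fun t => sin (INR n * t)) 0 (2 * PI) = 0.
Proof.
destruct n as [|n].
- simpl; rewrite (RInt_ext _ (fun _ => 1)), (RInt_ext (fun t => sin _) (fun _ => 0)), !RInt_const.
  + unfold scal; simpl; unfold mult; simpl; split; ring.
  + intros; now rewrite Rmult_0_l, sin_0.
  + intros; now rewrite Rmult_0_l, cos_0.
- destruct (RInt_trig (S n)) as [A B]; [lia|].
  split; now apply is_RInt_unique.
Qed.

(** The mean of [q^n] over the circle vanishes except for [n = 0]; so the integral of the whole
    truncated kernel is [2 * PI] for every positive length. *)
Lemma RInt_kc_ks R0 x y n :
  RInt (kc R0 x y n) 0 (2 * PI) = (if n then 2 * PI else 0) /\ RInt (ks R0 x y n) 0 (2 * PI) = 0.
Proof.
destruct (RInt_cos_sin n) as [A B].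
assert (Cc : forall t, continuous (fun t => cos (INR n * t)) t)
  by (intros t; apply (ex_derive_continuous (fun t => cos (INR n * t))); auto_derive; trivial).
assert (Cs : forall t, continuous (fun t => sin (INR n * t)) t)
  by (intros t; apply (ex_derive_continuous (fun t => sin (INR n * t))); auto_derive; trivial).
unfold kc, ks; split.
- rewrite (RInt_extR _ (fun t => PRe x y n / R0 ^ n * cos (INR n * t) + PIm x y n / R0 ^ n * sin (INR n * t)))
    by (intros; unfold Rdiv; ring).
  rewrite RInt_plusR, !RInt_scalR, A, B; trivial.
  + eqR; destruct n; [unfold PRe; simpl; field|ring].
  + intros; apply continuous_Rmult; [apply continuous_const|apply Cc].
  + intros; apply continuous_Rmult; [apply continuous_const|apply Cs].
- rewrite (RInt_extR _ (fun t => PIm x y n / R0 ^ n * cos (INR n * t) + (- PRe x y n / R0 ^ n) * sin (INR n * t)))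
    by (intros; unfold Rdiv; ring).
  rewrite RInt_plusR, !RInt_scalR, A, B; trivial.
  + eqR; destruct n; [unfold PIm; simpl; field|ring].
  + intros; apply continuous_Rmult; [apply continuous_const|apply Cc].
  + intros; apply continuous_Rmult; [apply continuous_const|apply Cs].
Qed.

(* (ux, -vx) and (vx, ux) are the gradients of u and v: the Cauchy-Riemann equations are built in. *)
Record CRbox (u v ux vx : R -> R -> R) (x0 y0 rho D : R) : Prop := {
  CRu : forall x y, Rabs (x - x0) < rho -> Rabs (y - y0) < rho ->
    differentiable_pt_lim u x y (ux x y) (- vx x y);
  CRv : forall x y, Rabs (x - x0) < rho -> Rabs (y - y0) < rho ->
    differentiable_pt_lim v x y (vx x y) (ux x y);
  CRcu : forall x y, Rabs (x - x0) < rho -> Rabs (y - y0) < rho -> continuity_2d_pt ux x y;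
  CRcv : forall x y, Rabs (x - x0) < rho -> Rabs (y - y0) < rho -> continuity_2d_pt vx x y;
  CRb : forall x y, Rabs (x - x0) < rho -> Rabs (y - y0) < rho ->
    Rabs (u x y) <= D /\ Rabs (v x y) <= D /\ Rabs (ux x y) <= D /\ Rabs (vx x y) <= D }.

(** Multiplying [u + iv] by [-i] gives [v - iu], so a result about the real part also covers the
    imaginary part. *)
Lemma CRbox_rot u v ux vx x0 y0 rho D : CRbox u v ux vx x0 y0 rho D ->
  CRbox v (fun x y => - u x y) vx (fun x y => - ux x y) x0 y0 rho D.
Proof.
intros [A B C E F]; split; trivial; intros x y Hx Hy.
- rewrite Ropp_involutive; auto.
- intros eps; destruct (A x y Hx Hy eps) as [d Hd]; exists d; intros a b Ha Hb.
  specialize (Hd a b Ha Hb); rewrite <- Rabs_Ropp.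
  eapply Rle_trans; [|exact Hd]; right; f_equal; ring.
- now apply continuity_2d_pt_opp, C.
- rewrite !Rabs_Ropp; destruct (F x y Hx Hy) as [? [? [? ?]]]; auto.
Qed.

(* Homotopy l |-> z + l (R e^{it} - z) from z = x + iy (relative to the centre) to the circle. *)
Definition hX (x0 R0 x l t : R) : R := x0 + x + l * (R0 * cos t - x).
Definition hY (y0 R0 y l t : R) : R := y0 + y + l * (R0 * sin t - y).

(** An open interval around [[0, 1]] provides two-sided derivatives in [l] at both ends. Since [|l|]
    and [|1 - l|] stay below 3/2, the value stays below [3/8 R0 + 3/2 R0], whence the half-width
    [2 R0] of the box. *)
Lemma homotopy_bound R0 x l c : 0 < R0 -> Rabs x <= R0 / 4 -> - / 2 < l < 3 / 2 -> -1 <= c <= 1 ->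
  Rabs (x + l * (R0 * c - x)) < 2 * R0.
Proof.
intros HR Hx Hl Hc.
replace (x + l * (R0 * c - x)) with ((1 - l) * x + l * (R0 * c)) by ring.
eapply Rle_lt_trans; [apply Rabs_triang|rewrite !Rabs_mult, (Rabs_pos_eq R0) by lra].
assert (Rabs (1 - l) * Rabs x <= 3 / 2 * (R0 / 4)).
{ apply Rmult_le_compat; trivial; try apply Rabs_pos; apply Rabs_le; lra. }
assert (Rabs l * (R0 * Rabs c) <= 3 / 2 * (R0 * 1)).
{ assert (Rabs c <= 1) by (apply Rabs_le; lra); assert (Hc0 := Rabs_pos c).
  apply Rmult_le_compat; [apply Rabs_pos|nra|apply Rabs_le; lra|nra]. }
lra.
Qed.

Lemma hXY_box x0 y0 R0 x y l t : 0 < R0 -> Rabs x <= R0 / 4 -> Rabs y <= R0 / 4 -> - / 2 < l < 3 / 2 ->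
  Rabs (hX x0 R0 x l t - x0) < 2 * R0 /\ Rabs (hY y0 R0 y l t - y0) < 2 * R0.
Proof.
intros HR Hx Hy Hl; unfold hX, hY; split.
- replace (x0 + x + l * (R0 * cos t - x) - x0) with (x + l * (R0 * cos t - x)) by ring.
  apply homotopy_bound; trivial; apply COS_bound.
- replace (y0 + y + l * (R0 * sin t - y) - y0) with (y + l * (R0 * sin t - y)) by ring.
  apply homotopy_bound; trivial; apply SIN_bound.
Qed.

Lemma continuity_2d_hX x0 R0 x l t : continuity_2d_pt (hX x0 R0 x) l t.
Proof.
unfold hX; apply continuity_2d_pt_plus; [apply continuity_2d_pt_const|].
apply continuity_2d_pt_mult; [apply continuity_2d_pt_id1|].
apply (continuity_2d_pt_snd (fun t => R0 * cos t - x)).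
apply (ex_derive_continuous (fun t => R0 * cos t - x)); auto_derive; trivial.
Qed.

Lemma continuity_2d_hY y0 R0 y l t : continuity_2d_pt (hY y0 R0 y) l t.
Proof.
unfold hY; apply continuity_2d_pt_plus; [apply continuity_2d_pt_const|].
apply continuity_2d_pt_mult; [apply continuity_2d_pt_id1|].
apply (continuity_2d_pt_snd (fun t => R0 * sin t - y)).
apply (ex_derive_continuous (fun t => R0 * sin t - y)); auto_derive; trivial.
Qed.

Lemma continuity_2d_hXY f x0 y0 R0 x y l t :
  continuity_2d_pt f (hX x0 R0 x l t) (hY y0 R0 y l t) ->
  continuity_2d_pt (fun l t => f (hX x0 R0 x l t) (hY y0 R0 y l t)) l t.
Proof.
intros H; apply continuity_2d_pt_comp; trivial; [apply continuity_2d_hX|apply continuity_2d_hY].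
Qed.

Lemma is_derive_comp_2d (f : R -> R -> R) (g h : R -> R) t fx fy g' h' :
  differentiable_pt_lim f (g t) (h t) fx fy -> is_derive g t g' -> is_derive h t h' ->
  is_derive (fun t => f (g t) (h t)) t (fx * g' + fy * h').
Proof.
intros Hf Hg Hh; apply is_derive_Reals, derivable_pt_lim_comp_2d; trivial; now apply is_derive_Reals.
Qed.

Lemma differentiable_pt_lim_cont f x y a b : differentiable_pt_lim f x y a b -> continuity_2d_pt f x y.
Proof. intros H; apply differentiable_continuity_pt; now exists a, b. Qed.

Lemma continuity_2d_ex_RInt (G : R -> R -> R) l a b :
  (forall t, continuity_2d_pt G l t) -> ex_RInt (fun t => G l t) a b.
Proof. intros H; apply ex_RInt_cont; intros t; now apply continuity_2d_pt_slice. Qed.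

(** * Contraction of the circle under a truncated kernel *)

Section Cauchy.
Variables (u v ux vx : R -> R -> R) (x0 y0 R0 D : R).
Hypothesis HR : 0 < R0.
Hypothesis HC : CRbox u v ux vx x0 y0 (2 * R0) D.
Variables (x y : R).
Hypothesis Hx : Rabs x <= R0 / 4.
Hypothesis Hy : Rabs y <= R0 / 4.

Let X := hX x0 R0 x.
Let Y := hY y0 R0 y.
Let K1 N t := Rsum (fun n => kc R0 x y n t) N.
Let K2 N t := Rsum (fun n => ks R0 x y n t) N.
(** For [f = u + iv] along the homotopy, [G] is the real part of [f] times the truncated kernel,
    [A + iB] is [f' e^{it}], and [E] is minus the real part of [(A + iB) q^N]. *)
Let G N l t := u (X l t) (Y l t) * K1 N t - v (X l t) (Y l t) * K2 N t.
Let A l t := ux (X l t) (Y l t) * cos t - vx (X l t) (Y l t) * sin t.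
Let B l t := ux (X l t) (Y l t) * sin t + vx (X l t) (Y l t) * cos t.
Let E N l t := ks R0 x y N t * B l t - kc R0 x y N t * A l t.

Let box l t : - / 2 < l < 3 / 2 -> Rabs (X l t - x0) < 2 * R0 /\ Rabs (Y l t - y0) < 2 * R0.
Proof. now apply hXY_box. Qed.

Let contK1 N t : continuous (K1 N) t.
Proof. apply (continuous_Rsum (kc R0 x y)); intros; apply continuous_kc. Qed.
Let contK2 N t : continuous (K2 N) t.
Proof. apply (continuous_Rsum (ks R0 x y)); intros; apply continuous_ks. Qed.
Let contcos t : continuous cos t.
Proof. apply (ex_derive_continuous cos); auto_derive; trivial. Qed.
Let contsin t : continuous sin t.
Proof. apply (ex_derive_continuous sin); auto_derive; trivial. Qed.

Let contG N l t : - / 2 < l < 3 / 2 -> continuity_2d_pt (G N) l t.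
Proof.
intros Hl; destruct (box l t Hl) as [bx by'].
unfold G; apply continuity_2d_pt_minus; apply continuity_2d_pt_mult.
- apply continuity_2d_hXY; eapply differentiable_pt_lim_cont; now apply (CRu _ _ _ _ _ _ _ _ HC).
- apply continuity_2d_pt_snd, contK1.
- apply continuity_2d_hXY; eapply differentiable_pt_lim_cont; now apply (CRv _ _ _ _ _ _ _ _ HC).
- apply continuity_2d_pt_snd, contK2.
Qed.

Let contA l t : - / 2 < l < 3 / 2 -> continuity_2d_pt A l t.
Proof.
intros Hl; destruct (box l t Hl) as [bx by'].
unfold A; apply continuity_2d_pt_minus; apply continuity_2d_pt_mult.
- apply continuity_2d_hXY; now apply (CRcu _ _ _ _ _ _ _ _ HC).
- now apply continuity_2d_pt_snd.
- apply continuity_2d_hXY; now apply (CRcv _ _ _ _ _ _ _ _ HC).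
- now apply continuity_2d_pt_snd.
Qed.

Let contE N l t : - / 2 < l < 3 / 2 -> continuity_2d_pt (E N) l t.
Proof.
intros Hl; destruct (box l t Hl) as [bx by'].
unfold E; apply continuity_2d_pt_minus; apply continuity_2d_pt_mult.
- apply continuity_2d_pt_snd, continuous_ks.
- unfold B; apply continuity_2d_pt_plus; apply continuity_2d_pt_mult.
  + apply continuity_2d_hXY; now apply (CRcu _ _ _ _ _ _ _ _ HC).
  + now apply continuity_2d_pt_snd.
  + apply continuity_2d_hXY; now apply (CRcv _ _ _ _ _ _ _ _ HC).
  + now apply continuity_2d_pt_snd.
- apply continuity_2d_pt_snd, continuous_kc.
- now apply contA.
Qed.

(** The [l]-derivative of [f] along the homotopy is [f' (R0 e^{it} - z)]. Its second factor
    telescopes against the kernel to [R0 e^{it} (1 - q^N)], which separates a main term from a small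
    remainder. *)
Let derG N l t : - / 2 < l < 3 / 2 ->
  is_derive (fun l => G N l t) l (R0 * A l t + R0 * E N l t).
Proof.
intros Hl; destruct (box l t Hl) as [bx by'].
destruct (kernel_sum R0 x y N t) as [E1 E2]; [lra|].
fold (K1 N t) (K2 N t) in E1, E2.
assert (dX : is_derive (fun l => X l t) l (R0 * cos t - x)).
{ unfold X, hX; auto_derive; trivial; ring. }
assert (dY : is_derive (fun l => Y l t) l (R0 * sin t - y)).
{ unfold Y, hY; auto_derive; trivial; ring. }
assert (Du := is_derive_comp_2d u _ _ l _ _ _ _ (CRu _ _ _ _ _ _ _ _ HC _ _ bx by') dX dY).
assert (Dv := is_derive_comp_2d v _ _ l _ _ _ _ (CRv _ _ _ _ _ _ _ _ HC _ _ bx by') dX dY).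
set (a := ux (X l t) (Y l t)) in *; set (b := vx (X l t) (Y l t)) in *.
replace (R0 * A l t + R0 * E N l t) with
 ((a * (R0 * cos t - x) + - b * (R0 * sin t - y)) * K1 N t
  - (b * (R0 * cos t - x) + a * (R0 * sin t - y)) * K2 N t).
- unfold G.
  apply (is_derive_minus (V := R_NormedModule) (fun l => u (X l t) (Y l t) * K1 N t)
    (fun l => v (X l t) (Y l t) * K2 N t)).
  + apply (is_derive_scal_l (V := R_NormedModule) (fun l => u (X l t) (Y l t))); exact Du.
  + apply (is_derive_scal_l (V := R_NormedModule) (fun l => v (X l t) (Y l t))); exact Dv.
- transitivity (a * ((R0 * cos t - x) * K1 N t - (R0 * sin t - y) * K2 N t)
   - b * ((R0 * cos t - x) * K2 N t + (R0 * sin t - y) * K1 N t)); [ring|].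
  rewrite E1, E2; unfold A, E, B, A; fold a b; ring.
Qed.

Let locl l : - / 2 < l < 3 / 2 -> locally l (fun l => - / 2 < l < 3 / 2).
Proof.
intros Hl; apply filter_and; [apply (open_gt (- / 2)); lra|apply (open_lt (3 / 2)); lra].
Qed.

Let derI N l : - / 2 < l < 3 / 2 ->
  is_derive (fun l => RInt (G N l) 0 (2 * PI)) l (RInt (fun t => R0 * A l t + R0 * E N l t) 0 (2 * PI)).
Proof.
intros Hl.
replace (RInt (fun t => R0 * A l t + R0 * E N l t) 0 (2 * PI)) with
  (RInt (fun t => Derive (fun l => G N l t) l) 0 (2 * PI)).
- apply is_derive_RInt_param.
  + apply filter_imp with (2 := locl l Hl); intros z Hz t _; eexists; now apply derG.
  + intros t _.
    apply continuity_2d_pt_ext_loc with (fun l t => R0 * A l t + R0 * E N l t).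
    * destruct (locl l Hl) as [d Hd]; exists d; intros a b Ha _.
      symmetry; apply is_derive_unique, derG, Hd, Ha.
    * apply continuity_2d_pt_plus; apply continuity_2d_pt_mult;
        try apply continuity_2d_pt_const; auto.
  + apply filter_imp with (2 := locl l Hl); intros z Hz; apply continuity_2d_ex_RInt; auto.
- apply RInt_extR; intros; now apply is_derive_unique, derG.
Qed.

(** [A] is the [t]-derivative of [v / (l R0)] along a closed circle. The division by [l] is
    admissible because the mean value theorem will supply an interior point of [[0, 1]]. *)
Let intA l : 0 < l < 1 -> RInt (A l) 0 (2 * PI) = 0.
Proof.
intros Hl; assert (Hl' : - / 2 < l < 3 / 2) by lra.
assert (P : 0 = minus (v (X l (2 * PI)) (Y l (2 * PI)) / (l * R0)) (v (X l 0) (Y l 0) / (l * R0))).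
{ unfold X, Y, hX, hY.
  rewrite cos_2PI, sin_2PI, cos_0, sin_0; unfold minus, plus, opp; simpl; ring. }
refine (eq_trans _ (eq_sym P)); apply is_RInt_unique; clear P.
apply (is_RInt_derive (V := R_CompleteNormedModule) (fun t => v (X l t) (Y l t) / (l * R0))).
- intros t _; destruct (box l t Hl') as [bx by'].
  assert (dX : is_derive (fun t => X l t) t (- l * R0 * sin t)).
  { unfold X, hX; auto_derive; trivial; ring. }
  assert (dY : is_derive (fun t => Y l t) t (l * R0 * cos t)).
  { unfold Y, hY; auto_derive; trivial; ring. }
  assert (Dv := is_derive_comp_2d v _ _ t _ _ _ _ (CRv _ _ _ _ _ _ _ _ HC _ _ bx by') dX dY).
  replace (A l t) with ((vx (X l t) (Y l t) * (- l * R0 * sin t) + ux (X l t) (Y l t) * (l * R0 * cos t))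
     * / (l * R0)) by (unfold A; field; split; lra).
  apply (is_derive_scal_l (V := R_NormedModule) (fun t => v (X l t) (Y l t))); exact Dv.
- intros t _; apply continuity_2d_pt_slice; auto.
Qed.

Let xy_sq : x ^ 2 + y ^ 2 <= (R0 / 2) ^ 2.
Proof. apply Rabs_le_between in Hx; apply Rabs_le_between in Hy; nra. Qed.

Let D0 : 0 <= D.
Proof.
destruct (box 0 0) as [bx by']; [lra|].
destruct (CRb _ _ _ _ _ _ _ _ HC _ _ bx by') as [H _].
eapply Rle_trans; [apply Rabs_pos|apply H].
Qed.

Let boundE N l t : - / 2 < l < 3 / 2 -> Rabs (E N l t) <= 4 * D * (/ 2) ^ N.
Proof.
intros Hl; destruct (box l t Hl) as [bx by'].
destruct (CRb _ _ _ _ _ _ _ _ HC _ _ bx by') as [_ [_ [Ha Hb]]].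
destruct (kc_ks_bound R0 x y N t HR xy_sq) as [H1 H2].
assert (C := COS_bound t); assert (S := SIN_bound t).
unfold E, A, B; set (a := ux (X l t) (Y l t)) in *; set (b := vx (X l t) (Y l t)) in *.
assert (Q : forall p q c s, Rabs p <= D -> Rabs q <= D -> Rabs c <= 1 -> Rabs s <= 1 -> Rabs (p * c + q * s) <= 2 * D).
{ intros p q c s Hp Hq Hc Hs; eapply Rle_trans; [apply Rabs_triang|].
  rewrite !Rabs_mult; assert (Z := Rabs_pos p); assert (Z' := Rabs_pos q).
  assert (Rabs p * Rabs c <= D * 1) by (apply Rmult_le_compat; trivial; apply Rabs_pos).
  assert (Rabs q * Rabs s <= D * 1) by (apply Rmult_le_compat; trivial; apply Rabs_pos).
  lra. }
assert (Hcos : Rabs (cos t) <= 1) by (apply Rabs_le; lra).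
assert (Hsin : Rabs (sin t) <= 1) by (apply Rabs_le; lra).
assert (Q1 := Q a b (sin t) (cos t) Ha Hb Hsin Hcos).
assert (Hb' : Rabs (- b) <= D) by now rewrite Rabs_Ropp.
assert (Q2 := Q a (- b) (cos t) (sin t) Ha Hb' Hcos Hsin).
replace (a * cos t - b * sin t) with (a * cos t + - b * sin t) by ring.
unfold Rminus at 1; eapply Rle_trans; [apply Rabs_triang|].
rewrite Rabs_Ropp, !Rabs_mult.
assert (W : forall p q, Rabs p <= (/ 2) ^ N -> Rabs q <= 2 * D -> Rabs p * Rabs q <= (/ 2) ^ N * (2 * D)).
{ intros; apply Rmult_le_compat; trivial; apply Rabs_pos. }
assert (W1 := W _ _ H2 Q1); assert (W2 := W _ _ H1 Q2); lra.
Qed.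

(* For f = u + iv, the integral of f(z + l (R e^{it} - z)) sum_{n<N} q^n over t has l-derivative
   -R (integral of f' e^{it} q^N), because the part without q^N is the integral of a t-derivative. *)
Lemma Cauchy_approx N :
  Rabs (RInt (G N 1) 0 (2 * PI) - RInt (G N 0) 0 (2 * PI)) <= 2 * PI * (R0 * (4 * D * (/ 2) ^ N)).
Proof.
assert (PI0 := PI_RGT_0).
destruct (MVT_cor2 (fun l => RInt (G N l) 0 (2 * PI))
  (fun l => RInt (fun t => R0 * A l t + R0 * E N l t) 0 (2 * PI)) 0 1) as [c [Ec Hc]]; [lra| |].
{ intros l Hl; apply is_derive_Reals, derI; lra. }
simpl in Ec; rewrite Ec, Rminus_0_r, Rmult_1_r.
assert (Hc' : - / 2 < c < 3 / 2) by lra.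
assert (cA : forall t, continuous (fun t => A c t) t) by (intros; apply continuity_2d_pt_slice; auto).
assert (cE : forall t, continuous (fun t => E N c t) t) by (intros; apply continuity_2d_pt_slice; auto).
rewrite RInt_plusR, (RInt_scalR (fun t => A c t)), intA, Rmult_0_r, Rplus_0_l; trivial.
- replace (2 * PI) with (2 * PI - 0) at 2 by ring.
  apply abs_RInt_le_const; [lra| |].
  + apply ex_RInt_cont; intros; apply continuous_Rmult; trivial; apply continuous_const.
  + intros; rewrite Rabs_mult, (Rabs_pos_eq R0) by lra.
    apply Rmult_le_compat_l; [lra|auto].
- intros; apply continuous_Rmult; trivial; apply continuous_const.
- intros; apply continuous_Rmult; trivial; apply continuous_const.
Qed.

(** At [l = 0] the homotopy is constant, so only the integral of the kernel remains. The length
    [S N] guarantees that the term [n = 0], the only one with nonzero mean, is present. *)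
Lemma Cauchy_start N : RInt (G (S N) 0) 0 (2 * PI) = 2 * PI * u (x0 + x) (y0 + y).
Proof.
rewrite (RInt_extR _ (fun t => u (x0 + x) (y0 + y) * K1 (S N) t + (- v (x0 + x) (y0 + y)) * K2 (S N) t)).
2:{ intros t; unfold G, X, Y, hX, hY; rewrite !Rmult_0_l, !Rplus_0_r; ring. }
rewrite RInt_plusR, !RInt_scalR; trivial.
- unfold K1, K2; rewrite (RInt_Rsum (kc R0 x y)), (RInt_Rsum (ks R0 x y));
    try (intros; apply continuous_kc); try (intros; apply continuous_ks).
  rewrite (Rsum_ext (fun n => RInt (ks R0 x y n) 0 (2 * PI)) (fun n => 0 * 0)), Rsum_scal
    by (intros; rewrite (proj2 (RInt_kc_ks R0 x y _)); ring).
  assert (Q : Rsum (fun n => RInt (kc R0 x y n) 0 (2 * PI)) (S N) = 2 * PI).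
  { induction N as [|N IH]; [simpl; rewrite (proj1 (RInt_kc_ks R0 x y 0)); eqR; ring|].
    change (Rsum (fun n => RInt (kc R0 x y n) 0 (2 * PI)) (S N) + RInt (kc R0 x y (S N)) 0 (2 * PI) = 2 * PI).
    rewrite IH, (proj1 (RInt_kc_ks R0 x y (S N))); eqR; ring. }
  rewrite Q; eqR; ring.
- intros; apply continuous_Rmult; trivial; apply continuous_const.
- intros; apply continuous_Rmult; trivial; apply continuous_const.
Qed.

End Cauchy.

(** Each step multiplies by [x - x0] and by [y - y0] and adds, at a cost of [r] each. On a box of
    half-width [R0 / 4] the norm is thus at most [(R0 / 2)^n], small enough against [R0^n]. *)
Lemma AE_PRe_PIm x0 y0 r n : 0 <= r ->
  AE x0 y0 r ((2 * r) ^ n) (fun x y => PRe (x - x0) (y - y0) n) /\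
  AE x0 y0 r ((2 * r) ^ n) (fun x y => PIm (x - x0) (y - y0) n).
Proof.
intros Hr; induction n as [|n [IH1 IH2]].
- split.
  + generalize (AE_const x0 y0 r 1); rewrite Rabs_R1; now apply AE_ext.
  + apply AE_mono with (Rabs 0); [rewrite Rabs_R0; simpl; lra|].
    generalize (AE_const x0 y0 r 0); now apply AE_ext.
- split.
  + generalize (AE_plus _ _ _ _ _ _ _ (AE_mulX _ _ _ _ _ Hr IH1)
      (AE_scal _ _ _ _ _ (-1) (AE_mulY _ _ _ _ _ Hr IH2))).
    rewrite Rabs_left by lra; intros H; eapply AE_mono; [|eapply AE_ext; [|exact H]].
    * simpl; lra.
    * intros; cbv beta; rewrite PRe_S; ring.
  + generalize (AE_plus _ _ _ _ _ _ _ (AE_mulX _ _ _ _ _ Hr IH2) (AE_mulY _ _ _ _ _ Hr IH1)).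
    intros H; eapply AE_mono; [|eapply AE_ext; [|exact H]].
    * simpl; lra.
    * intros; cbv beta; rewrite PIm_S; ring.
Qed.

(** At [l = 1] the homotopy runs through the circle independently of the base point, which then
    enters the integral only through the kernel. The integral becomes a sum of harmonic polynomials
    weighted by Fourier coefficients [al], [be] of the boundary values, and the contraction estimate
    identifies its limit. *)
Lemma CRbox_AE u v ux vx x0 y0 R0 D : 0 < R0 -> CRbox u v ux vx x0 y0 (2 * R0) D ->
  exists M, AE x0 y0 (R0 / 4) M u.
Proof.
intros HR HC; assert (PI0 := PI_RGT_0).
assert (Box : forall t, Rabs (x0 + R0 * cos t - x0) < 2 * R0 /\ Rabs (y0 + R0 * sin t - y0) < 2 * R0).
{ intros t; destruct (hXY_box x0 y0 R0 0 0 1 t) as [H1 H2]; trivial; try (rewrite Rabs_R0; lra); try lra.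
  unfold hX, hY in H1, H2; split.
  - replace (x0 + R0 * cos t - x0) with (x0 + 0 + 1 * (R0 * cos t - 0) - x0) by ring; exact H1.
  - replace (y0 + R0 * sin t - y0) with (y0 + 0 + 1 * (R0 * sin t - 0) - y0) by ring; exact H2. }
set (ut t := u (x0 + R0 * cos t) (y0 + R0 * sin t)).
set (vt t := v (x0 + R0 * cos t) (y0 + R0 * sin t)).
assert (dX : forall t, is_derive (fun t => x0 + R0 * cos t) t (- R0 * sin t)).
{ intros t; auto_derive; trivial; ring. }
assert (dY : forall t, is_derive (fun t => y0 + R0 * sin t) t (R0 * cos t)).
{ intros t; auto_derive; trivial; ring. }
assert (cu : forall t, continuous ut t).
{ intros t; destruct (Box t) as [b1 b2]; apply (ex_derive_continuous ut); eexists.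
  exact (is_derive_comp_2d u _ _ t _ _ _ _ (CRu _ _ _ _ _ _ _ _ HC _ _ b1 b2) (dX t) (dY t)). }
assert (cv : forall t, continuous vt t).
{ intros t; destruct (Box t) as [b1 b2]; apply (ex_derive_continuous vt); eexists.
  exact (is_derive_comp_2d v _ _ t _ _ _ _ (CRv _ _ _ _ _ _ _ _ HC _ _ b1 b2) (dX t) (dY t)). }
assert (bu : forall t, Rabs (ut t) <= D /\ Rabs (vt t) <= D).
{ intros t; destruct (Box t) as [b1 b2]; destruct (CRb _ _ _ _ _ _ _ _ HC _ _ b1 b2); tauto. }
assert (D0 : 0 <= D) by (eapply Rle_trans; [apply Rabs_pos|apply (bu 0)]).
assert (cc : forall n t, continuous (fun t => cos (INR n * t)) t)
  by (intros n t; apply (ex_derive_continuous (fun t => cos (INR n * t))); auto_derive; trivial).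
assert (cs : forall n t, continuous (fun t => sin (INR n * t)) t)
  by (intros n t; apply (ex_derive_continuous (fun t => sin (INR n * t))); auto_derive; trivial).
set (fa n t := ut t * cos (INR n * t) + vt t * sin (INR n * t)).
set (fb n t := ut t * sin (INR n * t) - vt t * cos (INR n * t)).
assert (cfa : forall n t, continuous (fa n) t)
  by (intros; apply continuous_Rplus; apply continuous_Rmult; trivial).
assert (cfb : forall n t, continuous (fb n) t)
  by (intros; apply continuous_Rminus; apply continuous_Rmult; trivial).
set (al n := RInt (fa n) 0 (2 * PI) : R); set (be n := RInt (fb n) 0 (2 * PI) : R).
assert (T : forall p q c s, Rabs p <= D -> Rabs q <= D -> -1 <= c <= 1 -> -1 <= s <= 1 ->
   Rabs (p * c + q * s) <= 2 * D).
{ intros p q c s Hp Hq Hc Hs; eapply Rle_trans; [apply Rabs_triang|].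
  rewrite !Rabs_mult; assert (Z := Rabs_pos p); assert (Z' := Rabs_pos q).
  assert (Rabs p * Rabs c <= D * 1) by (apply Rmult_le_compat; trivial; try apply Rabs_pos; now apply Rabs_le).
  assert (Rabs q * Rabs s <= D * 1) by (apply Rmult_le_compat; trivial; try apply Rabs_pos; now apply Rabs_le).
  lra. }
assert (bal : forall n, Rabs (al n) <= 2 * PI * (2 * D)).
{ intros n; replace (2 * PI) with (2 * PI - 0) at 1 by ring; apply abs_RInt_le_const; [lra|now apply ex_RInt_cont|].
  intros t _; unfold fa; destruct (bu t); apply T; trivial; [apply COS_bound|apply SIN_bound]. }
assert (bbe : forall n, Rabs (be n) <= 2 * PI * (2 * D)).
{ intros n; replace (2 * PI) with (2 * PI - 0) at 1 by ring; apply abs_RInt_le_const; [lra|now apply ex_RInt_cont|].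
  intros t _; unfold fb; destruct (bu t).
  replace (ut t * sin (INR n * t) - vt t * cos (INR n * t)) with
   (ut t * sin (INR n * t) + - vt t * cos (INR n * t)) by ring.
  apply T; trivial; [now rewrite Rabs_Ropp|apply SIN_bound|apply COS_bound]. }
set (term n x y := / R0 ^ n * al n * PRe x y n + / R0 ^ n * be n * PIm x y n).
assert (Sum : forall x y, Rabs x <= R0 / 4 -> Rabs y <= R0 / 4 ->
   is_series (fun n => term n x y) (2 * PI * u (x0 + x) (y0 + y))).
{ intros x y Hx Hy.
  set (SN N := RInt (fun t => u (hX x0 R0 x 1 t) (hY y0 R0 y 1 t) * Rsum (fun n => kc R0 x y n t) N -
       v (hX x0 R0 x 1 t) (hY y0 R0 y 1 t) * Rsum (fun n => ks R0 x y n t) N) 0 (2 * PI) : R).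
  assert (E : forall N, SN N = Rsum (fun n => term n x y) N).
  { intros N; unfold SN.
    rewrite (RInt_extR _ (fun t => Rsum (fun n => (/ R0 ^ n * PRe x y n) * fa n t + (/ R0 ^ n * PIm x y n) * fb n t) N)).
    - rewrite (RInt_Rsum (fun n t => (/ R0 ^ n * PRe x y n) * fa n t + (/ R0 ^ n * PIm x y n) * fb n t)).
      + apply Rsum_ext; intros n _.
        rewrite RInt_plusR, !RInt_scalR; trivial; try (unfold term, al, be; eqR; ring);
        intros; apply continuous_Rmult; trivial; apply continuous_const.
      + intros; apply continuous_Rplus; apply continuous_Rmult; trivial; apply continuous_const.
    - intros t.
      replace (hX x0 R0 x 1 t) with (x0 + R0 * cos t) by (unfold hX; ring).
      replace (hY y0 R0 y 1 t) with (y0 + R0 * sin t) by (unfold hY; ring).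
      fold (ut t) (vt t).
      rewrite <- (Rsum_scal (ut t)).
      replace (Rsum (fun n => ut t * kc R0 x y n t) N - vt t * Rsum (fun n => ks R0 x y n t) N) with
       (Rsum (fun n => ut t * kc R0 x y n t) N + - vt t * Rsum (fun n => ks R0 x y n t) N) by ring.
      rewrite <- Rsum_scal, <- Rsum_plus; apply Rsum_ext; intros n _.
      unfold fa, fb, kc, ks, Rdiv; ring. }
  assert (L : is_lim_seq (sum_n (fun n => term n x y)) (2 * PI * u (x0 + x) (y0 + y))); [|exact L].
  apply (is_lim_seq_ext (fun N => SN (S N))).
  { intros N; rewrite E; symmetry; apply Rsum_sum_n. }
  apply is_lim_seq_le_le with
    (fun N => 2 * PI * u (x0 + x) (y0 + y) - 2 * PI * (R0 * (4 * D)) * (/ 2) ^ S N)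
    (fun N => 2 * PI * u (x0 + x) (y0 + y) + 2 * PI * (R0 * (4 * D)) * (/ 2) ^ S N).
  - intros N.
    assert (B := Cauchy_approx u v ux vx x0 y0 R0 D HR HC x y Hx Hy (S N)).
    assert (B0 := Cauchy_start u v x0 y0 R0 x y N).
    cbv beta zeta in B, B0; rewrite B0 in B.
    fold (SN (S N)) in B; apply Rabs_le_between in B; lra.
  - assert (G : is_lim_seq (fun N => (/ 2) ^ S N) 0).
    { apply (is_lim_seq_incr_1 (fun N => (/ 2) ^ N)), is_lim_seq_geom; rewrite Rabs_pos_eq; lra. }
    apply is_lim_seq_scal_l with (a := 2 * PI * (R0 * (4 * D))) in G.
    generalize (is_lim_seq_minus' _ _ _ _ (is_lim_seq_const (2 * PI * u (x0 + x) (y0 + y))) G).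
    simpl; rewrite Rmult_0_r, Rminus_0_r; trivial.
  - assert (G : is_lim_seq (fun N => (/ 2) ^ S N) 0).
    { apply (is_lim_seq_incr_1 (fun N => (/ 2) ^ N)), is_lim_seq_geom; rewrite Rabs_pos_eq; lra. }
    apply is_lim_seq_scal_l with (a := 2 * PI * (R0 * (4 * D))) in G.
    generalize (is_lim_seq_plus' _ _ _ _ (is_lim_seq_const (2 * PI * u (x0 + x) (y0 + y))) G).
    simpl; rewrite Rmult_0_r, Rplus_0_r; trivial. }
assert (HP : forall n, 0 < R0 ^ n) by (intros; now apply pow_lt).
(* Each of [al n], [be n] is at most [2 * PI * (2 * D)], and the polynomial norm [(R0 / 2)^n] is
   divided by [R0^n]. *)
assert (A : AE x0 y0 (R0 / 4) (Series (fun n => 8 * PI * D * (/ 2) ^ n)) (fun x y => 2 * PI * u x y)).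
{ apply (AE_series x0 y0 (R0 / 4) _ (fun n x y => term n (x - x0) (y - y0))).
  - lra.
  - intros n; destruct (AE_PRe_PIm x0 y0 (R0 / 4) n) as [A1 A2]; [lra|].
    apply AE_scal with (k := / R0 ^ n * al n) in A1.
    apply AE_scal with (k := / R0 ^ n * be n) in A2.
    eapply AE_mono; [|exact (AE_plus _ _ _ _ _ _ _ A1 A2)].
    replace (2 * (R0 / 4)) with (R0 * / 2) by field; rewrite Rpow_mult_distr.
    rewrite !Rabs_mult, (Rabs_pos_eq (/ R0 ^ n)) by (apply Rlt_le, Rinv_0_lt_compat, HP).
    replace (/ R0 ^ n * Rabs (al n) * (R0 ^ n * (/ 2) ^ n) + / R0 ^ n * Rabs (be n) * (R0 ^ n * (/ 2) ^ n))
      with ((Rabs (al n) + Rabs (be n)) * (/ 2) ^ n) by (field; apply pow_nonzero; lra).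
    apply Rmult_le_compat_r; [apply pow_le; lra|].
    specialize (bal n); specialize (bbe n); lra.
  - apply (ex_series_scal_l (8 * PI * D) (fun n => (/ 2) ^ n)), ex_series_geom; rewrite Rabs_pos_eq; lra.
  - intros x y Hx Hy; symmetry; apply is_series_unique.
    specialize (Sum _ _ Hx Hy).
    replace (x0 + (x - x0)) with x in Sum by ring; replace (y0 + (y - y0)) with y in Sum by ring.
    exact Sum. }
eexists; generalize (AE_scal _ _ _ _ _ (/ (2 * PI)) A); apply AE_ext.
intros; field; lra.
Qed.

(** * From the open set to a box around each point *)

Lemma open2_box Omega x0 y0 : open2 Omega -> Omega x0 y0 ->
  exists d, 0 < d /\ forall x y, Rabs (x - x0) < d -> Rabs (y - y0) < d -> Omega x y.
Proof.
intros HO H0; destruct (HO (x0, y0) H0) as [d Hd].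
exists d; split; [apply cond_pos|]; intros x y Hx Hy; apply (Hd (x, y)).
split; [exact Hx|exact Hy].
Qed.

Lemma C1_on_differentiable Omega f x0 y0 : open2 Omega -> C1_on Omega f -> Omega x0 y0 ->
  differentiable_pt_lim f x0 y0 (dx f x0 y0) (dy f x0 y0).
Proof.
intros HO HC H0; apply filterdiff_differentiable_pt_lim.
apply (is_derive_filterdiff f x0 y0 (dx f) (dy f x0 y0)).
- destruct (HO (x0, y0) H0) as [d Hd]; exists d; intros [x y] Hxy.
  apply Derive_correct, (HC x y), (Hd (x, y) Hxy).
- apply Derive_correct, (HC x0 y0 H0).
- apply (HC x0 y0 H0).
Qed.

Lemma continuity_2d_bounded f x y : continuity_2d_pt f x y ->
  exists d, 0 < d /\ forall a b, Rabs (a - x) < d -> Rabs (b - y) < d -> Rabs (f a b) <= Rabs (f x y) + 1.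
Proof.
intros H; destruct (H (mkposreal _ Rlt_0_1)) as [d Hd]; exists d; split; [apply cond_pos|].
intros a b Ha Hb; specialize (Hd a b Ha Hb); simpl in Hd.
assert (Q := Rabs_triang (f a b - f x y) (f x y)).
replace (f a b - f x y + f x y) with (f a b) in Q by ring; lra.
Qed.

Lemma CR_analytic Omega u v x0 y0 :
  open2 Omega -> C1_on Omega u -> C1_on Omega v ->
  (forall x y, Omega x y -> dx u x y = dy v x y /\ dy u x y = - dx v x y) ->
  Omega x0 y0 ->
  exists r M, 0 < r /\ AE x0 y0 r M u /\ AE x0 y0 r M v /\
    forall x y, Rabs (x - x0) <= r -> Rabs (y - y0) <= r -> Omega x y.
Proof.
intros HO Hu Hv CR H0.
destruct (open2_box _ _ _ HO H0) as [d [Hd Od]].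
assert (Cc : forall f, C1_on Omega f -> forall x y, Omega x y ->
  continuity_2d_pt f x y /\ continuity_2d_pt (dx f) x y).
{ intros f Hf x y Hxy; split.
  - eapply differentiable_pt_lim_cont, C1_on_differentiable; eassumption.
  - apply continuity_2d_pt_filterlim, (Hf x y Hxy). }
destruct (continuity_2d_bounded _ _ _ (proj1 (Cc u Hu _ _ H0))) as [d1 [P1 B1]].
destruct (continuity_2d_bounded _ _ _ (proj2 (Cc u Hu _ _ H0))) as [d2 [P2 B2]].
destruct (continuity_2d_bounded _ _ _ (proj1 (Cc v Hv _ _ H0))) as [d3 [P3 B3]].
destruct (continuity_2d_bounded _ _ _ (proj2 (Cc v Hv _ _ H0))) as [d4 [P4 B4]].
(* Near the centre each of the four functions exceeds its central absolute value by at most 1, so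
   one constant bounds them all. *)
set (D := Rabs (u x0 y0) + Rabs (dx u x0 y0) + Rabs (v x0 y0) + Rabs (dx v x0 y0) + 1).
assert (Z1 := Rabs_pos (u x0 y0)); assert (Z2 := Rabs_pos (dx u x0 y0)).
assert (Z3 := Rabs_pos (v x0 y0)); assert (Z4 := Rabs_pos (dx v x0 y0)).
set (rho := Rmin d (Rmin (Rmin d1 d2) (Rmin d3 d4))).
assert (Hrho : 0 < rho) by (unfold rho; repeat apply Rmin_pos; trivial).
assert (L : rho <= d /\ rho <= d1 /\ rho <= d2 /\ rho <= d3 /\ rho <= d4).
{ unfold rho; repeat split;
  eauto 6 using Rle_trans, Rmin_l, Rmin_r. }
destruct L as [L [L1 [L2 [L3 L4]]]].
assert (CB : CRbox u v (dx u) (dx v) x0 y0 (2 * (rho / 2)) D).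
{ replace (2 * (rho / 2)) with rho by field.
  assert (Ob : forall x y, Rabs (x - x0) < rho -> Rabs (y - y0) < rho -> Omega x y)
    by (intros; apply Od; lra).
  split; intros x y Hx Hy.
  - rewrite <- (proj2 (CR x y (Ob x y Hx Hy))); now apply C1_on_differentiable with Omega; auto.
  - rewrite (proj1 (CR x y (Ob x y Hx Hy))); now apply C1_on_differentiable with Omega; auto.
  - apply Cc; auto.
  - apply Cc; auto.
  - repeat split; unfold D.
    + eapply Rle_trans; [apply B1|]; lra.
    + eapply Rle_trans; [apply B3|]; lra.
    + eapply Rle_trans; [apply B2|]; lra.
    + eapply Rle_trans; [apply B4|]; lra. }
assert (HR : 0 < rho / 2) by lra.
destruct (CRbox_AE _ _ _ _ _ _ _ _ HR CB) as [M1 A1].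
destruct (CRbox_AE _ _ _ _ _ _ _ _ HR (CRbox_rot _ _ _ _ _ _ _ _ CB)) as [M2 A2].
exists (rho / 2 / 4), (Rmax M1 M2); split; [lra|split; [|split]].
- apply AE_mono with M1; trivial; apply Rmax_l.
- apply AE_mono with M2; trivial; apply Rmax_r.
- intros; apply Od; lra.
Qed.

(** * Logarithms and the homogeneous solutions *)

Lemma AE_bound x0 y0 r M f x y : AE x0 y0 r M f -> Rabs (x - x0) <= r -> Rabs (y - y0) <= r ->
  Rabs (f x y) <= M.
Proof.
intros [c [A E]] Hx Hy; rewrite E by trivial; unfold ev.
assert (B := abs2_box _ _ _ _ _ Hx Hy A).
destruct (abs2_rows _ _ B) as [B1 B2].
eapply Rle_trans; [|exact B2].
eapply Rle_trans; [apply Series_Rabs|].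
- apply (ex_series_dom _ _ (fun n => eq_ind_r (fun z => z <= _) (Series_Rabs _ (abs2_row _ _ n B)) (Rabs_Rabsolu _)) B1).
- apply Series_le; trivial; intros n; split; [apply Rabs_pos|].
  apply Series_Rabs; exact (abs2_row _ _ n B).
Qed.

(** Both sides vanish at 0 and have derivative [1 / (1 + w)], the latter by the geometric series. *)
Lemma ln_series w : Rabs w < 1 ->
  ln (1 + w) = Series (fun n => (-1) ^ n / INR (S n) * w ^ S n).
Proof.
intros Hw.
set (a n := match n with O => 0 | S n => (-1) ^ n / INR (S n) end).
assert (Ra : Rbar_le 1 (CV_radius a)).
{ apply CV_radius_bounded; exists 1; intros [|n]; unfold a.
  - rewrite Rmult_0_l, Rabs_R0; lra.
  - rewrite pow1, Rmult_1_r; unfold Rdiv; rewrite Rabs_mult, pow_1_abs, Rmult_1_l.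
    assert (P : 1 <= INR (S n)) by (rewrite S_INR; generalize (pos_INR n); lra).
    rewrite Rabs_pos_eq by (apply Rlt_le, Rinv_0_lt_compat; lra).
    apply Rmult_le_reg_r with (INR (S n)); [lra|rewrite Rinv_l; lra]. }
assert (CV : forall z, Rabs z < 1 -> Rbar_lt (Rabs z) (CV_radius a)).
{ intros z Hz; apply Rbar_lt_le_trans with 1; trivial. }
assert (D : forall z, Rabs z < 1 -> is_derive (fun z => ln (1 + z) - PSeries a z) z 0).
{ intros z Hz; assert (Hz' := Rabs_def2 _ _ Hz).
  replace 0 with (minus (/ (1 + z)) (PSeries (PS_derive a) z)).
  - apply (is_derive_minus (V := R_NormedModule)); [|now apply is_derive_PSeries, CV].
    auto_derive; [lra|field; lra].
  - replace (PSeries (PS_derive a) z) with (/ (1 + z)); [apply (minus_eq_zero (G := R_AbelianGroup))|].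
    replace (1 + z) with (1 - (- z)) by ring; rewrite <- Series_geom by now rewrite Rabs_Ropp.
    apply Series_ext; intros n; unfold PS_derive, a.
    replace (- z) with (-1 * z) by ring; rewrite Rpow_mult_distr; field.
    rewrite S_INR; generalize (pos_INR n); lra. }
assert (E : ln (1 + w) - PSeries a w = 0).
{ destruct (MVT_gen (fun z => ln (1 + z) - PSeries a z) 0 w (fun _ => 0)) as [c [_ Hc]].
  - intros z Hz; apply D; revert Hz; unfold Rmin, Rmax; destruct Rle_dec; intros Hz;
      apply Rabs_def2 in Hw; apply Rabs_def1; lra.
  - intros z Hz; apply continuity_pt_filterlim.
    apply (ex_derive_continuous (fun z => ln (1 + z) - PSeries a z)); exists 0; apply D.
    revert Hz; unfold Rmin, Rmax; destruct Rle_dec; intros Hz; apply Rabs_def2 in Hw; apply Rabs_def1; lra.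
  - rewrite PSeries_0, Rplus_0_r, ln_1 in Hc; simpl in Hc; lra. }
replace (ln (1 + w)) with (PSeries a w) by lra.
unfold PSeries; rewrite Series_incr_1.
- simpl a at 1; rewrite Rmult_0_l, Rplus_0_l; reflexivity.
- apply ex_pseries_R, CV_radius_inside, CV, Hw.
Qed.

(** With [w = (f - v0) / v0] the function is [ln |v0 / 2| + ln (1 + w)], and the logarithmic series
    converges in the algebra once the norm of [w] is below 1. The sign statement is kept because the
    branch of the complex logarithm depends on it. *)
Lemma AE_ln x0 y0 r M f : 0 < r -> AE x0 y0 r M f -> f x0 y0 <> 0 ->
  exists r' L, 0 < r' <= r /\ AE x0 y0 r' L (fun x y => ln (Rabs (f x y / 2))) /\
   forall x y, Rabs (x - x0) <= r' -> Rabs (y - y0) <= r' -> f x y <> 0 /\ 0 < f x y / f x0 y0.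
Proof.
intros Hr A H0; assert (M0 := AE_ge0 _ _ _ _ _ A).
set (v0 := f x0 y0) in *; assert (V0 := Rabs_pos_lt _ H0).
(* Chosen so that the norm bound of [w] comes out as exactly 1/2. *)
set (q := Rabs v0 / (2 * (M + Rabs v0))).
assert (Hq : 0 < q <= / 2).
{ unfold q; split; [apply Rdiv_lt_0_compat; lra|].
  apply Rmult_le_reg_r with (2 * (M + Rabs v0)); [lra|].
  unfold Rdiv; rewrite Rmult_assoc, Rinv_l; lra. }
assert (Hq1 : 0 <= q <= 1) by lra.
assert (A1 := AE_scal _ _ _ _ _ (/ v0) (AE_shrink_center _ _ _ _ _ q Hr Hq1 A)); fold v0 in A1.
assert (E2 : Rabs (/ v0) * (q * (M + Rabs v0)) = / 2).
{ unfold q; rewrite Rabs_inv; field; lra. }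
rewrite E2 in A1.
set (w x y := / v0 * (f x y - v0)) in A1.
assert (Bw : forall x y, Rabs (x - x0) <= q * r -> Rabs (y - y0) <= q * r -> Rabs (w x y) <= / 2)
  by (intros x y; apply (AE_bound _ _ _ _ _ x y A1)).
assert (Ef : forall x y, f x y = v0 * (1 + w x y)) by (intros; unfold w; field; trivial).
assert (Hqr : 0 < q * r <= r) by nra.
exists (q * r); eexists; split; [exact Hqr|split].
- assert (AL : AE x0 y0 (q * r) (Series (fun n => (/ 2) ^ n)) (fun x y => ln (1 + w x y))).
  { apply (AE_series _ _ _ _ (fun n x y => (-1) ^ n / INR (S n) * w x y ^ S n)).
    - lra.
    - intros n; eapply AE_mono; [|apply AE_scal, AE_pow; [lra|exact A1]].
      assert (P : 1 <= INR (S n)) by (rewrite S_INR; generalize (pos_INR n); lra).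
      unfold Rdiv; rewrite Rabs_mult, pow_1_abs, Rmult_1_l.
      rewrite Rabs_pos_eq by (apply Rlt_le, Rinv_0_lt_compat; lra).
      assert (/ INR (S n) <= 1) by (apply Rmult_le_reg_r with (INR (S n)); [lra|rewrite Rinv_l; lra]).
      assert (0 < / INR (S n)) by (apply Rinv_0_lt_compat; lra).
      assert (0 < (/ 2) ^ n) by (apply pow_lt; lra).
      simpl pow; nra.
    - apply ex_series_geom; rewrite Rabs_pos_eq; lra.
    - intros x y Hx Hy; apply ln_series; specialize (Bw x y Hx Hy); lra. }
  eapply AE_ext; [|exact (AE_plus _ _ _ _ _ _ _ (AE_const x0 y0 (q * r) (ln (Rabs (v0 / 2)))) AL)].
  intros x y Hx Hy; cbv beta; specialize (Bw x y Hx Hy); apply Rabs_le_between in Bw.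
  rewrite <- ln_mult.
  + f_equal; rewrite Ef; rewrite <- (Rabs_pos_eq (1 + w x y)) at 1 by lra.
    rewrite <- Rabs_mult; f_equal; field.
  + apply Rabs_pos_lt; unfold Rdiv; apply Rmult_integral_contrapositive; split; lra.
  + lra.
- intros x y Hx Hy; specialize (Bw x y Hx Hy); apply Rabs_le_between in Bw.
  rewrite Ef; split.
  + apply Rmult_integral_contrapositive; split; lra.
  + replace (v0 * (1 + w x y) / v0) with (1 + w x y) by (field; trivial); lra.
Qed.

(* Since N - 1 is the degree, WW k 0 = 0 and exp(sU) sum_i k_i (sV)^i = sum_q s^q WW k (q+1) U V. *)
Definition WW (k : nat -> R) (N : nat) (U V : R) : R :=
  Rsum (fun i => k i * (U ^ (N - 1 - i) / INR (fact (N - 1 - i))) * V ^ i) N.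

(** Coefficients of the derivative of [sum_i k_i V^i]. *)
Definition Dseq (k : nat -> R) (i : nat) : R := INR (S i) * k (S i).

Lemma Rsum_shift a N : Rsum a (S N) = a 0%nat + Rsum (fun i => a (S i)) N.
Proof. induction N as [|N IH]; simpl in *; [ring|rewrite IH; ring]. Qed.

Lemma Rsum_S a N : Rsum a (S N) = Rsum a N + a N.
Proof. reflexivity. Qed.

Lemma Rsum_0 a N : (forall n, (n < N)%nat -> a n = 0) -> Rsum a N = 0.
Proof. intros H; rewrite (Rsum_ext a (fun _ => 0 * 0)), Rsum_scal; [ring|]; intros; rewrite H; trivial; ring. Qed.

Lemma is_derive_Rsum (f : nat -> R -> R) (d : nat -> R) t N :
  (forall n, is_derive (f n) t (d n)) -> is_derive (fun t => Rsum (fun n => f n t) N) t (Rsum d N).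
Proof.
intros H; induction N as [|N IH]; simpl.
- exact (is_derive_const (V := R_NormedModule) 0 t).
- exact (is_derive_plus (V := R_NormedModule) _ _ _ _ _ IH (H N)).
Qed.

(* The chain rule along curves stands in for partial derivatives WU, WV on the half planes V in D. *)
Definition chain (D : R -> Prop) (W WU WV : R -> R -> R) : Prop :=
  forall (g h : R -> R) t g' h', D (h t) -> is_derive g t g' -> is_derive h t h' ->
    is_derive (fun t => W (g t) (h t)) t (WU (g t) (h t) * g' + WV (g t) (h t) * h').

Definition dpow' (p : nat) (U : R) : R :=
  match p with O => 0 | S p => U ^ p / INR (fact p) end.

Lemma is_derive_dpow p g t g' : is_derive g t g' ->
  is_derive (fun t => g t ^ p / INR (fact p)) t (dpow' p (g t) * g').
Proof.
intros H; assert (F := INR_fact_neq_0).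
replace (dpow' p (g t) * g') with (INR p * g' * g t ^ pred p * / INR (fact p)).
- apply (is_derive_scal_l (V := R_NormedModule) (fun t => g t ^ p)).
  now apply (is_derive_pow g).
- destruct p as [|p]; [simpl; field|].
  unfold dpow'; simpl pred; rewrite fact_simpl, mult_INR; field; split; trivial.
  now apply not_0_INR.
Qed.

(** The divided powers [U^p / p!] make the [U]-derivative a mere drop in degree with the same
    coefficients, while the [V]-derivative also shifts the coefficients. *)
Lemma chain_WW D k N : chain D (WW k N) (WW k (pred N)) (WW (Dseq k) (pred N)).
Proof.
intros g h t g' h' _ Hg Hh; unfold WW.
set (d i := k i * dpow' (N - 1 - i) (g t) * h t ^ i * g' +
   k i * (g t ^ (N - 1 - i) / INR (fact (N - 1 - i))) * (INR i * h t ^ pred i) * h').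
replace (_ + _) with (Rsum d N).
- apply (is_derive_Rsum (fun i t => k i * (g t ^ (N - 1 - i) / INR (fact (N - 1 - i))) * h t ^ i)).
  intros i; unfold d.
  assert (D1 := is_derive_dpow (N - 1 - i) g t g' Hg).
  assert (D2 := is_derive_pow h i t h' Hh).
  apply is_derive_ext with (fun t => k i * ((g t ^ (N - 1 - i) / INR (fact (N - 1 - i))) * h t ^ i)).
  { intros; eqR; ring. }
  replace (k i * dpow' (N - 1 - i) (g t) * h t ^ i * g' +
   k i * (g t ^ (N - 1 - i) / INR (fact (N - 1 - i))) * (INR i * h t ^ pred i) * h') with
   (k i * (dpow' (N - 1 - i) (g t) * g' * h t ^ i +
     (g t ^ (N - 1 - i) / INR (fact (N - 1 - i))) * (INR i * h' * h t ^ pred i))) by ring.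
  apply is_derive_scal.
  apply (is_derive_mult (K := R_AbsRing) (fun t => g t ^ (N - 1 - i) / INR (fact (N - 1 - i))) (fun t => h t ^ i)); trivial.
  intros; apply Rmult_comm.
- unfold d; rewrite Rsum_plus.
  destruct N as [|N]; [simpl; ring|].
  simpl pred; f_equal.
  + rewrite (Rsum_ext _ (fun i => g' * (k i * dpow' (S N - 1 - i) (g t) * h t ^ i))), Rsum_scal
      by (intros; ring).
    (* The last term carries [U^0] and drops out under the [U]-derivative; under the [V]-derivative
       it will be the first term that drops. *)
    rewrite Rmult_comm; f_equal; rewrite Rsum_S.
    replace (S N - 1 - N)%nat with 0%nat by lia; change (dpow' 0 (g t)) with 0.
    rewrite Rmult_0_r, Rmult_0_l, Rplus_0_r; apply Rsum_ext; intros n Hn.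
    replace (S N - 1 - n)%nat with (S (N - 1 - n)) by lia; reflexivity.
  + rewrite (Rsum_ext _ (fun i => h' * (k i * (g t ^ (S N - 1 - i) / INR (fact (S N - 1 - i))) * (INR i * h t ^ pred i)))), Rsum_scal
      by (intros; ring).
    rewrite Rmult_comm; f_equal; rewrite Rsum_shift.
    rewrite Rmult_0_l, Rmult_0_r, Rplus_0_l; apply Rsum_ext; intros n Hn.
    replace (S N - 1 - S n)%nat with (N - 1 - n)%nat by lia; simpl pred; unfold Dseq; ring.
Qed.

Lemma chain_plus D F FU FV G GU GV : chain D F FU FV -> chain D G GU GV ->
  chain D (fun U V => F U V + G U V) (fun U V => FU U V + GU U V) (fun U V => FV U V + GV U V).
Proof.
intros HF HG g h t g' h' Hd Hg Hh.
replace (_ + _) with ((FU (g t) (h t) * g' + FV (g t) (h t) * h') + (GU (g t) (h t) * g' + GV (g t) (h t) * h')) by ring.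
apply (is_derive_plus (V := R_NormedModule) (fun t => F (g t) (h t)) (fun t => G (g t) (h t))); auto.
Qed.

Lemma chain_mult D F FU FV G GU GV : chain D F FU FV -> chain D G GU GV ->
  chain D (fun U V => F U V * G U V) (fun U V => FU U V * G U V + F U V * GU U V)
    (fun U V => FV U V * G U V + F U V * GV U V).
Proof.
intros HF HG g h t g' h' Hd Hg Hh.
replace (_ + _) with ((FU (g t) (h t) * g' + FV (g t) (h t) * h') * G (g t) (h t) + F (g t) (h t) * (GU (g t) (h t) * g' + GV (g t) (h t) * h')) by ring.
apply (is_derive_mult (K := R_AbsRing) (fun t => F (g t) (h t)) (fun t => G (g t) (h t))); auto.
intros; apply Rmult_comm.
Qed.

Lemma chain_scal D k F FU FV : chain D F FU FV ->
  chain D (fun U V => k * F U V) (fun U V => k * FU U V) (fun U V => k * FV U V).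
Proof.
intros HF g h t g' h' Hd Hg Hh.
replace (_ + _) with (k * (FU (g t) (h t) * g' + FV (g t) (h t) * h')) by ring.
apply is_derive_scal; auto.
Qed.

Lemma chain_eq D F FU FV FU' FV' : chain D F FU FV ->
  (forall U V, D V -> FU U V = FU' U V) -> (forall U V, D V -> FV U V = FV' U V) -> chain D F FU' FV'.
Proof. intros HF HU HV g h t g' h' Hd Hg Hh; rewrite <- HU, <- HV by trivial; auto. Qed.

(** With the absolute value the derivative is [1 / V] on both half lines, so one family of solutions
    serves positive and negative [v]. *)
Lemma chain_ln : chain (fun V => V <> 0) (fun _ V => ln (Rabs (V / 2))) (fun _ _ => 0) (fun _ V => / V).
Proof.
intros g h t g' h' Hd Hg Hh; cbv beta in Hd |- *.
replace (0 * g' + / h t * h') with (h' * / h t) by ring.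
assert (L : is_derive (fun V => ln (Rabs (V / 2))) (h t) (/ h t)).
{ assert (Hpos : h t / 2 <> 0) by lra.
  auto_derive.
  - split; trivial; split; trivial; now apply Rabs_pos_lt.
  - unfold sign; destruct total_order_T as [[H|H]|H]; try lra.
    + rewrite Rabs_pos_eq by lra; field; lra.
    + rewrite Rabs_left by lra; field; lra. }
exact (is_derive_comp (fun V => ln (Rabs (V / 2))) h t (/ h t) h' L Hh).
Qed.

Lemma chain_inv : chain (fun V => V <> 0) (fun _ V => / V) (fun _ _ => 0) (fun _ V => - / V ^ 2).
Proof.
intros g h t g' h' Hd Hg Hh; cbv beta in Hd |- *.
replace (0 * g' + - / h t ^ 2 * h') with (h' * (- / h t ^ 2)) by ring.
assert (L : is_derive (fun V => / V) (h t) (- / h t ^ 2)) by (auto_derive; trivial; field; trivial).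
exact (is_derive_comp (fun V => / V) h t (- / h t ^ 2) h' L Hh).
Qed.

(** * Recurrences from Bessel's equation *)

Definition Sseq (k : nat -> R) (i : nat) : R := match i with O => 0 | S i => k i end.
(** Coefficients of [V k + V k'' + k'], the left side of Bessel's equation of order zero; [Sseq] is
    multiplication by [V]. *)
Definition Lseq (k : nat -> R) (i : nat) : R := Sseq k i + Sseq (Dseq (Dseq k)) i + Dseq k i.

Lemma WW_shift k N U V : WW (Sseq k) (S N) U V = V * WW k N U V.
Proof.
unfold WW; rewrite Rsum_shift, <- Rsum_scal; simpl Sseq at 1.
rewrite !Rmult_0_l, Rplus_0_l; apply Rsum_ext; intros i Hi.
replace (S N - 1 - S i)%nat with (N - 1 - i)%nat by lia; simpl; ring.
Qed.

Lemma WW_plus k l N U V : WW (fun i => k i + l i) N U V = WW k N U V + WW l N U V.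
Proof. unfold WW; rewrite <- Rsum_plus; apply Rsum_ext; intros; ring. Qed.

Lemma WW_scal a k N U V : WW (fun i => a * k i) N U V = a * WW k N U V.
Proof. unfold WW; rewrite <- Rsum_scal; apply Rsum_ext; intros; ring. Qed.

Lemma WW_zero k N U V : (forall i, k i = 0) -> WW k N U V = 0.
Proof. intros H; apply Rsum_0; intros; rewrite H; ring. Qed.

(** Two derivatives followed by a factor [V] lower the degree as much as one derivative does, so all
    terms are homogeneous of the same degree. For [N <= 1] every sum is empty, which agrees with the
    truncation of [pred]. *)
Lemma WW_L k N U V :
  V * (WW k (pred (pred N)) U V + WW (Dseq (Dseq k)) (pred (pred N)) U V) + WW (Dseq k) (pred N) U V
  = WW (Lseq k) (pred N) U V.
Proof.
destruct N as [|[|N]]; simpl pred; try (unfold WW; simpl; ring).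
unfold Lseq; rewrite (WW_plus (fun i => Sseq k i + Sseq (Dseq (Dseq k)) i)), WW_plus, !WW_shift; ring.
Qed.

Definition evens (c : nat -> R) (i : nat) : R := if Nat.even i then c (Nat.div2 i) else 0.

Lemma evens_double c k : evens c (2 * k) = c k.
Proof. unfold evens; now rewrite Nat.even_even, Nat.div2_double. Qed.

Lemma evens_succ_double c k : evens c (S (2 * k)) = 0.
Proof. unfold evens; replace (S (2 * k)) with (2 * k + 1)%nat by lia; now rewrite Nat.even_odd. Qed.

Lemma even_odd_cases (P : nat -> Prop) :
  (forall k, P (2 * k)%nat) -> (forall k, P (S (2 * k))) -> forall i, P i.
Proof.
intros H0 H1 i; destruct (Nat.Even_or_Odd i) as [[k ->]|[k ->]]; trivial.
replace (2 * k + 1)%nat with (S (2 * k)) by lia; trivial.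
Qed.

(** At [V^(2k+1)] the two derivative terms contribute [(2k+2)(2k+1) + (2k+2) = (2k+2)^2] times the
    next even coefficient; parity removes the other powers. *)
Lemma Lseq_evens c (e : nat -> R) :
  (forall k, c k + (2 * INR (S k)) ^ 2 * c (S k) = e k) ->
  forall i, Lseq (evens c) i = Sseq (evens e) i.
Proof.
intros H [|i]; unfold Lseq, Dseq, Sseq.
- change 1%nat with (S (2 * 0)); rewrite evens_succ_double; ring.
- revert i; apply even_odd_cases; intros k.
  + replace (S (S (2 * k))) with (2 * (S k))%nat by lia; rewrite !evens_double, <- H.
    replace (INR (2 * S k)) with (2 * INR (S k)) by (rewrite mult_INR; simpl; ring).
    replace (INR (S (2 * k))) with (2 * INR (S k) - 1) by (rewrite !S_INR, mult_INR; simpl; ring).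
    ring.
  + replace (S (S (S (2 * k)))) with (S (2 * (S k))) by lia; rewrite !evens_succ_double; ring.
Qed.

Definition jc (k : nat) : R := (-1) ^ k / (INR (fact k)) ^ 2 * / 4 ^ k.

Definition kap : nat -> R := evens jc.
Definition del : nat -> R := evens d_coef.

Lemma jc_rec k : jc k + (2 * INR (S k)) ^ 2 * jc (S k) = 0.
Proof.
unfold jc; rewrite fact_simpl, mult_INR; simpl pow.
assert (F := INR_fact_neq_0 k); assert (G := not_0_INR (S k) ltac:(lia)).
assert (P : 4 ^ k <> 0) by (apply pow_nonzero; lra).
field; auto.
Qed.

(** [d_coef k] is [2 / PI * (euler_gamma - harmonic k) * jc k]. The part with [euler_gamma]
    satisfies the homogeneous recurrence of [jc], and the increment [1 / (k+1)] of the harmonic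
    numbers produces the right side. The latter cancels the term [2 J0'] left over when the
    logarithm is differentiated. *)
Lemma d_coef_rec k : d_coef k + (2 * INR (S k)) ^ 2 * d_coef (S k) =
  - (2 * (2 / PI) * (2 * INR (S k)) * jc (S k)).
Proof.
unfold d_coef, jc; rewrite fact_simpl, mult_INR; simpl pow; simpl harmonic.
change (match k with O => 1 | S _ => INR k + 1 end) with (INR (S k)).
assert (F := INR_fact_neq_0 k); assert (G := not_0_INR (S k) ltac:(lia)).
assert (P : 4 ^ k <> 0) by (apply pow_nonzero; lra); assert (Q := PI_neq0).
field; auto.
Qed.

Lemma Lseq_kap i : Lseq kap i = 0.
Proof.
unfold kap; rewrite (Lseq_evens jc (fun _ => 0)); [|apply jc_rec].
destruct i; simpl; trivial; unfold evens; now destruct Nat.even.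
Qed.

Lemma Lseq_del i : Lseq del i + 2 * (2 / PI) * Dseq kap i = 0.
Proof.
unfold del, kap; rewrite (Lseq_evens d_coef _ d_coef_rec).
destruct i as [|i]; unfold Sseq, Dseq.
- change 1%nat with (S (2 * 0)) at 2; rewrite evens_succ_double; ring.
- revert i; apply even_odd_cases; intros k.
  + replace (S (S (2 * k))) with (2 * (S k))%nat by lia; rewrite !evens_double.
    replace (INR (2 * S k)) with (2 * INR (S k)) by (rewrite mult_INR; simpl; ring).
    ring.
  + replace (S (S (S (2 * k)))) with (S (2 * (S k))) by lia; rewrite !evens_succ_double; ring.
Qed.

(** * Factorial decay of the coefficients and of the homogeneous functions *)

(** The central binomial coefficient is at most [4^k]. This converts the decay [1 / (4^k k!^2)] of
    the Bessel coefficients into [1 / (2k)!]. *)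
Lemma fact_double_le k : INR (fact (2 * k)) <= 4 ^ k * INR (fact k) ^ 2.
Proof.
induction k as [|k IH]; [simpl; lra|].
replace (2 * S k)%nat with (S (S (2 * k))) by lia.
rewrite !fact_simpl, !mult_INR, !S_INR, mult_INR; simpl (INR 2).
assert (F := pos_INR k); assert (G := INR_fact_lt_0 k); assert (G2 := INR_fact_lt_0 (2 * k)).
simpl pow in *.
set (f := INR (fact k)) in *; set (p := 4 ^ k) in *; set (h := INR (fact (2 * k))) in *; set (n := INR k) in *.
apply Rle_trans with (4 * (n + 1) * (n + 1) * h).
- assert (0 <= (n + 1) * h) by (apply Rmult_le_pos; lra); nra.
- replace (4 * p * ((n + 1) * f * ((n + 1) * f * 1))) with (4 * (n + 1) * (n + 1) * (p * (f * (f * 1)))) by ring.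
  apply Rmult_le_compat_l; trivial; nra.
Qed.

Lemma evens_bound c C B : 0 <= C -> 0 <= B ->
  (forall k, Rabs (c k) <= C * B ^ (2 * k) / (4 ^ k * INR (fact k) ^ 2)) ->
  forall i, Rabs (evens c i) <= C * B ^ i / INR (fact i).
Proof.
intros HC HB H; apply even_odd_cases; intros k.
- rewrite evens_double; eapply Rle_trans; [apply H|].
  unfold Rdiv; apply Rmult_le_compat_l; [apply Rmult_le_pos; trivial; now apply pow_le|].
  apply Rinv_le_contravar; [apply INR_fact_lt_0|apply fact_double_le].
- rewrite evens_succ_double, Rabs_R0.
  apply Rdiv_le_0_compat; [apply Rmult_le_pos; trivial; now apply pow_le|apply INR_fact_lt_0].
Qed.

(** Exponential type: the factor [1 / i!] matches the divided powers of [U], so that the binomial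
    theorem can sum the products. *)
Definition coef_bound (C B : R) (k : nat -> R) : Prop :=
  0 <= C /\ 0 <= B /\ forall i, Rabs (k i) <= C * B ^ i / INR (fact i).

Lemma kap_bound : coef_bound 1 1 kap.
Proof.
split; [lra|split; [lra|]]; apply evens_bound; try lra; intros k; right.
unfold jc, Rdiv; rewrite !Rabs_mult, pow_1_abs, pow1, !Rmult_1_l.
assert (F := INR_fact_lt_0 k); assert (0 < 4 ^ k) by (apply pow_lt; lra).
assert (0 < INR (fact k) ^ 2) by now apply pow_lt.
rewrite !Rabs_pos_eq by (apply Rlt_le, Rinv_0_lt_compat; trivial).
rewrite Rinv_mult; ring.
Qed.

Lemma harmonic_bound k : 0 <= harmonic k <= INR k.
Proof.
induction k as [|k IH]; [simpl; lra|].
simpl harmonic; change (match k with O => 1 | S _ => INR k + 1 end) with (INR (S k)).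
assert (P : 1 <= INR (S k)) by (rewrite S_INR; generalize (pos_INR k); lra).
assert (0 < / INR (S k)) by (apply Rinv_0_lt_compat; lra).
assert (/ INR (S k) <= 1) by (apply Rmult_le_reg_r with (INR (S k)); [lra|rewrite Rinv_l; lra]).
rewrite S_INR in *; lra.
Qed.

Lemma INR_le_pow4 k : INR k + 1 <= 4 ^ k.
Proof. induction k as [|k IH]; [simpl; lra|]; rewrite S_INR; simpl pow; generalize (pos_INR k); lra. Qed.

(** The harmonic numbers are bounded by [4^k = 2^(2k)], whence [B = 2]. *)
Lemma del_bound : coef_bound (2 / PI * (Rabs euler_gamma + 1)) 2 del.
Proof.
assert (PI0 := PI_RGT_0); assert (G0 := Rabs_pos euler_gamma).
assert (P2 : 0 < 2 / PI) by (apply Rdiv_lt_0_compat; lra).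
assert (C0 : 0 <= 2 / PI * (Rabs euler_gamma + 1)) by (apply Rmult_le_pos; lra).
split; trivial; split; [lra|]; apply evens_bound; try lra; intros k.
unfold d_coef, Rdiv at 2; rewrite !Rabs_mult, pow_1_abs, Rmult_1_l, (Rabs_pos_eq (2 / PI)) by lra.
assert (F := INR_fact_lt_0 k); assert (0 < 4 ^ k) by (apply pow_lt; lra).
assert (0 < INR (fact k) ^ 2) by now apply pow_lt.
assert (Q : 0 < 4 ^ k * INR (fact k) ^ 2) by now apply Rmult_lt_0_compat.
assert (Q' := Rinv_0_lt_compat _ Q).
rewrite (Rabs_pos_eq (/ _)) by lra.
unfold Rdiv at 2; rewrite !Rmult_assoc; apply Rmult_le_compat_l; [lra|].
rewrite <- Rmult_assoc; apply Rmult_le_compat_r; [lra|].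
rewrite pow_mult; replace (2 ^ 2) with 4 by ring.
assert (Hh := harmonic_bound k); assert (H4 := INR_le_pow4 k); assert (Hk := pos_INR k).
apply Rle_trans with (Rabs euler_gamma + INR k).
- unfold Rminus; eapply Rle_trans; [apply Rabs_triang|].
  rewrite Rabs_Ropp, (Rabs_pos_eq (harmonic k)); lra.
- nra.
Qed.

Lemma coef_bound_mono C B C' B' k : C <= C' -> B <= B' -> coef_bound C B k -> coef_bound C' B' k.
Proof.
intros HC HB [C0 [B0 H]]; split; [lra|split; [lra|]]; intros i; eapply Rle_trans; [apply H|].
unfold Rdiv; apply Rmult_le_compat_r; [apply Rlt_le, Rinv_0_lt_compat, INR_fact_lt_0|].
apply Rmult_le_compat; trivial; [now apply pow_le|now apply pow_incr].
Qed.

(** With [1 / i!] and [1 / (q-i)!] present in each term, the sum is dominated by the binomial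
    expansion of [(M + B N)^q / q!]. The numbers [M], [N] stand for norms in the algebra as well as
    for absolute values. *)
Lemma WW_norm_bound C B k M N q : coef_bound C B k -> 0 <= M -> 0 <= N ->
  Rsum (fun i => Rabs (k i) * (M ^ (S q - 1 - i) / INR (fact (S q - 1 - i))) * N ^ i) (S q)
  <= C * ((M + B * N) ^ q / INR (fact q)).
Proof.
intros [C0 [B0 H]] HM HN.
rewrite Rplus_comm, binomial.
replace (C * (sum_f_R0 (fun i => Binomial.C q i * (B * N) ^ i * M ^ (q - i)) q / INR (fact q)))
 with (Rsum (fun i => C * / INR (fact q) * (Binomial.C q i * (B * N) ^ i * M ^ (q - i))) (S q)).
2:{ rewrite Rsum_scal.
  replace (Rsum (fun i => Binomial.C q i * (B * N) ^ i * M ^ (q - i)) (S q)) with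
   (sum_f_R0 (fun i => Binomial.C q i * (B * N) ^ i * M ^ (q - i)) q).
  - unfold Rdiv; ring.
  - rewrite <- Rsum_sum_n; symmetry; apply sum_n_Reals. }
rewrite <- !Rsum_sum_n; apply sum_n_le; intros i Hi.
replace (S q - 1 - i)%nat with (q - i)%nat by lia.
unfold Binomial.C; rewrite Rpow_mult_distr.
assert (F1 := INR_fact_lt_0 q); assert (F2 := INR_fact_lt_0 i); assert (F3 := INR_fact_lt_0 (q - i)).
replace (C * / INR (fact q) * (INR (fact q) / (INR (fact i) * INR (fact (q - i))) * (B ^ i * N ^ i) * M ^ (q - i)))
 with (C * B ^ i / INR (fact i) * (M ^ (q - i) / INR (fact (q - i))) * N ^ i) by (field; lra).
apply Rmult_le_compat_r; [now apply pow_le|].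
apply Rmult_le_compat_r; [apply Rdiv_le_0_compat; trivial; now apply pow_le|apply H].
Qed.

Lemma AE_Rsum x0 y0 r (Mn : nat -> R) (f : nat -> R -> R -> R) N :
  (forall n, AE x0 y0 r (Mn n) (f n)) -> AE x0 y0 r (Rsum Mn N) (fun x y => Rsum (fun n => f n x y) N).
Proof.
intros H; induction N as [|N IH]; simpl.
- generalize (AE_const x0 y0 r 0); now rewrite Rabs_R0.
- now apply AE_plus.
Qed.

Lemma AE_WW x0 y0 r M N u v C B k q : 0 < r -> AE x0 y0 r M u -> AE x0 y0 r N v -> coef_bound C B k ->
  AE x0 y0 r (C * ((M + B * N) ^ q / INR (fact q))) (fun x y => WW k (S q) (u x y) (v x y)).
Proof.
intros Hr Hu Hv Hk.
eapply AE_mono; [apply (WW_norm_bound C B k); trivial; [apply (AE_ge0 _ _ _ _ _ Hu)|apply (AE_ge0 _ _ _ _ _ Hv)]|].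
unfold WW; apply AE_Rsum; intros i; apply AE_mult; trivial; [|now apply AE_pow].
assert (A := AE_scal _ _ _ _ _ (k i * / INR (fact (S q - 1 - i))) (AE_pow _ _ _ _ _ (S q - 1 - i) Hr Hu)).
eapply AE_ext; [|eapply AE_mono; [|exact A]].
- intros; cbv beta; unfold Rdiv; ring.
- rewrite Rabs_mult, (Rabs_pos_eq (/ _)) by apply Rlt_le, Rinv_0_lt_compat, INR_fact_lt_0.
  unfold Rdiv; right; ring.
Qed.

(* kap and del are the Taylor coefficients of J0 and of Y0(z) - (2/PI) ln(z/2) J0(z), see J0_expansion. *)
Definition TT (al be : R) (N : nat) (U V : R) : R :=
  al * WW kap N U V + be * (WW del N U V + 2 / PI * (ln (Rabs (V / 2)) * WW kap N U V)).

(** In the constant, 2 collects the two terms without logarithm and [2 / PI * L] the one with it. *)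
Lemma AE_TT x0 y0 r M N L u v C B a al be q : 0 < r -> AE x0 y0 r M u -> AE x0 y0 r N v ->
  AE x0 y0 r L (fun x y => ln (Rabs (v x y / 2))) -> coef_bound C B kap -> coef_bound C B del ->
  Rabs al <= a -> Rabs be <= a ->
  AE x0 y0 r (a * ((2 + 2 / PI * L) * (C * ((M + B * N) ^ q / INR (fact q)))))
    (fun x y => TT al be (S q) (u x y) (v x y)).
Proof.
intros Hr Hu Hv HL Hk Hd Ha Hb; unfold TT.
assert (A1 := AE_WW _ _ _ _ _ _ _ _ _ _ q Hr Hu Hv Hk).
assert (A2 := AE_WW _ _ _ _ _ _ _ _ _ _ q Hr Hu Hv Hd).
assert (L0 := AE_ge0 _ _ _ _ _ HL); assert (W0 := AE_ge0 _ _ _ _ _ A1).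
set (w := C * ((M + B * N) ^ q / INR (fact q))) in *.
assert (P0 : 0 < 2 / PI) by (apply Rdiv_lt_0_compat; [lra|apply PI_RGT_0]).
assert (A3 := AE_scal _ _ _ _ _ (2 / PI) (AE_mult _ _ _ _ _ _ _ Hr HL A1)).
assert (A4 := AE_scal _ _ _ _ _ be (AE_plus _ _ _ _ _ _ _ A2 A3)).
eapply AE_mono; [|exact (AE_plus _ _ _ _ _ _ _ (AE_scal _ _ _ _ _ al A1) A4)].
rewrite (Rabs_pos_eq (2 / PI)) by lra.
assert (0 <= w + 2 / PI * (L * w)).
{ assert (0 <= L * w) by now apply Rmult_le_pos. nra. }
assert (Rabs al * w <= a * w) by now apply Rmult_le_compat_r.
assert (Rabs be * (w + 2 / PI * (L * w)) <= a * (w + 2 / PI * (L * w))) by now apply Rmult_le_compat_r.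
lra.
Qed.

(** [TTV], [TTUV], [TTVV] are the derivatives of [TT] in [V], [UV] and [VV]; the [U]-derivative is
    [TT] itself one degree lower. *)
Definition TTV (al be : R) (N : nat) (U V : R) : R :=
  al * WW (Dseq kap) (pred N) U V + be * (WW (Dseq del) (pred N) U V +
    2 / PI * (/ V * WW kap N U V + ln (Rabs (V / 2)) * WW (Dseq kap) (pred N) U V)).

Definition TTUV (al be : R) (N : nat) (U V : R) : R :=
  al * WW (Dseq kap) (pred (pred N)) U V + be * (WW (Dseq del) (pred (pred N)) U V +
    2 / PI * (/ V * WW kap (pred N) U V + ln (Rabs (V / 2)) * WW (Dseq kap) (pred (pred N)) U V)).

Definition TTVV (al be : R) (N : nat) (U V : R) : R :=
  al * WW (Dseq (Dseq kap)) (pred (pred N)) U V + be * (WW (Dseq (Dseq del)) (pred (pred N)) U V +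
    2 / PI * (- / V ^ 2 * WW kap N U V + 2 * / V * WW (Dseq kap) (pred N) U V
      + ln (Rabs (V / 2)) * WW (Dseq (Dseq kap)) (pred (pred N)) U V)).

Lemma chain_TT al be N : chain (fun V => V <> 0) (TT al be N) (TT al be (pred N)) (TTV al be N).
Proof.
unfold TT, TTV; eapply chain_eq.
- apply chain_plus; [apply chain_scal, chain_WW|].
  apply chain_scal, chain_plus; [apply chain_WW|apply chain_scal, chain_mult; [apply chain_ln|apply chain_WW]].
- intros; cbv beta; ring.
- intros; cbv beta; ring.
Qed.

Lemma chain_TTV al be N : chain (fun V => V <> 0) (TTV al be N) (TTUV al be N) (TTVV al be N).
Proof.
unfold TTV, TTUV, TTVV; eapply chain_eq.
- apply chain_plus; [apply chain_scal, chain_WW|].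
  apply chain_scal, chain_plus; [apply chain_WW|apply chain_scal].
  apply chain_plus; apply chain_mult; [apply chain_inv|apply chain_WW|apply chain_ln|apply chain_WW].
- intros; cbv beta; ring.
- intros; cbv beta; ring.
Qed.

(** The undifferentiated logarithm multiplies the homogeneous equation for [kap]. The terms with
    [- / V^2] and [/ V] times [WW kap N] cancel, and the remaining double of the first derivative is
    compensated by [del]. *)
Lemma TT_PDE al be N U V : V <> 0 ->
  V * (TT al be (pred (pred N)) U V + TTVV al be N U V) + TTV al be N U V = 0.
Proof.
intros HV.
assert (E1 := WW_L kap N U V); rewrite (WW_zero (Lseq kap)) in E1 by apply Lseq_kap.
assert (E2 := WW_L del N U V).
assert (E3 : WW (Lseq del) (pred N) U V + 2 * (2 / PI) * WW (Dseq kap) (pred N) U V = 0).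
{ rewrite <- WW_scal, <- WW_plus; apply WW_zero, Lseq_del. }
rewrite <- E2 in E3; unfold TT, TTV, TTVV.
set (c := 2 / PI) in *; set (l := ln (Rabs (V / 2))).
match goal with |- ?a = 0 => transitivity
 ((al + be * c * l) * (V * (WW kap (pred (pred N)) U V + WW (Dseq (Dseq kap)) (pred (pred N)) U V) +
     WW (Dseq kap) (pred N) U V)
  + be * (V * (WW del (pred (pred N)) U V + WW (Dseq (Dseq del)) (pred (pred N)) U V) +
     WW (Dseq del) (pred N) U V + 2 * c * WW (Dseq kap) (pred N) U V)) end.
- field; trivial.
- rewrite E1, E3; ring.
Qed.

(** * The equation for psi and the Poisson bracket *)

Lemma AE_analytic x0 y0 r M f : 0 < r -> AE x0 y0 r M f -> real_analytic_at f x0 y0.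
Proof.
intros Hr [c [A E]]; exists r; split; trivial; exists c; intros x y Hx Hy.
apply Rlt_le in Hx; apply Rlt_le in Hy.
assert (B := abs2_box _ _ _ _ _ Hx Hy A).
assert (Q : forall i j, Rabs (c i j * (x - x0) ^ i * (y - y0) ^ j) = Rabs (c i j) * Rabs (x - x0) ^ i * Rabs (y - y0) ^ j).
{ intros; now rewrite !Rabs_mult, !RPow_abs. }
split; [|split].
- intros i; eapply ex_series_ext; [|exact (abs2_row _ _ i B)]; intros j; apply Q.
- eapply ex_series_ext; [|exact (proj1 (abs2_rows _ _ B))]; intros i.
  apply Series_ext; intros j; apply Q.
- now apply E.
Qed.

Lemma AE_dx x0 y0 r r' M f : 0 <= r' < r -> AE x0 y0 r M f -> exists M', AE x0 y0 r' M' (dx f).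
Proof. intros Hr [c A]; destruct (AN_dx _ _ _ _ _ _ _ Hr A) as [M' A']; exists M'; now exists (dXc c). Qed.

Lemma AE_dy x0 y0 r r' M f : 0 <= r' < r -> AE x0 y0 r M f -> exists M', AE x0 y0 r' M' (dy f).
Proof. intros Hr [c A]; destruct (AN_dy _ _ _ _ _ _ _ Hr A) as [M' A']; exists M'; now exists (dYc c). Qed.

Lemma AE_is_derive x0 y0 r M f x y : AE x0 y0 r M f -> Rabs (x - x0) < r -> Rabs (y - y0) < r ->
  is_derive (fun x => f x y) x (dx f x y) /\ is_derive (fun y => f x y) y (dy f x y).
Proof.
intros [c A] Hx Hy; split; apply Derive_correct; eexists.
- apply (AN_is_derive_x _ _ _ _ _ _ _ _ A); lra.
- apply (AN_is_derive_y _ _ _ _ _ _ _ _ A); lra.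
Qed.

(** Every derivative at the centre is read off as the constant term of a derived array. Both mixed
    derivatives yield the same coefficient, which is their symmetry. *)
Lemma AN_jet x0 y0 r c M f : 0 < r -> AN x0 y0 r c M f ->
  dx f x0 y0 = c 1%nat 0%nat /\ dy f x0 y0 = c 0%nat 1%nat /\
  dx (dx f) x0 y0 = 2 * c 2%nat 0%nat /\ dy (dy f) x0 y0 = 2 * c 0%nat 2%nat /\
  dx (dy f) x0 y0 = c 1%nat 1%nat /\ dy (dx f) x0 y0 = c 1%nat 1%nat.
Proof.
intros Hr A.
assert (H1 : 0 <= r / 2 < r) by lra; assert (H2 : 0 <= r / 4 < r / 2) by lra.
destruct (AN_dx _ _ _ _ _ _ _ H1 A) as [M1 A1], (AN_dy _ _ _ _ _ _ _ H1 A) as [M2 A2].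
destruct (AN_dx _ _ _ _ _ _ _ H2 A1) as [M3 A3], (AN_dy _ _ _ _ _ _ _ H2 A2) as [M4 A4].
destruct (AN_dx _ _ _ _ _ _ _ H2 A2) as [M5 A5], (AN_dy _ _ _ _ _ _ _ H2 A1) as [M6 A6].
apply AN_center in A1; [|lra]; apply AN_center in A2; [|lra]; apply AN_center in A3; [|lra].
apply AN_center in A4; [|lra]; apply AN_center in A5; [|lra]; apply AN_center in A6; [|lra].
rewrite A1, A2, A3, A4, A5, A6; unfold dXc, dYc; simpl INR; repeat split; ring.
Qed.

(* With V = v(x0, y0) and (a, b) = grad v(x0, y0) this is v Lap f + grad v . grad f at (x0, y0). Freezing
   the coefficients makes it linear in the Taylor coefficients of f, hence compatible with series. *)
Definition Lame (V a b : R) (f : R -> R -> R) (x0 y0 : R) : R :=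
  V * (dx (dx f) x0 y0 + dy (dy f) x0 y0) + a * dx f x0 y0 + b * dy f x0 y0.

Lemma is_series_0 : is_series (fun _ : nat => 0) 0.
Proof. exact (Series_single (fun _ => 0) (fun _ => eq_refl)). Qed.

Lemma Lame_series x0 y0 r (Mn : nat -> R) (f : nat -> R -> R -> R) F V a b :
  0 < r -> (forall n, AE x0 y0 r (Mn n) (f n)) -> ex_series Mn ->
  (forall x y, Rabs (x - x0) <= r -> Rabs (y - y0) <= r -> F x y = Series (fun n => f n x y)) ->
  (forall n, Lame V a b (f n) x0 y0 = 0) -> Lame V a b F x0 y0 = 0.
Proof.
intros Hr H EM HF HL.
(* The arrays are fixed once, so that the Taylor coefficients of [F] are the sums of those of the
   [f n]. *)
pose (c n := proj1_sig (constructive_indefinite_description _ (H n))).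
assert (Hc : forall n, AN x0 y0 r (c n) (Mn n) (f n))
  by (intros n; exact (proj2_sig (constructive_indefinite_description _ (H n)))).
destruct (AN_series x0 y0 r c Mn f F Hr Hc EM HF) as [A Ec].
destruct (AN_jet _ _ _ _ _ _ Hr A) as [J1 [J2 [J3 [J4 _]]]].
unfold Lame; rewrite J1, J2, J3, J4.
rewrite <- (Series_0 (fun n => Lame V a b (f n) x0 y0) HL).
assert (S1 : forall k i j, is_series (fun n => k * c n i j) (k * Series (fun n => c n i j))).
{ intros k i j; apply (is_series_scal (K := R_AbsRing) (V := R_NormedModule) k), Series_correct, Ec. }
symmetry; apply is_series_unique.
assert (S2 := is_series_plus _ _ _ _ (is_series_plus _ _ _ _ (is_series_plus _ _ _ _ (S1 (V * 2) 2%nat 0%nat) (S1 (V * 2) 0%nat 2%nat))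
   (S1 a 1%nat 0%nat)) (S1 b 0%nat 1%nat)).
replace (V * (2 * Series (fun n => c n 2%nat 0%nat) + 2 * Series (fun n => c n 0%nat 2%nat)) +
  a * Series (fun n => c n 1%nat 0%nat) + b * Series (fun n => c n 0%nat 1%nat)) with
 (plus (plus (plus (V * 2 * Series (fun n => c n 2%nat 0%nat)) (V * 2 * Series (fun n => c n 0%nat 2%nat)))
  (a * Series (fun n => c n 1%nat 0%nat))) (b * Series (fun n => c n 0%nat 1%nat))) by (unfold plus; simpl; ring).
revert S2; apply is_series_ext; intros n.
destruct (AN_jet _ _ _ _ _ _ Hr (Hc n)) as [K1 [K2 [K3 [K4 _]]]].
unfold Lame; rewrite K1, K2, K3, K4; unfold plus; simpl; ring.
Qed.

Lemma locally_abs x r : 0 < r -> locally x (fun z => Rabs (z - x) < r).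
Proof. intros Hr; exists (mkposreal _ Hr); intros z Hz; exact Hz. Qed.

(** By the Cauchy-Riemann equations [grad u] and [grad v] are orthogonal and equally long, and [u],
    [v] are harmonic. The mixed terms and the terms with second derivatives of [u], [v] disappear,
    leaving [|grad v|^2] times the equation in [(U, V)]. *)
Lemma Lame_comp D W WU WV WUU WUV WVU WVV x0 y0 r Mu Mv u v :
  0 < r -> AE x0 y0 r Mu u -> AE x0 y0 r Mv v ->
  (forall x y, Rabs (x - x0) < r -> Rabs (y - y0) < r ->
    dx u x y = dy v x y /\ dy u x y = - dx v x y /\ D (v x y)) ->
  chain D W WU WV -> chain D WU WUU WUV -> chain D WV WVU WVV ->
  (forall U V, D V -> V * (WUU U V + WVV U V) + WV U V = 0) ->
  Lame (v x0 y0) (dx v x0 y0) (dy v x0 y0) (fun x y => W (u x y) (v x y)) x0 y0 = 0.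
Proof.
intros Hr Au Av CR C0 CU CV PDE.
set (f x y := W (u x y) (v x y)).
assert (H0x : Rabs (x0 - x0) < r) by now rewrite Rminus_diag, Rabs_R0.
assert (H0y : Rabs (y0 - y0) < r) by now rewrite Rminus_diag, Rabs_R0.
assert (H1 : 0 <= r / 2 < r) by lra.
destruct (AE_dx _ _ _ _ _ _ H1 Au) as [M1 Aux], (AE_dx _ _ _ _ _ _ H1 Av) as [M2 Avx].
destruct (AE_dy _ _ _ _ _ _ H1 Au) as [M3 Auy], (AE_dy _ _ _ _ _ _ H1 Av) as [M4 Avy].
assert (H0 : Rabs (x0 - x0) < r / 2 /\ Rabs (y0 - y0) < r / 2)
  by (rewrite !Rminus_diag, Rabs_R0; lra); destruct H0 as [G1 G2].
assert (Dx : forall x y, Rabs (x - x0) < r -> Rabs (y - y0) < r ->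
  dx f x y = WU (u x y) (v x y) * dx u x y + WV (u x y) (v x y) * dx v x y).
{ intros x y Hx Hy; apply is_derive_unique.
  apply (C0 (fun x => u x y) (fun x => v x y) x); [now apply CR| |].
  - now apply (AE_is_derive _ _ _ _ _ x y Au).
  - now apply (AE_is_derive _ _ _ _ _ x y Av). }
assert (Dy : forall x y, Rabs (x - x0) < r -> Rabs (y - y0) < r ->
  dy f x y = WU (u x y) (v x y) * dy u x y + WV (u x y) (v x y) * dy v x y).
{ intros x y Hx Hy; apply is_derive_unique.
  apply (C0 (fun y => u x y) (fun y => v x y) y); [now apply CR| |].
  - now apply (AE_is_derive _ _ _ _ _ x y Au).
  - now apply (AE_is_derive _ _ _ _ _ x y Av). }
set (U := u x0 y0); set (V := v x0 y0).
destruct (CR x0 y0 H0x H0y) as [CR1 [CR2 HD]].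
destruct (AE_is_derive _ _ _ _ _ _ _ Au H0x H0y) as [ux uy].
destruct (AE_is_derive _ _ _ _ _ _ _ Av H0x H0y) as [vx vy].
destruct (AE_is_derive _ _ _ _ _ _ _ Aux G1 G2) as [uxx _].
destruct (AE_is_derive _ _ _ _ _ _ _ Avx G1 G2) as [vxx _].
destruct (AE_is_derive _ _ _ _ _ _ _ Auy G1 G2) as [_ uyy].
destruct (AE_is_derive _ _ _ _ _ _ _ Avy G1 G2) as [_ vyy].
assert (Dxx : dx (dx f) x0 y0 =
  (WUU U V * dx u x0 y0 + WUV U V * dx v x0 y0) * dx u x0 y0 + WU U V * dx (dx u) x0 y0 +
  ((WVU U V * dx u x0 y0 + WVV U V * dx v x0 y0) * dx v x0 y0 + WV U V * dx (dx v) x0 y0)).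
{ unfold dx at 1; rewrite (Derive_ext_loc _ (fun x => WU (u x y0) (v x y0) * dx u x y0 + WV (u x y0) (v x y0) * dx v x y0)).
  2:{ generalize (locally_abs x0 r Hr); apply filter_imp; intros z Hz; now apply Dx. }
  apply is_derive_unique.
  apply (is_derive_plus (V := R_NormedModule) (fun x => WU (u x y0) (v x y0) * dx u x y0) (fun x => WV (u x y0) (v x y0) * dx v x y0)).
  - apply (is_derive_mult (K := R_AbsRing) (fun x => WU (u x y0) (v x y0)) (fun x => dx u x y0)); trivial.
    + now apply (CU (fun x => u x y0) (fun x => v x y0) x0).
    + intros; apply Rmult_comm.
  - apply (is_derive_mult (K := R_AbsRing) (fun x => WV (u x y0) (v x y0)) (fun x => dx v x y0)); trivial.
    + now apply (CV (fun x => u x y0) (fun x => v x y0) x0).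
    + intros; apply Rmult_comm. }
assert (Dyy : dy (dy f) x0 y0 =
  (WUU U V * dy u x0 y0 + WUV U V * dy v x0 y0) * dy u x0 y0 + WU U V * dy (dy u) x0 y0 +
  ((WVU U V * dy u x0 y0 + WVV U V * dy v x0 y0) * dy v x0 y0 + WV U V * dy (dy v) x0 y0)).
{ unfold dy at 1; rewrite (Derive_ext_loc _ (fun y => WU (u x0 y) (v x0 y) * dy u x0 y + WV (u x0 y) (v x0 y) * dy v x0 y)).
  2:{ generalize (locally_abs y0 r Hr); apply filter_imp; intros z Hz; now apply Dy. }
  apply is_derive_unique.
  apply (is_derive_plus (V := R_NormedModule) (fun y => WU (u x0 y) (v x0 y) * dy u x0 y) (fun y => WV (u x0 y) (v x0 y) * dy v x0 y)).
  - apply (is_derive_mult (K := R_AbsRing) (fun y => WU (u x0 y) (v x0 y)) (fun y => dy u x0 y)); trivial.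
    + now apply (CU (fun y => u x0 y) (fun y => v x0 y) y0).
    + intros; apply Rmult_comm.
  - apply (is_derive_mult (K := R_AbsRing) (fun y => WV (u x0 y) (v x0 y)) (fun y => dy v x0 y)); trivial.
    + now apply (CV (fun y => u x0 y) (fun y => v x0 y) y0).
    + intros; apply Rmult_comm. }
destruct Au as [cu Au], Av as [cv Av].
destruct (AN_jet _ _ _ _ _ _ Hr Au) as [_ [_ [_ [_ [Ju Ju']]]]].
destruct (AN_jet _ _ _ _ _ _ Hr Av) as [_ [_ [_ [_ [Jv Jv']]]]].
(* Harmonicity: the differentiated Cauchy-Riemann equations turn pure second derivatives into mixed
   ones, which are symmetric. *)
assert (E1 : dx (dx u) x0 y0 = dx (dy v) x0 y0).
{ apply Derive_ext_loc; generalize (locally_abs x0 r Hr); apply filter_imp; intros z Hz; now apply CR. }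
assert (E2 : dy (dy u) x0 y0 = - dy (dx v) x0 y0).
{ transitivity (Derive (fun y => - dx v x0 y) y0); [apply Derive_ext_loc|apply Derive_opp].
  generalize (locally_abs y0 r Hr); apply filter_imp; intros z Hz; now apply CR. }
assert (E3 : dy (dy v) x0 y0 = dy (dx u) x0 y0).
{ apply Derive_ext_loc; generalize (locally_abs y0 r Hr); apply filter_imp; intros z Hz; symmetry; now apply CR. }
assert (E4 : dx (dx v) x0 y0 = - dx (dy u) x0 y0).
{ transitivity (Derive (fun x => - dy u x y0) x0); [apply Derive_ext_loc|apply Derive_opp].
  generalize (locally_abs x0 r Hr); apply filter_imp; intros z Hz.
  change (dx v z y0 = - dy u z y0); destruct (CR z y0 Hz H0y) as [_ [-> _]]; ring. }
unfold Lame; rewrite Dxx, Dyy, (Dx x0 y0), (Dy x0 y0) by trivial.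
rewrite E1, E2, E3, E4, Ju, Ju', Jv, Jv', CR1, CR2.
fold U V; specialize (PDE U V HD).
transitivity ((V * (WUU U V + WVV U V) + WV U V) * (dx v x0 y0 ^ 2 + dy v x0 y0 ^ 2)); [ring|].
rewrite PDE; ring.
Qed.

(** * Coordinate derivatives and the Poisson bracket *)

Lemma is_derive_Fint_coord (a b u v : R -> R) p1 p2 t a' b' u' v' :
  is_derive a t a' -> is_derive b t b' -> is_derive u t u' -> is_derive v t v' ->
  - b t * p1 + a t * p2 <> 0 ->
  is_derive (fun t => (- (b t * u t + a t * v t) * p1 + (a t * u t - b t * v t) * p2) / (- b t * p1 + a t * p2)) t
  (((- (b' * u t + b t * u' + a' * v t + a t * v') * p1 + (a' * u t + a t * u' - b' * v t - b t * v') * p2)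
      * (- b t * p1 + a t * p2)
    - (- (b t * u t + a t * v t) * p1 + (a t * u t - b t * v t) * p2) * (- b' * p1 + a' * p2))
    / (- b t * p1 + a t * p2) ^ 2).
Proof.
intros Ha Hb Hu Hv H; auto_derive.
- repeat split; trivial; eexists; eassumption.
- apply is_derive_unique in Ha; apply is_derive_unique in Hb.
  apply is_derive_unique in Hu; apply is_derive_unique in Hv.
  change (Derive (fun x => a x) t) with (Derive a t); change (Derive (fun x => b x) t) with (Derive b t).
  change (Derive (fun x => u x) t) with (Derive u t); change (Derive (fun x => v x) t) with (Derive v t).
  rewrite Ha, Hb, Hu, Hv; field; trivial.
Qed.

Lemma is_derive_Ham_coord (a b : R -> R) p1 p2 t a' b' :
  is_derive a t a' -> is_derive b t b' -> a t ^ 2 + b t ^ 2 <> 0 ->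
  is_derive (fun t => (p1 ^ 2 + p2 ^ 2) / (2 * (a t ^ 2 + b t ^ 2))) t
   (- (p1 ^ 2 + p2 ^ 2) * (a t * a' + b t * b') / (a t ^ 2 + b t ^ 2) ^ 2).
Proof.
intros Ha Hb H; auto_derive.
- repeat split; try (eexists; eassumption); simpl in H; lra.
- apply is_derive_unique in Ha; apply is_derive_unique in Hb.
  change (Derive (fun x => a x) t) with (Derive a t); change (Derive (fun x => b x) t) with (Derive b t).
  rewrite Ha, Hb; field; exact H.
Qed.

Lemma poisson_zero ps u v x y r Mp Mu Mv p1 p2 :
  0 < r -> AE x y r Mp ps -> AE x y r Mu u -> AE x y r Mv v ->
  dx u x y = dy v x y -> dy u x y = - dx v x y ->
  Lame (v x y) (dx v x y) (dy v x y) ps x y = 0 ->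
  Lambda ps x y <> 0 -> - dy ps x y * p1 + dx ps x y * p2 <> 0 ->
  ex_d4 (Fint ps u v) x y p1 p2 /\ ex_d4 (Ham ps) x y p1 p2 /\ poisson (Fint ps u v) (Ham ps) x y p1 p2 = 0.
Proof.
intros Hr Ap Au Av CR1 CR2 HL HLam HD.
assert (H1 : 0 <= r / 2 < r) by lra.
assert (G : Rabs (x - x) < r / 2 /\ Rabs (y - y) < r / 2) by (rewrite !Rminus_diag, Rabs_R0; lra).
destruct G as [Gx Gy].
assert (Gx' : Rabs (x - x) < r) by lra; assert (Gy' : Rabs (y - y) < r) by lra.
destruct (AE_dx _ _ _ _ _ _ H1 Ap) as [M1 Aa], (AE_dy _ _ _ _ _ _ H1 Ap) as [M2 Ab].
destruct (AE_is_derive _ _ _ _ _ _ _ Aa Gx Gy) as [ax ay].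
destruct (AE_is_derive _ _ _ _ _ _ _ Ab Gx Gy) as [bx bY].
destruct (AE_is_derive _ _ _ _ _ _ _ Au Gx' Gy') as [ux uy].
destruct (AE_is_derive _ _ _ _ _ _ _ Av Gx' Gy') as [vx vy].
destruct Ap as [c Ap]; destruct (AN_jet _ _ _ _ _ _ Hr Ap) as [_ [_ [_ [_ [J1 J2]]]]].
assert (Sy : dx (dy ps) x y = dy (dx ps) x y) by congruence; clear J1 J2.
assert (F0 := is_derive_Fint_coord (fun x => dx ps x y) (fun x => dy ps x y) (fun x => u x y) (fun x => v x y)
   p1 p2 x _ _ _ _ ax bx ux vx HD).
assert (F1 := is_derive_Fint_coord (fun y => dx ps x y) (fun y => dy ps x y) (fun y => u x y) (fun y => v x y)
   p1 p2 y _ _ _ _ ay bY uy vy HD).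
unfold Lambda in HLam.
assert (H0 := is_derive_Ham_coord (fun x => dx ps x y) (fun x => dy ps x y) p1 p2 x _ _ ax bx HLam).
assert (Hh1 := is_derive_Ham_coord (fun y => dx ps x y) (fun y => dy ps x y) p1 p2 y _ _ ay bY HLam).
cbv beta in F0, F1, H0, Hh1; unfold Lame in HL.
set (a := dx ps x y) in *; set (b := dy ps x y) in *.
set (U := u x y) in *; set (V := v x y) in *.
assert (F2 : is_derive (fun z => Fint ps u v x y z p2) p1
  ((- (b * U + a * V) * (- b * p1 + a * p2) - (- (b * U + a * V) * p1 + (a * U - b * V) * p2) * (- b)) / (- b * p1 + a * p2) ^ 2)).
{ unfold Fint; fold a b U V; auto_derive; [exact HD|field; exact HD]. }
assert (F3 : is_derive (fun z => Fint ps u v x y p1 z) p2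
  (((a * U - b * V) * (- b * p1 + a * p2) - (- (b * U + a * V) * p1 + (a * U - b * V) * p2) * a) / (- b * p1 + a * p2) ^ 2)).
{ unfold Fint; fold a b U V; auto_derive; [exact HD|field; exact HD]. }
assert (Hh2 : is_derive (fun z => Ham ps x y z p2) p1 (p1 / (a ^ 2 + b ^ 2))).
{ unfold Ham, Lambda; fold a b; auto_derive; [simpl in HLam; lra|field; exact HLam]. }
assert (Hh3 : is_derive (fun z => Ham ps x y p1 z) p2 (p2 / (a ^ 2 + b ^ 2))).
{ unfold Ham, Lambda; fold a b; auto_derive; [simpl in HLam; lra|field; exact HLam]. }
split; [|split].
- split; [eexists; exact F0|split; [eexists; exact F1|split; eexists; eassumption]].
- split; [eexists; exact H0|split; [eexists; exact Hh1|split; eexists; eassumption]].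
- assert (E0 : d4 0 (Fint ps u v) x y p1 p2 = _) by exact (is_derive_unique _ _ _ F0).
  assert (E1 : d4 1 (Fint ps u v) x y p1 p2 = _) by exact (is_derive_unique _ _ _ F1).
  assert (E2 : d4 2 (Fint ps u v) x y p1 p2 = _) by exact (is_derive_unique _ _ _ F2).
  assert (E3 : d4 3 (Fint ps u v) x y p1 p2 = _) by exact (is_derive_unique _ _ _ F3).
  assert (K0 : d4 0 (Ham ps) x y p1 p2 = _) by exact (is_derive_unique _ _ _ H0).
  assert (K1 : d4 1 (Ham ps) x y p1 p2 = _) by exact (is_derive_unique _ _ _ Hh1).
  assert (K2 : d4 2 (Ham ps) x y p1 p2 = _) by exact (is_derive_unique _ _ _ Hh2).
  assert (K3 : d4 3 (Ham ps) x y p1 p2 = _) by exact (is_derive_unique _ _ _ Hh3).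
  unfold poisson; rewrite E0, E1, E2, E3, K0, K1, K2, K3.
  clear F0 F1 F2 F3 H0 Hh1 Hh2 Hh3 E0 E1 E2 E3 K0 K1 K2 K3 ax ay bx bY ux uy vx vy.
  rewrite Sy, CR1, CR2.
  set (axx := dx (dx ps) x y) in *; set (axy := dy (dx ps) x y) in *; set (byy := dy (dy ps) x y) in *.
  set (vX := dx v x y) in *; set (vY := dy v x y) in *.
  (* What remains is a rational identity in independent real numbers, with the left side of the
     equation for [ps] as a factor. *)
  clearbody a b U V axx axy byy vX vY.
  transitivity (- (p1 ^ 2 + p2 ^ 2) / ((- b * p1 + a * p2) * (a ^ 2 + b ^ 2)) *
    (V * (axx + byy) + vX * a + vY * b)).
  + field; split; trivial.
  + rewrite HL; ring.
Qed.

(** * Riemann-Stieltjes integrals of power series *)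

(** Componentwise like [CSeries], but asserting convergence as well as the value. *)
Definition CSer (a : nat -> CC) (l : CC) : Prop :=
  is_series (fun k => Re (a k)) (Re l) /\ is_series (fun k => Im (a k)) (Im l).

Lemma CSer_unique a l : CSer a l -> CSeries a = l.
Proof.
intros [H1 H2]; unfold CSeries; rewrite (is_series_unique _ _ H1), (is_series_unique _ _ H2).
now destruct l.
Qed.

Lemma CSer_ext a b l : (forall n, a n = b n) -> CSer a l -> CSer b l.
Proof. intros H [H1 H2]; split; [revert H1|revert H2]; apply is_series_ext; intros; now rewrite H. Qed.

Lemma CSer_plus a b l l' : CSer a l -> CSer b l' -> CSer (fun n => Cplus (a n) (b n)) (Cplus l l').
Proof. intros [H1 H2] [H3 H4]; split; now apply (is_series_plus (V := R_NormedModule)). Qed.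

Lemma CSer_scal k a l : CSer a l -> CSer (fun n => Cmult k (a n)) (Cmult k l).
Proof.
intros [H1 H2]; split.
- exact (is_series_minus (V := R_NormedModule) _ _ _ _ (is_series_scal (K := R_AbsRing) (V := R_NormedModule) (Re k) _ _ H1)
    (is_series_scal (K := R_AbsRing) (V := R_NormedModule) (Im k) _ _ H2)).
- exact (is_series_plus (V := R_NormedModule) _ _ _ _ (is_series_scal (K := R_AbsRing) (V := R_NormedModule) (Re k) _ _ H2)
    (is_series_scal (K := R_AbsRing) (V := R_NormedModule) (Im k) _ _ H1)).
Qed.

Lemma Re_le_Cmod z : Rabs (Re z) <= Cmod z.
Proof. eapply Rle_trans; [apply Rmax_l|apply (Rmax_Cmod z)]. Qed.

Lemma Im_le_Cmod z : Rabs (Im z) <= Cmod z.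
Proof. eapply Rle_trans; [apply Rmax_r|apply (Rmax_Cmod z)]. Qed.

Lemma Cmod_le_Re_Im z : Cmod z <= Rabs (Re z) + Rabs (Im z).
Proof.
destruct z as [x y].
replace (x, y) with (Cplus (RtoC x) (Cmult Ci (RtoC y)))
  by (unfold Cplus, Cmult, Ci, RtoC; simpl; f_equal; ring).
eapply Rle_trans; [apply Cmod_triangle|].
rewrite Cmod_mult, !Cmod_R; unfold Re, Im; simpl.
replace (Cmod Ci) with 1; [|unfold Cmod, Ci; simpl; rewrite <- sqrt_1 at 1; f_equal; ring].
replace (x + (0 * y - 1 * 0)) with x by ring; replace (0 + (0 * 0 + 1 * y)) with y by ring; lra.
Qed.

Lemma CSer_dominated (a : nat -> CC) (r : nat -> R) : (forall n, Cmod (a n) <= r n) -> ex_series r -> exists l, CSer a l.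
Proof.
intros H E.
assert (E1 : ex_series (fun k => Re (a k))).
{ apply (ex_series_dom _ r); trivial; intros; eapply Rle_trans; [apply Re_le_Cmod|apply H]. }
assert (E2 : ex_series (fun k => Im (a k))).
{ apply (ex_series_dom _ r); trivial; intros; eapply Rle_trans; [apply Im_le_Cmod|apply H]. }
destruct E1 as [x Hx], E2 as [y Hy]; now exists (x, y).
Qed.

Lemma Re_Csum a N : Re (Csum a N) = Rsum (fun n => Re (a n)) N.
Proof. induction N as [|N IH]; simpl; trivial; now rewrite <- IH. Qed.

Lemma Im_Csum a N : Im (Csum a N) = Rsum (fun n => Im (a n)) N.
Proof. induction N as [|N IH]; simpl; trivial; now rewrite <- IH. Qed.

Lemma is_series_Rsum_lim (a : nat -> R) l : is_series a l -> is_lim_seq (Rsum a) l.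
Proof.
intros H; apply is_lim_seq_incr_1; apply (is_lim_seq_ext (sum_n a)); [apply Rsum_sum_n|exact H].
Qed.

Lemma CSer_lim a l eps : CSer a l -> 0 < eps ->
  exists N0, forall N, (N0 <= N)%nat -> Cmod (Cminus l (Csum a N)) < eps.
Proof.
intros [H1 H2] He.
assert (He2 : 0 < eps / 2) by lra.
apply is_series_Rsum_lim, is_lim_seq_spec in H1; apply is_series_Rsum_lim, is_lim_seq_spec in H2.
destruct (H1 (mkposreal _ He2)) as [N1 P1], (H2 (mkposreal _ He2)) as [N2 P2]; simpl in P1, P2.
exists (Nat.max N1 N2); intros N HN.
specialize (P1 N ltac:(lia)); specialize (P2 N ltac:(lia)).
eapply Rle_lt_trans; [apply Cmod_le_Re_Im|].
replace (Re (Cminus l (Csum a N))) with (- (Rsum (fun n => Re (a n)) N - Re l))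
  by (rewrite <- Re_Csum; unfold Re; simpl; ring).
replace (Im (Cminus l (Csum a N))) with (- (Rsum (fun n => Im (a n)) N - Im l))
  by (rewrite <- Im_Csum; unfold Im; simpl; ring).
rewrite !Rabs_Ropp; lra.
Qed.

Lemma Cmod_Csum a N : Cmod (Csum a N) <= Rsum (fun n => Cmod (a n)) N.
Proof.
induction N as [|N IH]; simpl; [rewrite Cmod_R, Rabs_R0; lra|].
eapply Rle_trans; [apply Cmod_triangle|lra].
Qed.

Lemma Rsum_le a b N : (forall n, (n < N)%nat -> a n <= b n) -> Rsum a N <= Rsum b N.
Proof.
intros H; induction N as [|N IH]; simpl; [lra|].
apply Rplus_le_compat; [apply IH; auto|apply H; lia].
Qed.

Lemma Csum_ext a b N : (forall n, (n < N)%nat -> a n = b n) -> Csum a N = Csum b N.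
Proof.
intros H; induction N as [|N IH]; simpl; trivial.
rewrite IH, (H N) by (intros; auto with arith); trivial.
Qed.

Lemma Csum_plus a b N : Csum (fun n => Cplus (a n) (b n)) N = Cplus (Csum a N) (Csum b N).
Proof. induction N as [|N IH]; simpl; [|rewrite IH]; ring. Qed.

Lemma Csum_scal k a N : Csum (fun n => Cmult k (a n)) N = Cmult k (Csum a N).
Proof. induction N as [|N IH]; simpl; [|rewrite IH]; ring. Qed.

(** The bound depends on the majorant alone; for a power series on a bounded curve it is therefore
    uniform along the curve. *)
Lemma CSer_tail (a : nat -> CC) (r : nat -> R) l N : CSer a l -> (forall n, Cmod (a n) <= r n) -> ex_series r ->
  Cmod (Cminus l (Csum a N)) <= Series r - Rsum r N.
Proof.
intros H Hr E.
assert (R0 : forall n, 0 <= r n) by (intros; eapply Rle_trans; [apply Cmod_ge_0|apply Hr]).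
assert (P : forall k, Cmod (Cminus (Csum a (N + k)) (Csum a N)) <= Rsum r (N + k) - Rsum r N).
{ induction k as [|k IH].
  - rewrite Nat.add_0_r, Rminus_diag; unfold Cminus; rewrite Cplus_opp_r, Cmod_0; lra.
  - rewrite Nat.add_succ_r; simpl.
    replace (Cminus (Cplus (Csum a (N + k)) (a (N + k)%nat)) (Csum a N)) with
      (Cplus (Cminus (Csum a (N + k)) (Csum a N)) (a (N + k)%nat)) by (unfold Cminus; ring).
    eapply Rle_trans; [apply Cmod_triangle|]; specialize (Hr (N + k)%nat); lra. }
assert (Q : forall k, Rsum r k <= Series r).
{ intros [|k]; [simpl; now apply Series_ge0|rewrite <- Rsum_sum_n; now apply sum_n_le_Series]. }
apply le_epsilon; intros eps He.
destruct (CSer_lim a l eps H He) as [N0 HN0].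
specialize (HN0 (N + N0)%nat ltac:(lia)); specialize (P N0); specialize (Q (N + N0)%nat).
replace (Cminus l (Csum a N)) with
  (Cplus (Cminus l (Csum a (N + N0))) (Cminus (Csum a (N + N0)) (Csum a N))) by (unfold Cminus; ring).
eapply Rle_trans; [apply Cmod_triangle|lra].
Qed.

(** * Tagged partitions and limits of Riemann-Stieltjes sums *)

Lemma tagged_mono n t xi : tagged_partition n t xi -> forall k, (k <= n)%nat -> 0 <= t k <= 1.
Proof.
intros [H0 [H1 H]] k Hk; split.
- induction k as [|k IH]; [lra|]; specialize (H k Hk); specialize (IH ltac:(lia)); lra.
- assert (P : forall j, (j <= n)%nat -> t (n - j)%nat <= 1).
  { induction j as [|j IH]; intros Hj; [rewrite Nat.sub_0_r; lra|].
    specialize (IH ltac:(lia)); specialize (H (n - S j)%nat ltac:(lia)).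
    replace (S (n - S j)) with (n - j)%nat in H by lia; lra. }
  replace k with (n - (n - k))%nat by lia; apply P; lia.
Qed.

Lemma tagged_tag n t xi k : tagged_partition n t xi -> (k < n)%nat -> 0 <= xi k <= 1.
Proof.
intros H Hk; assert (A := tagged_mono n t xi H k ltac:(lia)); assert (B := tagged_mono n t xi H (S k) ltac:(lia)).
destruct H as [_ [_ H]]; specialize (H k Hk); lra.
Qed.

(** Arbitrarily fine partitions have to exist for [is_RS] to determine anything: uniqueness and the
    norm bound of the integral both evaluate it on one of them. *)
Lemma tagged_exists delta : 0 < delta -> exists n t xi, tagged_partition n t xi /\
  forall k, (k < n)%nat -> t (S k) - t k < delta.
Proof.
intros Hd; destruct (archimed_cor1 delta Hd) as [n [Hn Hn0]].
assert (P : 0 < INR n) by now apply lt_0_INR.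
exists n, (fun k => INR k / INR n), (fun k => INR k / INR n); split.
- split; [simpl; unfold Rdiv; ring|split; [field; lra|]].
  intros k _; split; [lra|].
  unfold Rdiv; apply Rmult_le_compat_r; [apply Rlt_le; now apply Rinv_0_lt_compat|].
  rewrite S_INR; lra.
- intros k _; rewrite S_INR; replace ((INR k + 1) / INR n - INR k / INR n) with (/ INR n) by (field; lra); trivial.
Qed.

Lemma RS_sum_ext f f' g n t xi : tagged_partition n t xi -> (forall t, 0 <= t <= 1 -> f t = f' t) ->
  RS_sum f g n t xi = RS_sum f' g n t xi.
Proof. intros H E; apply Csum_ext; intros k Hk; rewrite E; trivial; now apply (tagged_tag n t xi). Qed.

Lemma is_RS_ext f f' g I : (forall t, 0 <= t <= 1 -> f t = f' t) -> is_RS f g I -> is_RS f' g I.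
Proof.
intros E H eps He; destruct (H eps He) as [d [Hd P]]; exists d; split; trivial.
intros n t xi T M; rewrite <- (RS_sum_ext f f' g n t xi T E); auto.
Qed.

Lemma is_RS_unique f g I J : is_RS f g I -> is_RS f g J -> I = J.
Proof.
intros HI HJ.
assert (E : Cmod (Cminus I J) <= 0).
{ apply le_epsilon; intros eps He; rewrite Rplus_0_l.
  assert (He2 : 0 < eps / 2) by lra.
  destruct (HI _ He2) as [d1 [P1 Q1]], (HJ _ He2) as [d2 [P2 Q2]].
  destruct (tagged_exists (Rmin d1 d2)) as [n [t [xi [T M]]]]; [now apply Rmin_pos|].
  assert (A := Q1 n t xi T (fun k Hk => Rlt_le_trans _ _ _ (M k Hk) (Rmin_l _ _))).
  assert (B := Q2 n t xi T (fun k Hk => Rlt_le_trans _ _ _ (M k Hk) (Rmin_r _ _))).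
  set (s := RS_sum f g n t xi) in *.
  replace (Cminus I J) with (Cplus (Copp (Cminus s I)) (Cminus s J)) by (unfold Cminus; ring).
  eapply Rle_trans; [apply Cmod_triangle|]; rewrite Cmod_opp; lra. }
assert (Z : Cminus I J = RtoC 0) by (apply Cmod_eq_0; apply Rle_antisym; trivial; apply Cmod_ge_0).
replace I with (Cplus (Cminus I J) J) by (unfold Cminus; ring); rewrite Z; ring.
Qed.

(** Uniqueness forces the value picked by [epsilon]. *)
Lemma RS_int_eq f g I : is_RS f g I -> RS_int f g = I.
Proof.
intros H; apply (is_RS_unique f g); trivial.
unfold RS_int; apply epsilon_spec; now exists I.
Qed.

Lemma is_RS_plus f f' g I I' : is_RS f g I -> is_RS f' g I' -> is_RS (fun t => Cplus (f t) (f' t)) g (Cplus I I').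
Proof.
intros HI HJ eps He; assert (He2 : 0 < eps / 2) by lra.
destruct (HI _ He2) as [d1 [P1 Q1]], (HJ _ He2) as [d2 [P2 Q2]].
exists (Rmin d1 d2); split; [now apply Rmin_pos|]; intros n t xi T M.
assert (A := Q1 n t xi T (fun k Hk => Rlt_le_trans _ _ _ (M k Hk) (Rmin_l _ _))).
assert (B := Q2 n t xi T (fun k Hk => Rlt_le_trans _ _ _ (M k Hk) (Rmin_r _ _))).
replace (RS_sum (fun t => Cplus (f t) (f' t)) g n t xi) with (Cplus (RS_sum f g n t xi) (RS_sum f' g n t xi)).
2:{ unfold RS_sum; rewrite <- Csum_plus; apply Csum_ext; intros; ring. }
replace (Cminus _ _) with (Cplus (Cminus (RS_sum f g n t xi) I) (Cminus (RS_sum f' g n t xi) I'))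
  by (unfold Cminus; ring).
eapply Rle_lt_trans; [apply Cmod_triangle|lra].
Qed.

Lemma is_RS_0 g : is_RS (fun _ => RtoC 0) g (RtoC 0).
Proof.
intros eps He; exists 1; split; [lra|]; intros n t xi _ _.
replace (RS_sum _ g n t xi) with (RtoC 0).
- unfold Cminus; rewrite Cplus_opp_r, Cmod_0; trivial.
- unfold RS_sum; induction n as [|n IH]; simpl; trivial; rewrite <- IH; ring.
Qed.

Lemma is_RS_scal k f g I : is_RS f g I -> is_RS (fun t => Cmult k (f t)) g (Cmult k I).
Proof.
intros H eps He; assert (K0 := Cmod_ge_0 k).
destruct (H (eps / (Cmod k + 1))) as [d [Hd P]]; [apply Rdiv_lt_0_compat; lra|].
exists d; split; trivial; intros n t xi T M; specialize (P n t xi T M).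
replace (RS_sum (fun t => Cmult k (f t)) g n t xi) with (Cmult k (RS_sum f g n t xi)).
2:{ unfold RS_sum; rewrite <- Csum_scal; apply Csum_ext; intros; ring. }
replace (Cminus _ _) with (Cmult k (Cminus (RS_sum f g n t xi) I)) by (unfold Cminus; ring).
rewrite Cmod_mult; assert (Z := Cmod_ge_0 (Cminus (RS_sum f g n t xi) I)).
apply Rle_lt_trans with ((Cmod k + 1) * Cmod (Cminus (RS_sum f g n t xi) I)); [nra|].
replace eps with ((Cmod k + 1) * (eps / (Cmod k + 1))) by (field; lra).
apply Rmult_lt_compat_l; trivial; lra.
Qed.

Lemma is_RS_Csum (F : nat -> R -> CC) (I w : nat -> CC) g N : (forall q, is_RS (F q) g (I q)) ->
  is_RS (fun t => Csum (fun q => Cmult (w q) (F q t)) N) g (Csum (fun q => Cmult (w q) (I q)) N).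
Proof.
intros H; induction N as [|N IH]; simpl; [apply is_RS_0|].
apply (is_RS_plus (fun t => Csum (fun q => Cmult (w q) (F q t)) N)); trivial.
now apply is_RS_scal.
Qed.

Definition variation_le (g : R -> CC) (M : R) : Prop :=
  forall n (t : nat -> R), t O = 0 -> t n = 1 -> (forall k, (k < n)%nat -> t k <= t (S k)) ->
    Rsum (fun k => Cmod (Cminus (g (t (S k))) (g (t k)))) n <= M.

Lemma RS_sum_bound f g n t xi B M : variation_le g M -> tagged_partition n t xi ->
  0 <= B -> (forall t, 0 <= t <= 1 -> Cmod (f t) <= B) -> Cmod (RS_sum f g n t xi) <= B * M.
Proof.
intros HM T HB Hf.
apply Rle_trans with (B * Rsum (fun k => Cmod (Cminus (g (t (S k))) (g (t k)))) n).
- rewrite <- Rsum_scal; eapply Rle_trans; [apply Cmod_Csum|]; apply Rsum_le; intros k Hk.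
  rewrite Cmod_mult; apply Rmult_le_compat_r; [apply Cmod_ge_0|].
  apply Hf; now apply (tagged_tag n t xi).
- apply Rmult_le_compat_l; trivial; destruct T as [T0 [T1 T]]; apply HM; trivial.
  intros k Hk; specialize (T k Hk); lra.
Qed.

Lemma is_RS_bound f g I B M : variation_le g M -> 0 <= B -> (forall t, 0 <= t <= 1 -> Cmod (f t) <= B) ->
  is_RS f g I -> Cmod I <= B * M.
Proof.
intros HM HB Hf H; apply le_epsilon; intros eps He.
destruct (H eps He) as [d [Hd P]]; destruct (tagged_exists d Hd) as [n [t [xi [T Q]]]].
specialize (P n t xi T Q); assert (SB := RS_sum_bound f g n t xi B M HM T HB Hf).
replace I with (Cplus (Copp (Cminus (RS_sum f g n t xi) I)) (RS_sum f g n t xi)) by (unfold Cminus; ring).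
eapply Rle_trans; [apply Cmod_triangle|]; rewrite Cmod_opp; lra.
Qed.

(** The sums for [f] and for [fN N] differ by at most [tau N * M] whatever the partition, so [N] can
    be fixed before the mesh. The rest is an argument with three thirds of [eps]. *)
Lemma is_RS_limit f g I M (fN : nat -> R -> CC) (IN : nat -> CC) (tau : nat -> R) :
  variation_le g M -> (forall N, is_RS (fN N) g (IN N)) ->
  (forall N t, 0 <= t <= 1 -> Cmod (Cminus (f t) (fN N t)) <= tau N) -> is_lim_seq tau 0 ->
  (forall eps, 0 < eps -> exists N0, forall N, (N0 <= N)%nat -> Cmod (Cminus I (IN N)) < eps) ->
  is_RS f g I.
Proof.
intros HM HN Ht Ltau LI eps He.
assert (He3 : 0 < eps / 3) by lra.
destruct (LI _ He3) as [N1 P1].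
(* [INR] serves as the partition with nodes 0 and 1. *)
assert (M0 : 0 <= M).
{ eapply Rle_trans; [|apply (HM 1%nat INR); trivial].
  - simpl; assert (Z := Cmod_ge_0 (Cminus (g 1) (g 0))); lra.
  - intros; apply le_INR; lia. }
(* [M + 1] keeps the quotient meaningful when [M = 0]. *)
assert (Hd3 : 0 < eps / (3 * (M + 1))) by (apply Rdiv_lt_0_compat; lra).
apply is_lim_seq_spec in Ltau; destruct (Ltau (mkposreal _ Hd3)) as [N2 P2]; simpl in P2.
set (N := Nat.max N1 N2); specialize (P1 N ltac:(lia)); specialize (P2 N ltac:(lia)).
rewrite Rminus_0_r in P2.
assert (T0 : 0 <= tau N) by (eapply Rle_trans; [apply Cmod_ge_0|apply (Ht N 0); lra]).
rewrite Rabs_pos_eq in P2 by trivial.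
destruct (HN N _ He3) as [d [Hd P]]; exists d; split; trivial; intros n t xi T Q.
specialize (P n t xi T Q).
assert (SB := RS_sum_bound (fun t => Cminus (f t) (fN N t)) g n t xi (tau N) M HM T T0 (Ht N)).
assert (E : RS_sum (fun t => Cminus (f t) (fN N t)) g n t xi = Cminus (RS_sum f g n t xi) (RS_sum (fN N) g n t xi)).
{ unfold RS_sum; replace (Cminus (Csum _ n) (Csum _ n)) with
   (Cplus (Csum (fun k => Cmult (f (xi k)) (Cminus (g (t (S k))) (g (t k)))) n)
     (Cmult (RtoC (-1)) (Csum (fun k => Cmult (fN N (xi k)) (Cminus (g (t (S k))) (g (t k)))) n))).
  - rewrite <- Csum_scal, <- Csum_plus; apply Csum_ext; intros.
    unfold Cminus, Cplus, Cmult, Copp, RtoC; simpl; f_equal; ring.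
  - unfold Cminus, Cplus, Cmult, Copp, RtoC; simpl; f_equal; ring. }
rewrite E in SB; clear E.
replace (Cminus (RS_sum f g n t xi) I) with
  (Cplus (Cminus (RS_sum f g n t xi) (RS_sum (fN N) g n t xi))
    (Cplus (Cminus (RS_sum (fN N) g n t xi) (IN N)) (Copp (Cminus I (IN N))))) by (unfold Cminus; ring).
eapply Rle_lt_trans; [apply Cmod_triangle|].
assert (Z := Cmod_triangle (Cminus (RS_sum (fN N) g n t xi) (IN N)) (Copp (Cminus I (IN N)))).
rewrite Cmod_opp in Z.
assert (tau N * M < eps / 3); [|lra].
apply Rle_lt_trans with (tau N * (M + 1)); [nra|].
replace (eps / 3) with (eps / (3 * (M + 1)) * (M + 1)) by (field; lra).
apply Rmult_lt_compat_r; lra.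
Qed.

(** [bounded_integrable_on] asks for test functions continuous on the whole line, whereas a curve is
    continuous only at parameters in [[0, 1]]; composing with [clamp] extends it by constants. *)
Definition clamp (t : R) : R := Rmax 0 (Rmin t 1).

Lemma clamp_range t : 0 <= clamp t <= 1.
Proof. unfold clamp, Rmax, Rmin; repeat destruct Rle_dec; lra. Qed.

Lemma clamp_id t : 0 <= t <= 1 -> clamp t = t.
Proof. unfold clamp, Rmax, Rmin; repeat destruct Rle_dec; lra. Qed.

Lemma continuous_clamp t : continuous clamp t.
Proof.
apply continuity_pt_filterlim; intros eps He; exists eps; split; trivial.
intros z [_ Hz]; simpl in Hz |- *; unfold R_dist in *; eapply Rle_lt_trans; [|exact Hz].
unfold clamp, Rmax, Rmin, Rabs; repeat destruct Rle_dec; repeat destruct Rcase_abs; lra.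
Qed.

Lemma continuous_pair (f g : R -> R) t : continuous f t -> continuous g t ->
  continuous (fun t => (f t, g t) : CC) t.
Proof.
intros Hf Hg.
apply (continuous_comp_2 (W := R_UniformSpace) (X := C_UniformSpace) f g (fun a b => (a, b)) t Hf Hg).
apply (continuous_ext (fun z => z)); [now intros [a b]|apply continuous_id].
Qed.

Lemma continuous_Re (f : R -> CC) t : continuous f t -> continuous (fun t => Re (f t)) t.
Proof. intros H; apply (continuous_comp f fst t H); destruct (f t); apply continuous_fst. Qed.

Lemma continuous_Im (f : R -> CC) t : continuous f t -> continuous (fun t => Im (f t)) t.
Proof. intros H; apply (continuous_comp f snd t H); destruct (f t); apply continuous_snd. Qed.

Lemma continuous_Cpow (f : R -> CC) q t : continuous f t -> continuous (fun t => Cpow (f t) q) t.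
Proof.
intros H; induction q as [|q IH]; [apply continuous_const|].
apply continuous_Re in H as H1; apply continuous_Im in H as H2.
apply continuous_Re in IH as H3; apply continuous_Im in IH as H4.
apply (continuous_pair (fun t => Re (Cpow (f t) q) * Re (f t) - Im (Cpow (f t) q) * Im (f t))
   (fun t => Re (Cpow (f t) q) * Im (f t) + Im (Cpow (f t) q) * Re (f t))).
- now apply continuous_Rminus; apply continuous_Rmult.
- now apply continuous_Rplus; apply continuous_Rmult.
Qed.

Lemma Cmod_Cpow z q : Cmod (Cpow z q) = Cmod z ^ q.
Proof.
induction q as [|q IH]; simpl; [rewrite Cmod_R; apply Rabs_R1|].
rewrite Cmod_mult, IH; ring.
Qed.

(** The partition [0, t, 1] bounds the distance from [g 0] to [g t] by the variation. *)
Lemma variation_bound g M : variation_le g M -> forall t, 0 <= t <= 1 -> Cmod (g t) <= Cmod (g 0) + M.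
Proof.
intros H t Ht.
assert (B := H 2%nat (fun k => match k with O => 0 | 1%nat => t | _ => 1 end) eq_refl eq_refl).
simpl in B; assert (Z := Cmod_ge_0 (Cminus (g 1) (g t))).
assert (B' : 0 + Cmod (Cminus (g t) (g 0)) + Cmod (Cminus (g 1) (g t)) <= M).
{ apply B; intros [|[|k]] Hk; simpl; lra || lia. }
replace (g t) with (Cplus (g 0) (Cminus (g t) (g 0))) by (unfold Cminus; ring).
eapply Rle_trans; [apply Cmod_triangle|lra].
Qed.

Lemma Series_tail_lim (r : nat -> R) : ex_series r -> is_lim_seq (fun N => Series r - Rsum r N) 0.
Proof.
intros E; replace (Finite 0) with (Finite (Series r - Series r)) by (f_equal; ring).
apply is_lim_seq_minus'; [apply is_lim_seq_const|apply is_series_Rsum_lim, Series_correct, E].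
Qed.

(** The curve lies in a disc of radius [S], so a power series in [s] dominated there converges
    uniformly along it and may be integrated term by term. The moments [m] and the constants [K],
    [S] are fixed before [w], and [w] will carry all dependence on [(U, V)]. *)
Lemma curve_moments g a : rectifiable g -> bounded_integrable_on g a ->
  exists (m : nat -> CC) K S, 0 <= K /\ 0 <= S /\ (forall q, Cmod (m q) <= K * S ^ q) /\
  forall (w : nat -> CC) (f h : CC -> CC), ex_series (fun q => Cmod (w q) * S ^ q) ->
    (forall t, 0 <= t <= 1 -> f (g t) = Cmult (a (g t)) (h (g t)) /\
       CSer (fun q => Cmult (w q) (Cpow (g t) q)) (h (g t))) ->
    CSer (fun q => Cmult (w q) (m q)) (curve_int g f).
Proof.
intros [Cg [M HM]] [[Ba HBa] Hint]; fold (variation_le g M) in HM.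
set (S := Cmod (g 0) + M).
assert (HS : forall t, 0 <= t <= 1 -> Cmod (g t) <= S) by now apply variation_bound.
assert (S0 : 0 <= S) by (eapply Rle_trans; [apply Cmod_ge_0|apply (HS 0); lra]).
assert (M0 : 0 <= M).
{ assert (Z := variation_bound g M HM 0 ltac:(lra)); lra. }
assert (B0 : 0 <= Ba) by (eapply Rle_trans; [apply Cmod_ge_0|apply (HBa 0); lra]).
assert (Ex : forall q, exists I, is_RS (fun t => Cmult (a (g t)) (Cpow (g t) q)) g I).
{ intros q; destruct (Hint (fun t => Cpow (g (clamp t)) q)) as [I HI].
  - intros t; apply (continuous_Cpow (fun t => g (clamp t))).
    apply (continuous_comp clamp g); [apply continuous_clamp|apply Cg, clamp_range].
  - exists I; revert HI; apply is_RS_ext; intros t Ht; now rewrite clamp_id. }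
set (m q := proj1_sig (constructive_indefinite_description _ (Ex q))).
assert (Hm : forall q, is_RS (fun t => Cmult (a (g t)) (Cpow (g t) q)) g (m q))
  by (intros q; exact (proj2_sig (constructive_indefinite_description _ (Ex q)))).
clearbody m.
assert (Bm : forall q, Cmod (m q) <= Ba * M * S ^ q).
{ intros q; replace (Ba * M * S ^ q) with (Ba * S ^ q * M) by ring.
  refine (is_RS_bound _ g (m q) _ _ HM _ _ (Hm q)).
  - apply Rmult_le_pos; trivial; now apply pow_le.
  - intros t Ht; rewrite Cmod_mult, Cmod_Cpow; apply Rmult_le_compat; auto using Cmod_ge_0.
    + apply pow_le, Cmod_ge_0.
    + apply pow_incr; split; [apply Cmod_ge_0|auto]. }
exists m, (Ba * M), S; split; [now apply Rmult_le_pos|split; trivial; split; trivial].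
intros w f h Ew Hf.
assert (Em := ex_series_scal_l (Ba * M) _ Ew).
assert (Bw : forall q, Cmod (Cmult (w q) (m q)) <= Ba * M * (Cmod (w q) * S ^ q)).
{ intros q; rewrite Cmod_mult; replace (Ba * M * (Cmod (w q) * S ^ q)) with (Cmod (w q) * (Ba * M * S ^ q)) by ring.
  apply Rmult_le_compat_l; [apply Cmod_ge_0|apply Bm]. }
destruct (CSer_dominated _ _ Bw Em) as [I HI].
replace (curve_int g f) with I; trivial.
symmetry; apply RS_int_eq.
apply (is_RS_limit _ g I M (fun N t => Csum (fun q => Cmult (w q) (Cmult (a (g t)) (Cpow (g t) q))) N)
  (fun N => Csum (fun q => Cmult (w q) (m q)) N)
  (fun N => Ba * (Series (fun q => Cmod (w q) * S ^ q) - Rsum (fun q => Cmod (w q) * S ^ q) N))); trivial.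
(* The partial sums are integrable with known values, since they are finite combinations of the
   moment integrands. *)
- intros N; apply (is_RS_Csum (fun q t => Cmult (a (g t)) (Cpow (g t) q))); trivial.
- intros N t Ht; destruct (Hf t Ht) as [-> HC].
  rewrite (Csum_ext _ (fun q => Cmult (a (g t)) (Cmult (w q) (Cpow (g t) q)))) by (intros; ring).
  rewrite Csum_scal.
  replace (Cminus _ _) with (Cmult (a (g t)) (Cminus (h (g t)) (Csum (fun q => Cmult (w q) (Cpow (g t) q)) N)))
    by (unfold Cminus; ring).
  rewrite Cmod_mult; apply Rmult_le_compat; auto using Cmod_ge_0.
  apply CSer_tail; trivial; intros q; rewrite Cmod_mult, Cmod_Cpow.
  apply Rmult_le_compat_l; [apply Cmod_ge_0|apply pow_incr; split; [apply Cmod_ge_0|auto]].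
- replace (Finite 0) with (Rbar_mult Ba 0) by (simpl; f_equal; ring).
  now apply is_lim_seq_scal_l, Series_tail_lim.
- intros eps He; now apply CSer_lim.
Qed.

(** * The complex exponential as a power series *)

Lemma ex_series_exp x : ex_series (fun n => x ^ n / INR (fact n)).
Proof.
exists (exp x); generalize (is_exp_Reals x); apply is_series_ext; intros n.
rewrite pow_n_pow; unfold scal; simpl; unfold mult; simpl; reflexivity.
Qed.

Lemma PRe_PIm_bound x y n : Rabs (PRe x y n) <= Cmod (x, y) ^ n /\ Rabs (PIm x y n) <= Cmod (x, y) ^ n.
Proof.
unfold PRe, PIm; rewrite <- Cmod_Cpow; split; [apply Re_le_Cmod|apply Im_le_Cmod].
Qed.

(** For every [r] the terms at [r] are bounded by the sum of the exponential series at [b * r]. *)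
Lemma CV_radius_fact (a : nat -> R) b : 0 <= b -> (forall n, Rabs (a n) <= b ^ n / INR (fact n)) ->
  CV_radius a = p_infty.
Proof.
intros Hb H.
assert (Q : forall r, 0 <= r -> Rbar_le r (CV_radius a)).
{ intros r Hr; apply CV_radius_bounded; exists (Series (fun n => (b * r) ^ n / INR (fact n))); intros n.
  rewrite Rabs_mult, (Rabs_pos_eq (r ^ n)) by now apply pow_le.
  assert (P : forall n, 0 <= (b * r) ^ n / INR (fact n)).
  { intros k; apply Rdiv_le_0_compat; [apply pow_le; now apply Rmult_le_pos|apply INR_fact_lt_0]. }
  apply Rle_trans with ((b * r) ^ n / INR (fact n)).
  - rewrite Rpow_mult_distr; replace (b ^ n * r ^ n / INR (fact n)) with (b ^ n / INR (fact n) * r ^ n)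
      by (field; apply INR_fact_neq_0).
    apply Rmult_le_compat_r; [now apply pow_le|apply H].
  - apply (term_le_Series (fun n => (b * r) ^ n / INR (fact n))); trivial; apply ex_series_exp. }
destruct (CV_radius a) as [c| |] eqn:E; trivial.
- assert (Z := Q (Rabs c + 1) ltac:(generalize (Rabs_pos c); lra)); simpl in Z.
  generalize (Rle_abs c); lra.
- assert (Z := Q 0 ltac:(lra)); contradiction.
Qed.

(** Along the ray [t z] the component series solve the linear system [A' = x A - y B],
    [B' = x B + y A] with initial value [(1, 0)]. Comparison with the exponential at [t = 1]
    identifies the sum. *)
Lemma CSer_Cexp z : CSer (fun p => Cmult (RtoC (/ INR (fact p))) (Cpow z p)) (Cexp z).
Proof.
destruct z as [x y].
set (a p := PRe x y p / INR (fact p)); set (b p := PIm x y p / INR (fact p)).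
assert (F := INR_fact_neq_0).
assert (Ba : forall n, Rabs (a n) <= Cmod (x, y) ^ n / INR (fact n) /\ Rabs (b n) <= Cmod (x, y) ^ n / INR (fact n)).
{ intros n; unfold a, b, Rdiv; rewrite !Rabs_mult, (Rabs_pos_eq (/ _)) by apply Rlt_le, Rinv_0_lt_compat, INR_fact_lt_0.
  split; apply Rmult_le_compat_r; try apply PRe_PIm_bound; apply Rlt_le, Rinv_0_lt_compat, INR_fact_lt_0. }
assert (Ra : CV_radius a = p_infty) by (apply CV_radius_fact with (Cmod (x, y)); [apply Cmod_ge_0|apply Ba]).
assert (Rb : CV_radius b = p_infty) by (apply CV_radius_fact with (Cmod (x, y)); [apply Cmod_ge_0|apply Ba]).
assert (Exa : forall t, ex_series (fun n => a n * t ^ n)) by (intros t; refine (proj1 (ex_pseries_R a t) (CV_radius_inside a t _)); rewrite Ra; exact I).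
assert (Exb : forall t, ex_series (fun n => b n * t ^ n)) by (intros t; refine (proj1 (ex_pseries_R b t) (CV_radius_inside b t _)); rewrite Rb; exact I).
set (A := PSeries a); set (B := PSeries b).
assert (DA : forall t, is_derive A t (x * A t - y * B t)).
{ intros t; replace (x * A t - y * B t) with (PSeries (PS_derive a) t); [apply is_derive_PSeries; rewrite Ra; exact I|].
  unfold A, B, PSeries; rewrite <- !Series_scal_l, <- Series_minus.
  - apply Series_ext; intros n; unfold PS_derive, a, b; rewrite PRe_S, fact_simpl, mult_INR; field.
    split; trivial; now apply not_0_INR.
  - exact (ex_series_scal_l _ _ (Exa t)).
  - exact (ex_series_scal_l _ _ (Exb t)). }
assert (DB : forall t, is_derive B t (x * B t + y * A t)).
{ intros t; replace (x * B t + y * A t) with (PSeries (PS_derive b) t); [apply is_derive_PSeries; rewrite Rb; exact I|].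
  unfold A, B, PSeries; rewrite <- !Series_scal_l, <- Series_plus.
  - apply Series_ext; intros n; unfold PS_derive, a, b; rewrite PIm_S, fact_simpl, mult_INR; field.
    split; trivial; now apply not_0_INR.
  - exact (ex_series_scal_l _ _ (Exb t)).
  - exact (ex_series_scal_l _ _ (Exa t)). }
assert (const : forall f : R -> R, (forall t, is_derive f t 0) -> f 1 = f 0).
{ intros f Hf; destruct (MVT_cor2 f (fun _ => 0) 0 1) as [c [Hc _]]; [lra| |lra].
  intros; apply is_derive_Reals, Hf. }
assert (A0 : A 0 = 1) by (unfold A; rewrite PSeries_0; unfold a, PRe; simpl; field).
assert (B0 : B 0 = 0) by (unfold B; rewrite PSeries_0; unfold b, PIm; simpl; field).
assert (dA : forall t, Derive (fun t => A t) t = x * A t - y * B t) by (intros t; exact (is_derive_unique _ _ _ (DA t))).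
assert (dB : forall t, Derive (fun t => B t) t = x * B t + y * A t) by (intros t; exact (is_derive_unique _ _ _ (DB t))).
(* e^{-zt} (A + iB) has zero derivative *)
assert (E1 := const (fun t => exp (- (t * x)) * (A t * cos (t * y) + B t * sin (t * y)))).
assert (E2 := const (fun t => exp (- (t * x)) * (B t * cos (t * y) - A t * sin (t * y)))).
cbv beta in E1, E2.
assert (H1 : exp (- x) * (A 1 * cos y + B 1 * sin y) = 1).
{ transitivity (exp (- (1 * x)) * (A 1 * cos (1 * y) + B 1 * sin (1 * y))); [now rewrite !Rmult_1_l|].
  rewrite E1; [rewrite A0, B0, !Rmult_0_l, Ropp_0, exp_0, cos_0; ring|]; intros t; auto_derive.
  - repeat split; eexists; [apply DA|apply DB].
  - rewrite dA, dB; ring. }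
assert (H2 : exp (- x) * (B 1 * cos y - A 1 * sin y) = 0).
{ transitivity (exp (- (1 * x)) * (B 1 * cos (1 * y) - A 1 * sin (1 * y))); [now rewrite !Rmult_1_l|].
  rewrite E2; [rewrite A0, B0, !Rmult_0_l, Ropp_0, exp_0, sin_0; ring|]; intros t; auto_derive.
  - repeat split; eexists; [apply DB|apply DA].
  - rewrite dA, dB; ring. }
assert (Ex : exp x * exp (- x) = 1) by (rewrite <- exp_plus, Rplus_opp_r; apply exp_0).
assert (T := sin2_cos2 y); unfold Rsqr in T.
assert (VA : A 1 = exp x * cos y).
{ transitivity (A 1 * (exp x * exp (- x)) * (sin y * sin y + cos y * cos y)); [rewrite Ex, T; ring|].
  transitivity (exp x * cos y * (exp (- x) * (A 1 * cos y + B 1 * sin y)) - exp x * sin y * (exp (- x) * (B 1 * cos y - A 1 * sin y))); [ring|].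
  rewrite H1, H2; ring. }
assert (VB : B 1 = exp x * sin y).
{ transitivity (B 1 * (exp x * exp (- x)) * (sin y * sin y + cos y * cos y)); [rewrite Ex, T; ring|].
  transitivity (exp x * sin y * (exp (- x) * (A 1 * cos y + B 1 * sin y)) + exp x * cos y * (exp (- x) * (B 1 * cos y - A 1 * sin y))); [ring|].
  rewrite H1, H2; ring. }
split.
- change (Re (Cexp (x, y))) with (exp x * cos y); rewrite <- VA.
  generalize (Series_correct _ (Exa 1)); apply is_series_ext; intros n.
  rewrite pow1; unfold a, PRe, Re, Cmult, RtoC; simpl; field; apply F.
- change (Im (Cexp (x, y))) with (exp x * sin y); rewrite <- VB.
  generalize (Series_correct _ (Exb 1)); apply is_series_ext; intros n.
  rewrite pow1; unfold b, PIm, Im, Cmult, RtoC; simpl; field; apply F.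
Qed.

(** * Expansion of the integrands *)

Lemma Rsum_sum_f_R0 u n : sum_f_R0 u n = Rsum u (S n).
Proof. rewrite <- Rsum_sum_n; symmetry; apply sum_n_Reals. Qed.

(** The complex Cauchy product is assembled from four real ones; the majorants provide the absolute
    convergence that these require. *)
Lemma CSer_mult (a b : nat -> CC) A B (ra rb : nat -> R) : CSer a A -> CSer b B ->
  (forall n, Cmod (a n) <= ra n) -> (forall n, Cmod (b n) <= rb n) -> ex_series ra -> ex_series rb ->
  CSer (fun n => Csum (fun i => Cmult (a i) (b (n - i)%nat)) (S n)) (Cmult A B).
Proof.
intros [A1 A2] [B1 B2] Ha Hb Ea Eb.
assert (E : forall (z : nat -> CC) r (p : CC -> R), (forall z, Rabs (p z) <= Cmod z) ->
   (forall n, Cmod (z n) <= r n) -> ex_series r -> ex_series (fun n => Rabs (p (z n)))).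
{ intros z r p Hp Hz Er; apply (ex_series_dom _ r); trivial; intros n; rewrite Rabs_Rabsolu.
  eapply Rle_trans; [apply Hp|apply Hz]. }
assert (a1 := E a ra Re Re_le_Cmod Ha Ea); assert (a2 := E a ra Im Im_le_Cmod Ha Ea).
assert (b1 := E b rb Re Re_le_Cmod Hb Eb); assert (b2 := E b rb Im Im_le_Cmod Hb Eb).
split.
- generalize (is_series_minus (V := R_NormedModule) _ _ _ _ (is_series_mult _ _ _ _ A1 B1 a1 b1) (is_series_mult _ _ _ _ A2 B2 a2 b2)).
  apply is_series_ext; intros n; rewrite Re_Csum, !Rsum_sum_f_R0; unfold minus, plus, opp; simpl.
  replace (- _) with (-1 * Rsum (fun k => Im (a k) * Im (b (n - k)%nat)) (S n)) by (simpl; ring).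
  rewrite <- Rsum_scal.
  change (Rsum (fun k => Re (a k) * Re (b (n - k)%nat)) (S n) + Rsum (fun k => -1 * (Im (a k) * Im (b (n - k)%nat))) (S n)
    = Rsum (fun k => Re (Cmult (a k) (b (n - k)%nat))) (S n)).
  rewrite <- Rsum_plus; apply Rsum_ext; intros; unfold Re, Im, Cmult; simpl; ring.
- generalize (is_series_plus (V := R_NormedModule) _ _ _ _ (is_series_mult _ _ _ _ A1 B2 a1 b2) (is_series_mult _ _ _ _ A2 B1 a2 b1)).
  apply is_series_ext; intros n; rewrite Im_Csum, !Rsum_sum_f_R0.
  change (Rsum (fun k => Re (a k) * Im (b (n - k)%nat)) (S n) + Rsum (fun k => Im (a k) * Re (b (n - k)%nat)) (S n)
    = Rsum (fun k => Im (Cmult (a k) (b (n - k)%nat))) (S n)).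
  rewrite <- Rsum_plus; apply Rsum_ext; intros; unfold Re, Im, Cmult; simpl; ring.
Qed.

Lemma Cpow_mult z w k : Cpow (Cmult z w) k = Cmult (Cpow z k) (Cpow w k).
Proof. induction k as [|k IH]; simpl; [|rewrite IH]; ring. Qed.

Lemma Cpow_RtoC x k : Cpow (RtoC x) k = RtoC (x ^ k).
Proof. induction k as [|k IH]; simpl; trivial; rewrite IH, RtoC_mult; ring. Qed.

Lemma Cpow_add z i j : Cpow z (i + j) = Cmult (Cpow z i) (Cpow z j).
Proof. induction i as [|i IH]; simpl; [|rewrite IH]; ring. Qed.

Lemma Csum_RtoC x N : Csum (fun i => RtoC (x i)) N = RtoC (Rsum x N).
Proof. induction N as [|N IH]; simpl; trivial; rewrite IH, RtoC_plus; trivial. Qed.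

Lemma Re_RtoC_mult x z : Re (Cmult (RtoC x) z) = x * Re z.
Proof. unfold Re, Cmult, RtoC; simpl; ring. Qed.

Lemma CSeries_ext a b : (forall n, a n = b n) -> CSeries a = CSeries b.
Proof. intros H; unfold CSeries; f_equal; apply Series_ext; intros; now rewrite H. Qed.

Lemma fact_le_double k : INR (fact k) <= INR (fact (2 * k)).
Proof. apply le_INR, fact_le; lia. Qed.

Lemma coef_term_bound C B k i s V : coef_bound C B k ->
  Cmod (Cmult (RtoC (k i * V ^ i)) (Cpow s i)) <= C * ((B * Rabs V * Cmod s) ^ i / INR (fact i)).
Proof.
intros [C0 [B0 H]]; rewrite Cmod_mult, Cmod_R, Cmod_Cpow, Rabs_mult, <- RPow_abs, !Rpow_mult_distr.
specialize (H i); assert (P : 0 <= Rabs V ^ i) by (apply pow_le, Rabs_pos); assert (Q : 0 <= Cmod s ^ i) by (apply pow_le, Cmod_ge_0).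
replace (C * (B ^ i * Rabs V ^ i * Cmod s ^ i / INR (fact i))) with (C * B ^ i / INR (fact i) * Rabs V ^ i * Cmod s ^ i)
  by (field; apply INR_fact_neq_0).
repeat apply Rmult_le_compat_r; trivial.
Qed.

(** Convergence comes from weakening [1 / (2k)!] to [1 / k!], which leaves the exponential series of
    [x^2]; zeros are then inserted at the odd powers of [s]. *)
Lemma CSer_evens C B c s V : coef_bound C B (evens c) ->
  CSer (fun i => Cmult (RtoC (evens c i * V ^ i)) (Cpow s i))
    (CSeries (fun k => Cmult (RtoC (c k * V ^ (2 * k))) (Cpow s (2 * k)))).
Proof.
intros H; assert (H0 := H); destruct H0 as [C0 [B0 _]].
set (x := B * Rabs V * Cmod s).
assert (X0 : 0 <= x) by (unfold x; repeat apply Rmult_le_pos; trivial; [apply Rabs_pos|apply Cmod_ge_0]).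
assert (D : forall k, Cmod (Cmult (RtoC (c k * V ^ (2 * k))) (Cpow s (2 * k))) <= C * ((x ^ 2) ^ k / INR (fact k))).
{ intros k; rewrite <- (evens_double c k); eapply Rle_trans; [apply (coef_term_bound C B); trivial|].
  fold x; rewrite pow_mult; apply Rmult_le_compat_l; trivial.
  unfold Rdiv; apply Rmult_le_compat_l; [apply pow_le; nra|].
  apply Rinv_le_contravar; [apply INR_fact_lt_0|apply fact_le_double]. }
destruct (CSer_dominated _ _ D (ex_series_scal_l C _ (ex_series_exp (x ^ 2)))) as [l Hl].
rewrite (CSer_unique _ _ Hl); destruct Hl as [H1 H2].
assert (O : forall k, Cmult (RtoC (evens c (S (2 * k)) * V ^ S (2 * k))) (Cpow s (S (2 * k))) = RtoC 0).
{ intros k; rewrite evens_succ_double, Rmult_0_l; ring. }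
split; apply is_series_odd_zero.
- intros k; now rewrite O.
- revert H1; apply is_series_ext; intros k; now rewrite evens_double.
- intros k; now rewrite O.
- revert H2; apply is_series_ext; intros k; now rewrite evens_double.
Qed.

Lemma WW_bound C B k U V q : coef_bound C B k ->
  Rabs (WW k (S q) U V) <= C * ((Rabs U + B * Rabs V) ^ q / INR (fact q)).
Proof.
intros H; eapply Rle_trans; [|apply (WW_norm_bound C B k (Rabs U) (Rabs V) q H); apply Rabs_pos].
unfold WW; rewrite <- !Rsum_sum_n; eapply Rle_trans; [apply sum_n_Rabs|].
right; apply sum_n_ext; intros i; unfold Rdiv; rewrite !Rabs_mult, !RPow_abs.
now rewrite (Rabs_pos_eq (/ _)) by apply Rlt_le, Rinv_0_lt_compat, INR_fact_lt_0.
Qed.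

Lemma ex_series_WW C B k U V T : coef_bound C B k -> 0 <= T ->
  ex_series (fun q => Rabs (WW k (S q) U V) * T ^ q).
Proof.
intros H HT; apply (ex_series_dom _ (fun q => C * (((Rabs U + B * Rabs V) * T) ^ q / INR (fact q)))).
- intros q; assert (P : 0 <= T ^ q) by now apply pow_le.
  rewrite Rabs_mult, Rabs_Rabsolu, (Rabs_pos_eq (T ^ q)), Rpow_mult_distr by trivial.
  replace (C * ((Rabs U + B * Rabs V) ^ q * T ^ q / INR (fact q))) with
    (C * ((Rabs U + B * Rabs V) ^ q / INR (fact q)) * T ^ q) by (field; apply INR_fact_neq_0).
  apply Rmult_le_compat_r; trivial; now apply WW_bound.
- exact (ex_series_scal_l C _ (ex_series_exp _)).
Qed.

(** The Cauchy product of the even series in [sV] with the exponential series in [sU]: collecting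
    equal powers of [s] produces the homogeneous functions [WW]. *)
Lemma CSer_WW C B c s U V : coef_bound C B (evens c) ->
  CSer (fun q => Cmult (RtoC (WW (evens c) (S q) U V)) (Cpow s q))
    (Cmult (CSeries (fun k => Cmult (RtoC (c k * V ^ (2 * k))) (Cpow s (2 * k)))) (Cexp (Cmult s (RtoC U)))).
Proof.
intros H.
generalize (CSer_mult _ _ _ _ (fun i => C * ((B * Rabs V * Cmod s) ^ i / INR (fact i)))
  (fun p => Cmod (Cmult s (RtoC U)) ^ p / INR (fact p)) (CSer_evens C B c s V H) (CSer_Cexp (Cmult s (RtoC U)))).
intros P; assert (Q : CSer (fun n => Csum (fun i => Cmult (Cmult (RtoC (evens c i * V ^ i)) (Cpow s i))
    (Cmult (RtoC (/ INR (fact (n - i)))) (Cpow (Cmult s (RtoC U)) (n - i)))) (S n))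
   (Cmult (CSeries (fun k => Cmult (RtoC (c k * V ^ (2 * k))) (Cpow s (2 * k)))) (Cexp (Cmult s (RtoC U))))).
{ apply P.
  - intros; now apply coef_term_bound.
  - intros n; rewrite Cmod_mult, Cmod_R, Cmod_Cpow.
    rewrite Rabs_pos_eq by apply Rlt_le, Rinv_0_lt_compat, INR_fact_lt_0; unfold Rdiv; lra.
  - exact (ex_series_scal_l C _ (ex_series_exp _)).
  - apply ex_series_exp. }
revert Q; apply CSer_ext; intros n.
rewrite (Csum_ext _ (fun i => Cmult (Cpow s n) (RtoC (evens c i * (U ^ (S n - 1 - i) / INR (fact (S n - 1 - i))) * V ^ i)))).
- rewrite Csum_scal, Csum_RtoC, Cmult_comm; reflexivity.
- intros i Hi; replace (S n - 1 - i)%nat with (n - i)%nat by lia.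
  assert (E : Cpow s n = Cmult (Cpow s i) (Cpow s (n - i))) by (rewrite <- Cpow_add; f_equal; lia).
  rewrite E, Cpow_mult, Cpow_RtoC.
  unfold Rdiv; rewrite !RtoC_mult; ring.
Qed.

Lemma J0_expansion s V : J0 (Cmult s (RtoC V)) = CSeries (fun k => Cmult (RtoC (jc k * V ^ (2 * k))) (Cpow s (2 * k))).
Proof.
unfold J0; apply CSeries_ext; intros k.
rewrite !Cpow_mult, !Cpow_RtoC; unfold jc.
replace ((/ 2) ^ (2 * k)) with (/ 4 ^ k) by (rewrite pow_inv, pow_mult; do 2 f_equal; ring).
rewrite !RtoC_mult; ring.
Qed.

(** * Moments and the expansion of the real part of [phi] *)

Definition geometric (K T : R) (al : nat -> R) : Prop := 0 <= K /\ 0 <= T /\ forall q, Rabs (al q) <= K * T ^ q.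

Lemma geometric_mono K T K' T' al : K <= K' -> T <= T' -> geometric K T al -> geometric K' T' al.
Proof.
intros HK HT [K0 [T0 H]]; split; [lra|split; [lra|]]; intros q; eapply Rle_trans; [apply H|].
apply Rmult_le_compat; trivial; [now apply pow_le|now apply pow_incr].
Qed.

Lemma geometric_plus K T K' T' al al' : geometric K T al -> geometric K' T' al' ->
  geometric (K + K') (Rmax T T') (fun q => al q + al' q).
Proof.
intros H H'; apply (geometric_mono K T K (Rmax T T')) in H; [|lra|apply Rmax_l].
apply (geometric_mono K' T' K' (Rmax T T')) in H'; [|lra|apply Rmax_r].
destruct H as [K0 [T0 H]], H' as [K0' [_ H']]; split; [lra|split; trivial]; intros q.
eapply Rle_trans; [apply Rabs_triang|]; specialize (H q); specialize (H' q); lra.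
Qed.

(** The expansion coefficients [WW kap] are real, so only the real parts of the moments enter; the
    sequence [al] is fixed before [U] and [V]. *)
Lemma J_part_series n g1 a :
  (forall j, (j < n)%nat -> rectifiable (g1 j) /\ bounded_integrable_on (g1 j) (a j)) ->
  exists al K T, geometric K T al /\ forall U V,
   is_series (fun q => al q * WW kap (S q) U V)
     (Re (Csum (fun j => curve_int (g1 j)
      (fun s => Cmult (Cmult (a j s) (Cexp (Cmult s (RtoC U)))) (J0 (Cmult s (RtoC V))))) n)).
Proof.
induction n as [|n IH]; intros H.
- exists (fun _ => 0), 0, 0; split; [split; [lra|split; [lra|]]; intros; rewrite Rabs_R0; lra|].
  intros U V; generalize is_series_0; apply is_series_ext; intros; eqR; ring.
- destruct IH as [al [K [T [G HS]]]]; [intros; apply H; lia|].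
  destruct (H n) as [Hr Hb]; [lia|].
  destruct (curve_moments _ _ Hr Hb) as [m [K' [T' [K0 [T0 [Hm HI]]]]]].
  exists (fun q => al q + Re (m q)), (K + K'), (Rmax T T'); split.
  + apply geometric_plus; trivial; split; trivial; split; trivial; intros q.
    eapply Rle_trans; [apply Re_le_Cmod|apply Hm].
  + intros U V.
    destruct (HI (fun q => RtoC (WW kap (S q) U V))
      (fun s => Cmult (Cmult (a n s) (Cexp (Cmult s (RtoC U)))) (J0 (Cmult s (RtoC V))))
      (fun s => Cmult (J0 (Cmult s (RtoC V))) (Cexp (Cmult s (RtoC U))))) as [H1 _].
    * apply (ex_series_ext (fun q => Rabs (WW kap (S q) U V) * T' ^ q)); [intros; now rewrite Cmod_R|].
      apply (ex_series_WW 1 1); trivial; apply kap_bound.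
    * intros t _; split; [ring|]; rewrite J0_expansion; apply (CSer_WW 1 1 jc); apply kap_bound.
    * generalize (is_series_plus (V := R_NormedModule) _ _ _ _ (HS U V) H1); apply is_series_ext; intros q.
      rewrite Re_RtoC_mult; unfold plus; simpl; eqR; ring.
Qed.

Lemma del_kap_bound : exists C B, coef_bound C B kap /\ coef_bound C B del.
Proof.
exists (1 + 2 / PI * (Rabs euler_gamma + 1)), 2.
assert (P : 0 <= 2 / PI * (Rabs euler_gamma + 1)) by apply del_bound.
split; [apply (coef_bound_mono 1 1); trivial; try lra; apply kap_bound|].
apply (coef_bound_mono (2 / PI * (Rabs euler_gamma + 1)) 2); try lra; apply del_bound.
Qed.

(* The imaginary part of the logarithm of a negative number contributes the sequence ga. *)
Lemma Y_part_series m g2 b :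
  (forall l, (l < m)%nat -> rectifiable (g2 l) /\ bounded_integrable_on (g2 l) (b l)) ->
  exists ga be K T, geometric K T ga /\ geometric K T be /\ forall U V,
   is_series (fun q => TT (if Rlt_dec (V / 2) 0 then ga q else 0) (be q) (S q) U V)
     (Re (Csum (fun l => curve_int (g2 l)
      (fun s => Cmult (Cmult (b l s) (Cexp (Cmult s (RtoC U)))) (Y0_reg s V))) m)).
Proof.
induction m as [|m IH]; intros H.
- exists (fun _ => 0), (fun _ => 0), 0, 0.
  assert (G : geometric 0 0 (fun _ => 0)) by (split; [lra|split; [lra|]]; intros; rewrite Rabs_R0; lra).
  split; trivial; split; trivial; intros U V; generalize is_series_0; apply is_series_ext; intros.
  eqR; unfold TT; destruct Rlt_dec; ring.
- destruct IH as [ga [be [K [T [G1 [G2 HS]]]]]]; [intros; apply H; lia|].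
  destruct (H m) as [Hr Hb]; [lia|].
  destruct (curve_moments _ _ Hr Hb) as [mu [K' [T' [K0 [T0 [Hm HI]]]]]].
  (* For [V < 0] the factor [2 / PI] times the imaginary part [PI] gives [2i], and the real part of
     [2i mu] is [-2] times the imaginary part of [mu]. *)
  exists (fun q => ga q + -2 * Im (mu q)), (fun q => be q + Re (mu q)), (K + 2 * K'), (Rmax T T').
  split; [|split].
  + apply geometric_plus; trivial; split; [lra|split; trivial]; intros q.
    rewrite Rabs_mult, (Rabs_left (-2)) by lra.
    assert (Z := Rle_trans _ _ _ (Im_le_Cmod _) (Hm q)); lra.
  + apply geometric_plus; trivial; split; [lra|split; trivial]; intros q.
    assert (Z := Rle_trans _ _ _ (Re_le_Cmod _) (Hm q)).
    assert (0 <= K' * T' ^ q) by (apply Rmult_le_pos; trivial; now apply pow_le); lra.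
  + intros U V; set (lam := Cmult (RtoC (2 / PI)) (Clog_real (V / 2))).
    destruct del_kap_bound as [C [B [Bk Bd]]].
    destruct (HI (fun q => Cplus (Cmult lam (RtoC (WW kap (S q) U V))) (RtoC (WW del (S q) U V)))
      (fun s => Cmult (Cmult (b m s) (Cexp (Cmult s (RtoC U)))) (Y0_reg s V))
      (fun s => Cmult (Y0_reg s V) (Cexp (Cmult s (RtoC U))))) as [H1 _].
    * apply (ex_series_dom _ (fun q => Cmod lam * (Rabs (WW kap (S q) U V) * T' ^ q) + Rabs (WW del (S q) U V) * T' ^ q)).
      -- intros q; assert (P : 0 <= T' ^ q) by now apply pow_le.
         rewrite Rabs_pos_eq by (apply Rmult_le_pos; trivial; apply Cmod_ge_0).
         rewrite <- Rmult_assoc, <- Rmult_plus_distr_r; apply Rmult_le_compat_r; trivial.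
         eapply Rle_trans; [apply Cmod_triangle|]; rewrite Cmod_mult, !Cmod_R; lra.
      -- apply (ex_series_plus (V := R_NormedModule)).
         ++ exact (ex_series_scal_l (Cmod lam) _ (ex_series_WW C B kap U V T' Bk T0)).
         ++ exact (ex_series_WW C B del U V T' Bd T0).
    * intros t _; split; [ring|].
      set (s := g2 m t); unfold Y0_reg; fold lam.
      generalize (CSer_plus _ _ _ _ (CSer_scal lam _ _ (CSer_WW C B jc s U V Bk)) (CSer_WW C B d_coef s U V Bd)).
      rewrite J0_expansion.
      intros Q; match goal with |- CSer _ ?z => match type of Q with CSer _ ?w => replace z with w by ring end end.
      revert Q; apply CSer_ext; intros q; fold kap del; ring.
    * generalize (is_series_plus (V := R_NormedModule) _ _ _ _ (HS U V) H1); apply is_series_ext; intros q.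
      unfold plus; simpl plus.
      change (TT (if Rlt_dec (V / 2) 0 then ga q else 0) (be q) (S q) U V +
        Re (Cmult (Cplus (Cmult lam (RtoC (WW kap (S q) U V))) (RtoC (WW del (S q) U V))) (mu q)) =
        TT (if Rlt_dec (V / 2) 0 then ga q + -2 * Im (mu q) else 0) (be q + Re (mu q)) (S q) U V).
      unfold TT, lam, Clog_real, Re, Im, Cmult, Cplus, RtoC; simpl fst; simpl snd.
      destruct Rlt_dec; [field; apply PI_neq0|ring].
Qed.

Lemma Y_part_zero m g2 b U V :
  (forall l, (l < m)%nat -> forall t, 0 <= t <= 1 -> b l (g2 l t) = RtoC 0) ->
  Csum (fun l => curve_int (g2 l)
      (fun s => Cmult (Cmult (b l s) (Cexp (Cmult s (RtoC U)))) (Y0_reg s V))) m = RtoC 0.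
Proof.
intros H; induction m as [|m IH]; simpl; trivial.
rewrite IH by (intros; apply H; trivial; lia).
replace (curve_int _ _) with (RtoC 0); [ring|].
symmetry; apply RS_int_eq; apply (is_RS_ext (fun _ => RtoC 0)); [|apply is_RS_0].
intros t Ht; rewrite (H m ltac:(lia) t Ht); ring.
Qed.

(** Two expansions are kept: one with the logarithm, for points with [v <> 0], and, when the [b]
    vanish on their curves, one in [kap] alone that is regular across [V = 0]. *)
Lemma Re_phi_series n m g1 a g2 b :
  (forall j, (j < n)%nat -> rectifiable (g1 j) /\ bounded_integrable_on (g1 j) (a j)) ->
  (forall l, (l < m)%nat -> rectifiable (g2 l) /\ bounded_integrable_on (g2 l) (b l)) ->
  exists al ga be K T, geometric K T al /\ geometric K T ga /\ geometric K T be /\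
   (forall U V, is_series (fun q => TT (al q + if Rlt_dec (V / 2) 0 then ga q else 0) (be q) (S q) U V)
     (Re (phi n m g1 a g2 b U V))) /\
   ((forall l, (l < m)%nat -> forall t, 0 <= t <= 1 -> b l (g2 l t) = RtoC 0) ->
    forall U V, is_series (fun q => al q * WW kap (S q) U V) (Re (phi n m g1 a g2 b U V))).
Proof.
intros Ha Hb.
destruct (J_part_series n g1 a Ha) as [al [K [T [G1 HJ]]]].
destruct (Y_part_series m g2 b Hb) as [ga [be [K' [T' [G2 [G3 HY]]]]]].
exists al, ga, be, (Rmax K K'), (Rmax T T').
split; [revert G1; apply geometric_mono; apply Rmax_l|].
split; [revert G2; apply geometric_mono; apply Rmax_r|].
split; [revert G3; apply geometric_mono; apply Rmax_r|].
split.
- intros U V; generalize (is_series_plus (V := R_NormedModule) _ _ _ _ (HJ U V) (HY U V)).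
  apply is_series_ext; intros q; unfold plus, TT; simpl; eqR; ring.
- intros H0 U V; unfold phi; rewrite (Y_part_zero m g2 b U V H0), Cplus_0_r; apply HJ.
Qed.

(** Geometric growth against factorial decay: up to a constant this is the exponential series at
    [T * x]. *)
Lemma ex_series_majorant K T c C x : ex_series (fun q => K * T ^ q * (c * (C * (x ^ q / INR (fact q))))).
Proof.
generalize (ex_series_scal_l (K * c * C) _ (ex_series_exp (T * x))); apply ex_series_ext; intros q.
transitivity (K * c * C * ((T * x) ^ q / INR (fact q))); [reflexivity|eqR].
rewrite Rpow_mult_distr; field; apply INR_fact_neq_0.
Qed.

Lemma psi_local Omega u v n m g1 a g2 b x0 y0 :
  open2 Omega -> C1_on Omega u -> C1_on Omega v ->
  (forall x y, Omega x y -> dx u x y = dy v x y /\ dy u x y = - dx v x y) ->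
  (forall j, (j < n)%nat -> rectifiable (g1 j) /\ bounded_integrable_on (g1 j) (a j)) ->
  (forall l, (l < m)%nat -> rectifiable (g2 l) /\ bounded_integrable_on (g2 l) (b l)) ->
  Omega x0 y0 ->
  (v x0 y0 <> 0 \/ (forall l, (l < m)%nat -> forall t, 0 <= t <= 1 -> b l (g2 l t) = RtoC 0)) ->
  exists r Mp Mu Mv, 0 < r /\ AE x0 y0 r Mp (psi n m g1 a g2 b u v) /\ AE x0 y0 r Mu u /\ AE x0 y0 r Mv v /\
    Lame (v x0 y0) (dx v x0 y0) (dy v x0 y0) (psi n m g1 a g2 b u v) x0 y0 = 0.
Proof.
intros HO Hu Hv CR Ha Hb H0 Hcase.
destruct (CR_analytic _ _ _ _ _ HO Hu Hv CR H0) as [r [M [Hr [Au [Av Ob]]]]].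
destruct (Re_phi_series n m g1 a g2 b Ha Hb) as [al [ga [be [K [T [G1 [G2 [G3 [S1 S2]]]]]]]]].
destruct del_kap_bound as [C [B [Bk Bd]]].
destruct Hcase as [Hv0|Hzero].
- destruct (AE_ln _ _ _ _ _ Hr Av Hv0) as [r' [L [Hr' [AL Hs]]]].
  assert (Hrr : 0 <= r' <= r) by lra.
  assert (Au' := AE_shrink _ _ _ _ _ _ Hrr Au); assert (Av' := AE_shrink _ _ _ _ _ _ Hrr Av).
  (* The sign test is frozen at the centre. [AE_ln] provides a box on which [v] keeps its sign, so
     there [A q] is a genuine constant and each term is a function [TT] with constant
     coefficients. *)
  set (A q := al q + if Rlt_dec (v x0 y0 / 2) 0 then ga q else 0).
  set (f q x y := TT (A q) (be q) (S q) (u x y) (v x y)).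
  set (Mn q := (K + K) * T ^ q * ((2 + 2 / PI * L) * (C * ((M + B * M) ^ q / INR (fact q))))).
  assert (GA : geometric (K + K) T A).
  { destruct G1 as [K0 [T0 G1]], G2 as [_ [_ G2]]; split; [lra|split; trivial]; intros q; unfold A.
    eapply Rle_trans; [apply Rabs_triang|]; specialize (G1 q); specialize (G2 q).
    destruct Rlt_dec; [lra|rewrite Rabs_R0].
    assert (0 <= K * T ^ q) by (eapply Rle_trans; [apply Rabs_pos|apply G1]); lra. }
  assert (GB : geometric (K + K) T be) by (revert G3; apply geometric_mono; [destruct G1; lra|lra]).
  assert (Af : forall q, AE x0 y0 r' (Mn q) (f q)).
  { intros q; apply AE_TT; trivial; [lra|apply GA|apply GB]. }
  assert (Em : ex_series Mn) by apply ex_series_majorant.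
  assert (Ef : forall x y, Rabs (x - x0) <= r' -> Rabs (y - y0) <= r' ->
    psi n m g1 a g2 b u v x y = Series (fun q => f q x y)).
  { intros x y Hx Hy; symmetry; apply is_series_unique.
    generalize (S1 (u x y) (v x y)); apply is_series_ext; intros q; unfold f, A.
    destruct (Hs x y Hx Hy) as [Hn Hpos].
    assert (Hprod : 0 < v x y * v x0 y0).
    { replace (v x y * v x0 y0) with (v x y / v x0 y0 * (v x0 y0 * v x0 y0)) by (field; trivial).
      apply Rmult_lt_0_compat; trivial; nra. }
    destruct (Rlt_dec (v x y / 2) 0), (Rlt_dec (v x0 y0 / 2) 0); trivial; nra. }
  exists r', (Series Mn), M, M; split; [lra|split; [|split; [trivial|split; trivial]]].
  + apply AE_series with f; trivial; lra.
  + apply (Lame_series x0 y0 r' Mn f); trivial; [lra|]; intros q.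
    assert (Hr0 : 0 < r') by lra.
    refine (Lame_comp _ _ _ _ _ _ _ _ x0 y0 r' M M u v Hr0 Au' Av' _
      (chain_TT (A q) (be q) (S q)) (chain_TT _ _ _) (chain_TTV _ _ _) _).
    * intros x y Hx Hy; destruct (CR x y) as [E1 E2]; [apply Ob; lra|].
      split; trivial; split; trivial; apply Hs; lra.
    * intros U V HV; now apply TT_PDE.
- set (f q x y := al q * WW kap (S q) (u x y) (v x y)).
  set (Mn q := K * T ^ q * (1 * (C * ((M + B * M) ^ q / INR (fact q))))).
  assert (Af : forall q, AE x0 y0 r (Mn q) (f q)).
  { intros q; assert (AW := AE_WW _ _ _ _ _ _ _ _ _ _ q Hr Au Av Bk).
    eapply AE_mono; [|exact (AE_scal _ _ _ _ _ (al q) AW)]; unfold Mn; rewrite Rmult_1_l.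
    apply Rmult_le_compat_r; [exact (AE_ge0 _ _ _ _ _ AW)|apply G1]. }
  assert (Em : ex_series Mn) by apply ex_series_majorant.
  assert (Ef : forall x y, Rabs (x - x0) <= r -> Rabs (y - y0) <= r ->
    psi n m g1 a g2 b u v x y = Series (fun q => f q x y)).
  { intros x y _ _; symmetry; apply is_series_unique, (S2 Hzero). }
  exists r, (Series Mn), M, M; split; [trivial|split; [|split; [trivial|split; trivial]]].
  + now apply AE_series with f.
  + apply (Lame_series x0 y0 r Mn f); trivial; intros q.
    (* Without the logarithm nothing is divided by [V], so the equation holds on the whole plane and
       the domain is [True]. *)
    apply (Lame_comp (fun _ => True) (fun U V => al q * WW kap (S q) U V)
      (fun U V => al q * WW kap q U V) (fun U V => al q * WW (Dseq kap) q U V)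
      (fun U V => al q * WW kap (pred q) U V) (fun U V => al q * WW (Dseq kap) (pred q) U V)
      (fun U V => al q * WW (Dseq kap) (pred q) U V) (fun U V => al q * WW (Dseq (Dseq kap)) (pred q) U V)
      x0 y0 r M M u v Hr Au Av).
    * intros x y Hx Hy; destruct (CR x y) as [E1 E2]; [apply Ob; lra|]; auto.
    * apply chain_scal, (chain_WW _ kap (S q)).
    * apply chain_scal, chain_WW.
    * apply chain_scal, chain_WW.
    * intros U V _; assert (E := WW_L kap (S q) U V); simpl pred in E.
      rewrite (WW_zero (Lseq kap)) in E by apply Lseq_kap.
      transitivity (al q * (V * (WW kap (pred q) U V + WW (Dseq (Dseq kap)) (pred q) U V) + WW (Dseq kap) q U V)); [ring|].
      rewrite E; ring.
Qed.

Lemma Lambda_analytic ps x0 y0 r M : 0 < r -> AE x0 y0 r M ps -> real_analytic_at (Lambda ps) x0 y0.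
Proof.
intros Hr A; assert (H1 : 0 <= r / 2 < r) by lra; assert (H2 : 0 < r / 2) by lra.
destruct (AE_dx _ _ _ _ _ _ H1 A) as [M1 A1], (AE_dy _ _ _ _ _ _ H1 A) as [M2 A2].
apply (AE_analytic _ _ _ _ _ H2 (AE_plus _ _ _ _ _ _ _ (AE_pow _ _ _ _ _ 2 H2 A1) (AE_pow _ _ _ _ _ 2 H2 A2))).
Qed.

Theorem theorem2
  (Omega : R -> R -> Prop) (u v : R -> R -> R)
  (n m : nat) (g1 : nat -> R -> CC) (a : nat -> CC -> CC)
  (g2 : nat -> R -> CC) (b : nat -> CC -> CC) :
  open2 Omega ->
  C1_on Omega u -> C1_on Omega v ->
  (forall x y, Omega x y -> dx u x y = dy v x y /\ dy u x y = - dx v x y) ->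
  (forall j, (j < n)%nat -> rectifiable (g1 j) /\ bounded_integrable_on (g1 j) (a j)) ->
  (forall l, (l < m)%nat -> rectifiable (g2 l) /\ bounded_integrable_on (g2 l) (b l)) ->
  let ps := psi n m g1 a g2 b u v in
  let H := Ham ps in
  let F := Fint ps u v in
  (* F is a first integral: {F,H} = 0 wherever F and H are defined *)
  (forall x y p1 p2, Omega x y ->
     (v x y <> 0 \/
      (forall l, (l < m)%nat -> forall t, 0 <= t <= 1 -> b l (g2 l t) = RtoC 0)) ->
     Lambda ps x y <> 0 ->
     - dy ps x y * p1 + dx ps x y * p2 <> 0 ->
     ex_d4 F x y p1 p2 /\ ex_d4 H x y p1 p2 /\ poisson F H x y p1 p2 = 0) /\
  (* Lambda is analytic where v <> 0 *)
  (forall x y, Omega x y -> v x y <> 0 -> real_analytic_at (Lambda ps) x y) /\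
  (* if all b_l vanish, Lambda is analytic on all of Omega *)
  ((forall l, (l < m)%nat -> forall t, 0 <= t <= 1 -> b l (g2 l t) = RtoC 0) ->
   forall x y, Omega x y -> real_analytic_at (Lambda ps) x y).
Proof.
intros HO Hu Hv CR Ha Hb ps H F.
assert (Loc := fun x y => psi_local Omega u v n m g1 a g2 b x y HO Hu Hv CR Ha Hb).
split; [|split].
- intros x y p1 p2 Hxy Hcase HL HD.
  destruct (Loc x y Hxy Hcase) as [r [Mp [Mu [Mv [Hr [Ap [Au [Av L0]]]]]]]].
  destruct (CR x y Hxy) as [E1 E2].
  now apply (poisson_zero ps u v x y r Mp Mu Mv p1 p2).
- intros x y Hxy Hv0; destruct (Loc x y Hxy (or_introl Hv0)) as [r [Mp [_ [_ [Hr [Ap _]]]]]].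
  exact (Lambda_analytic _ _ _ _ _ Hr Ap).
- intros Hz x y Hxy; destruct (Loc x y Hxy (or_intror Hz)) as [r [Mp [_ [_ [Hr [Ap _]]]]]].
  exact (Lambda_analytic _ _ _ _ _ Hr Ap).
Qed.
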